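(* Let $m$ be a natural number and let $c>1$ be a fixed real number (used in the definition of $P(m,\eta,d)$). Let $\Gamma$ be a group generated by $S=\{s_1,\dots,s_m,s_1^{-1},\dots,s_m^{-1}\}$, and for $P=(S,R)\in P(m,\eta,d)$ let $\Gamma_P'=\Gamma/\overline{R}$, where $\overline{R}$ denotes the normal closure of the subset of $\Gamma$ determined by $R$. Let $0\le\delta<1$ and let $k$ be an integer with $k>1/(1-\delta)$. Let $\mathcal{Y}_\delta$ be the class of $\mathrm{CAT}(0)$ spaces $Y$ with $\delta(Y)\le\delta$. If $k/(2k+1)<d<1$, then $$\lim_{\eta\to\infty}\frac{\#\{P\in P(m,\eta,d)\mid\Gamma_P'\text{ has }F(Y)\text{ for all }Y\in\mathcal{Y}_\delta\}}{\#P(m,\eta,d)}=1.$$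
   Context: Random quotient model. Let $m,\eta\ge1$ be natural numbers and $0<d<1$ a real number. Regard $S=\{s_1,s_1^{-1},\dots,s_m,s_m^{-1}\}$ as a set of $2m$ letters (formal symbols, which may become equal or trivial in $\Gamma$, with $s_i^{-1}$ representing the inverse of $s_i$). A word of length $\eta$ is a sequence of $\eta$ letters of $S$, not necessarily reduced; $W_\eta$ is the set of all words of length $\eta$, so $\#W_\eta=(2m)^\eta$. Each word determines an element of $\Gamma$. Fix a real number $c>1$ and set $$P(m,\eta,d)=\{P=(S,R)\mid R\subset W_\eta,\ c^{-1}(2m)^{d\eta}\le\#R\le c(2m)^{d\eta}\}.$$ Fixed-point property. For a metric space $Y$, a group $G$ has $F(Y)$ if for every homomorphism $\rho:G\to\mathrm{Isom}(Y)$ ($\mathrm{Isom}(Y)$ the group of isometries of $Y$) there is $p\in Y$ with $\rho(\gamma)p=p$ for all $\gamma\in G$. $\mathrm{CAT}(0)$ spaces. A $\mathrm{CAT}(0)$ space is a complete geodesic metric space in which every geodesic triangle satisfies the $\mathrm{CAT}(0)$ inequality (distances between points on its sides are at most the distances between the comparison points on the Euclidean comparison triangle). The invariant $\delta(Y)$. Let $Y$ be a $\mathrm{CAT}(0)$ space with metric $d$. For a finitely supported probability measure $\mu$ on $Y$, its barycenter $\overline\mu$ is the unique point of $Y$ minimizing $q\mapsto\int_Y d(p,q)^2\,d\mu(p)$. If $\mu$ is not a Dirac measure, let $$\delta(\mu)=\inf_{\varphi}\frac{\left|\int_Y\varphi(p)\,d\mu(p)\right|^2}{\int_Y|\varphi(p)|^2\,d\mu(p)},$$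 the infimum being over all maps $\varphi:\mathrm{supp}\,\mu\to\mathcal{H}$ into an infinite-dimensional real Hilbert space $\mathcal{H}$ such that $|\varphi(p)|=d(\overline\mu,p)$ for all $p\in\mathrm{supp}\,\mu$ and $|\varphi(p)-\varphi(q)|\le d(p,q)$ for all $p,q\in\mathrm{supp}\,\mu$. Then $\delta(Y)\in[0,1]$ is the supremum of $\delta(\mu)$ over all finitely supported non-Dirac probability measures $\mu$ on $Y$ (with $\delta(Y)=0$ if $Y$ is a single point). *)

(* Defs.v *)
From HB Require Import structures.
From mathcomp Require Import all_boot all_order all_algebra finmap.
From mathcomp Require Import all_classical all_reals all_analysis.

Set Implicit Arguments.
Unset Strict Implicit.
Unset Printing Implicit Defensive.

Import Order.TTheory GRing.Theory Num.Theory.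
Import numFieldNormedType.Exports.

Local Open Scope classical_set_scope.
Local Open Scope ring_scope.
Local Open Scope quotient_scope.

Section Subgroups.
Local Open Scope group_scope.
Context {G : groupType}.

Definition subgroup (H : set G) : Prop :=
  [/\ H 1, forall x y, H x -> H y -> H (x * y) & forall x, H x -> H x^-1].

Definition normal_subgroup (N : set G) : Prop :=
  subgroup N /\ forall x y, N x -> N (x ^ y).

Definition generated_by (A : set G) : Prop := smallest subgroup A = setT.

Definition normal_closure (A : set G) : set G := smallest normal_subgroup A.

Lemma normal_closureP (A : set G) : normal_subgroup (normal_closure A).
Proof.
split; first split=> [N [[[]]]//|x y Nx Ny N NA|x Nx N NA].
- by case: (NA) => -[[_ NM _] _] _; apply: NM; [exact: Nx|exact: Ny].
- by case: (NA) => -[[_ _ NV] _] _; apply: NV; exact: Nx.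
- by move=> x y Nx N NA; case: (NA) => -[_ NJ] _; apply: NJ; exact: Nx.
Qed.

End Subgroups.

Section Quotient.
Local Open Scope group_scope.
Context {G : groupType}.
Variable A : set G.
Let N := normal_closure A.

Definition ncl_rel : rel G := [rel x y : G | `[< N (x^-1 * y) >]].

Lemma ncl_refl : reflexive ncl_rel.
Proof.
by move=> x; apply/asboolP; rewrite mulVg; case: (normal_closureP A) => -[].
Qed.

Lemma ncl_sym : symmetric ncl_rel.
Proof.
have h x y : ncl_rel x y -> ncl_rel y x.
  move=> /asboolP xy; apply/asboolP; rewrite -[_ * _]invgK invgM invgK.
  by case: (normal_closureP A) => -[_ _ NV] _; exact: NV.
by move=> x y; apply/idP/idP; exact: h.
Qed.

Lemma ncl_trans : transitive ncl_rel.
Proof.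
move=> y x z /asboolP xy /asboolP yz; apply/asboolP.
case: (normal_closureP A) => -[_ NM _] _.
by move: (NM _ _ xy yz); rewrite mulgA mulgK.
Qed.

Canonical ncl_equiv := EquivRel ncl_rel ncl_refl ncl_sym ncl_trans.

Definition quot_ncl : Type := {eq_quot ncl_equiv}.

HB.instance Definition _ := Choice.on quot_ncl.
HB.instance Definition _ := EqQuotient.on quot_ncl.

Definition pi_ncl (x : G) : quot_ncl := \pi_quot_ncl x.

Definition ncl_one : quot_ncl := pi_ncl 1.
Definition ncl_mul (a b : quot_ncl) : quot_ncl := pi_ncl (repr a * repr b).
Definition ncl_inv (a : quot_ncl) : quot_ncl := pi_ncl (repr a)^-1.

Let piE (x y : G) : N (x^-1 * y) -> pi_ncl x = pi_ncl y.
Proof. by move=> xy; apply/eqmodP/asboolP. Qed.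

Let reprP (x : G) : N ((repr (pi_ncl x))^-1 * x).
Proof. by apply/asboolP; apply/(@eqmodP _ ncl_equiv); rewrite reprK. Qed.

Let mul_pi (x y : G) : ncl_mul (pi_ncl x) (pi_ncl y) = pi_ncl (x * y).
Proof.
apply: piE; set x' := repr _; set y' := repr _.
case: (normal_closureP A) => -[_ NM _] NJ.
have -> : (x' * y')^-1 * (x * y) = (x'^-1 * x) ^ y' * (y'^-1 * y).
  by rewrite /conjg invgM !mulgA mulgK.
by apply: NM; [exact: NJ (reprP x)|exact: reprP].
Qed.

Let inv_pi (x : G) : ncl_inv (pi_ncl x) = pi_ncl x^-1.
Proof.
apply: piE; set x' := repr _.
case: (normal_closureP A) => -[_ _ NV] NJ.
have -> : x'^-1^-1 * x^-1 = ((x'^-1 * x)^-1) ^ x'^-1.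
  by rewrite /conjg invgM !invgK !mulgA mulgK.
exact: NJ (NV _ (reprP x)).
Qed.

Let quot_nclW (P : quot_ncl -> Prop) :
  (forall x, P (pi_ncl x)) -> forall a, P a.
Proof. exact: quotW. Qed.

Let mulA : associative ncl_mul.
Proof.
by apply: quot_nclW => x; apply: quot_nclW => y; apply: quot_nclW => z; rewrite !mul_pi mulgA.
Qed.

Let mul1 : left_id ncl_one ncl_mul.
Proof. by apply: quot_nclW => x; rewrite mul_pi mul1g. Qed.

Let mulr1 : right_id ncl_one ncl_mul.
Proof. by apply: quot_nclW => x; rewrite mul_pi mulg1. Qed.

Let mulV : left_inverse ncl_one ncl_inv ncl_mul.
Proof. by apply: quot_nclW => x; rewrite inv_pi mul_pi mulVg. Qed.

Let mulrV : right_inverse ncl_one ncl_inv ncl_mul.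
Proof. by apply: quot_nclW => x; rewrite inv_pi mul_pi mulgV. Qed.

HB.instance Definition _ :=
  isGroup.Build quot_ncl mulA mul1 mulr1 mulV mulrV.

Lemma pi_nclM (x y : G) : pi_ncl (x * y) = pi_ncl x * pi_ncl y.
Proof. by rewrite -mul_pi. Qed.

Lemma pi_nclP (x y : G) :
  pi_ncl x = pi_ncl y <-> normal_closure A (x^-1 * y).
Proof.
by split=> [/(@eqmodP _ ncl_equiv)/asboolP//|]; exact: piE.
Qed.

End Quotient.
Arguments quot_ncl {G} A.
Arguments pi_ncl {G} A x.

(* The letter (i, false) stands for s_i and (i, true) for its inverse. *)
Definition letter (m : nat) : finType := ('I_m * bool)%type.

Definition word (m eta : nat) : finType := eta.-tuple (letter m).

Section Words.
Local Open Scope group_scope.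
Context {G : groupType} {m : nat}.
Variable s : 'I_m -> G.

Definition letter_val (a : letter m) : G :=
  if a.2 then (s a.1)^-1 else s a.1.

Definition word_val (eta : nat) (w : word m eta) : G :=
  \prod_(a <- w) letter_val a.

Definition relators (eta : nat) (Rel : {set word m eta}) : set G :=
  [set g | exists2 w : word m eta, w \in Rel & g = word_val w].

End Words.

(* A presentation (S, R) in P(m, eta, d) is determined by its set R of words. *)
Definition presentations (R : realType) (c : R) (m eta : nat) (d : R) :
    {set {set word m eta}} :=
  [set Rel : {set word m eta} |
    c^-1 * (2 * m)%:R `^ (d * eta%:R) <= #|Rel|%:R
      <= c * (2 * m)%:R `^ (d * eta%:R)]%SET.

Record isom (R : realType) (Y : metricType R) := Isom {
  isom_fun :> Y -> Y;
  isom_dist : forall x y, mdist (isom_fun x) (isom_fun y) = mdist x y;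
  isom_bij : bijective isom_fun }.

Section IsomGroup.
Context {R : realType} (Y : metricType R).

HB.instance Definition _ := gen_eqMixin (isom Y).
HB.instance Definition _ := gen_choiceMixin (isom Y).

Lemma isom_ext (f g : isom Y) : f =1 g -> f = g.
Proof.
case: f g => [f fd fb] [g gd gb] /= /funext fg; rewrite -{g}fg in gd gb *.
by congr Isom; exact: Prop_irrelevance.
Qed.

Definition isom_one : isom Y :=
  @Isom R Y id (fun _ _ => erefl) (Bijective (frefl _) (frefl _)).

Lemma isom_mul_dist (f g : isom Y) x y :
  mdist ((f \o g) x) ((f \o g) y) = mdist x y.
Proof. by rewrite /= !isom_dist. Qed.

Definition isom_mul (f g : isom Y) : isom Y :=
  Isom (isom_mul_dist f g) (bij_comp (isom_bij f) (isom_bij g)).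

Lemma isom_inv_ex (f : isom Y) : {g : isom Y | cancel f g & cancel g f}.
Proof.
apply: cid2; case: (isom_bij f) => g fK gK.
have gd x y : mdist (g x) (g y) = mdist x y by rewrite -(isom_dist f) !gK.
by exists (Isom gd (Bijective gK fK)).
Qed.

Definition isom_inv (f : isom Y) : isom Y := s2val (isom_inv_ex f).

Let mulA : associative isom_mul.
Proof. by move=> f g h; exact: isom_ext. Qed.

Let mul1 : left_id isom_one isom_mul.
Proof. by move=> f; exact: isom_ext. Qed.

Let mulr1 : right_id isom_one isom_mul.
Proof. by move=> f; exact: isom_ext. Qed.

Let mulV : left_inverse isom_one isom_inv isom_mul.
Proof.
by move=> f; apply: isom_ext => x; exact: (s2valP (isom_inv_ex f)).
Qed.

Let mulrV : right_inverse isom_one isom_inv isom_mul.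
Proof.
by move=> f; apply: isom_ext => x; exact: (s2valP' (isom_inv_ex f)).
Qed.

HB.instance Definition _ :=
  isGroup.Build (isom Y) mulA mul1 mulr1 mulV mulrV.

End IsomGroup.

Definition has_F (R : realType) (G : groupType) (Y : metricType R) : Prop :=
  forall rho : {multiplicative G -> isom Y},
    exists p : Y, forall g : G, rho g p = p.

(* The norm of the library on 'rV[R]_2 is the sup norm. *)
Definition eucl_dist (R : realType) (a b : 'rV[R]_2) : R :=
  Num.sqrt (\sum_i (a 0 i - b 0 i) ^+ 2).

(* x is the point of the segment [a, b] at distance t from a. *)
Definition comparison_point (R : realType) (a b : 'rV[R]_2) (t : R)
    (x : 'rV[R]_2) : Prop :=
  (exists2 u : R, 0 <= u <= 1 & x = (1 - u) *: a + u *: b) /\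
  eucl_dist a x = t.

Section CAT0.
Context {R : realType} (Y : metricType R).

(* Geodesics are parametrized by arc length on [0, mdist x y]; the values of
   gamma outside this interval are irrelevant. *)
Definition geodesic (x y : Y) (gamma : R -> Y) : Prop :=
  [/\ gamma 0 = x, gamma (mdist x y) = y &
      forall s t, 0 <= s <= mdist x y -> 0 <= t <= mdist x y ->
        mdist (gamma s) (gamma t) = `|s - t|].

Definition geodesic_space : Prop :=
  forall x y : Y, exists gamma, geodesic x y gamma.

Definition complete_space : Prop :=
  forall F : set_system Y, ProperFilter F -> cauchy F -> exists y : Y, F --> y.

(* A geodesic triangle has vertices v 0, v 1, v 2; its side number i is the
   geodesic side i from v i to v (i + 1), where i + 1 is taken modulo 3. *)
Definition CAT0_inequality : Prop :=
  forall (v : 'I_3 -> Y) (side : 'I_3 -> R -> Y) (v' : 'I_3 -> 'rV[R]_2),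
    (forall i, geodesic (v i) (v (ordS i)) (side i)) ->
    (forall i, eucl_dist (v' i) (v' (ordS i)) = mdist (v i) (v (ordS i))) ->
    forall (i j : 'I_3) (s t : R) (x' y' : 'rV[R]_2),
      0 <= s <= mdist (v i) (v (ordS i)) ->
      0 <= t <= mdist (v j) (v (ordS j)) ->
      comparison_point (v' i) (v' (ordS i)) s x' ->
      comparison_point (v' j) (v' (ordS j)) t y' ->
      mdist (side i s) (side j t) <= eucl_dist x' y'.

(* The empty space is excluded: no group has a fixed point on it. *)
Definition CAT0 : Prop :=
  [/\ [set: Y] !=set0, complete_space, geodesic_space & CAT0_inequality].

End CAT0.

Definition is_hilbert (R : realType) (H : completeNormedModType R) : Prop :=
  exists ip : {dot H for idfun}, forall x : H, `|x| ^+ 2 = ip x x.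

Definition infinite_dimensional (R : realType) (H : lmodType R) : Prop :=
  ~ exists (n : nat) (e : 'I_n -> H),
      forall x : H, exists a : 'I_n -> R, x = \sum_i a i *: e i.

Section Delta.
Context {R : realType} (Y : metricType R).

(* A finitely supported measure on Y is given by the masses of points;
   finsupp mu is then its support. *)
Definition is_prob (mu : {fsfun Y -> R with 0}) : Prop :=
  (forall p, 0 <= mu p) /\ \sum_(p : finsupp mu) mu (val p) = 1.

Definition is_dirac (mu : {fsfun Y -> R with 0}) : Prop :=
  exists p : Y, finsupp mu = [fset p]%fset.

Definition sq_dist_integral (mu : {fsfun Y -> R with 0}) (q : Y) : R :=
  \sum_(p : finsupp mu) mu (val p) * mdist (val p) q ^+ 2.

Definition is_barycenter (mu : {fsfun Y -> R with 0}) (b : Y) : Prop :=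
  forall q : Y, q <> b -> sq_dist_integral mu b < sq_dist_integral mu q.

Definition admissible (mu : {fsfun Y -> R with 0}) (b : Y)
    (H : completeNormedModType R) (phi : finsupp mu -> H) : Prop :=
  (forall p, `|phi p| = mdist b (val p)) /\
  (forall p q, `|phi p - phi q| <= mdist (val p) (val q)).

Definition delta_ratio (mu : {fsfun Y -> R with 0})
    (H : completeNormedModType R) (phi : finsupp mu -> H) : R :=
  `|\sum_(p : finsupp mu) mu (val p) *: phi p| ^+ 2 /
  \sum_(p : finsupp mu) mu (val p) * `|phi p| ^+ 2.

(* All infinite-dimensional Hilbert spaces give the same infimum, because the
   support of mu is finite. *)
Definition delta_meas (mu : {fsfun Y -> R with 0}) : R :=
  inf [set r | exists (b : Y) (H : completeNormedModType R)
                      (phi : finsupp mu -> H),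
       [/\ is_barycenter mu b, is_hilbert H, infinite_dimensional H,
           admissible b phi & r = delta_ratio phi]].

(* The real supremum of the empty set is 0, as required when Y is a point. *)
Definition delta_space : R :=
  sup [set r | exists mu : {fsfun Y -> R with 0},
       [/\ is_prob mu, ~ is_dirac mu & r = delta_meas mu]].

End Delta.

(* Main.v *)
Require Import Defs.
From HB Require Import structures.
From mathcomp Require Import all_boot all_order all_algebra finmap.
From mathcomp Require Import all_classical all_reals all_analysis.
From mathcomp Require Import ring lra zify.

(* Cut a relator of length eta as u v w with |u| = |w| = n, |v| = l, eta = 2n + l
   and n >= k l. For a homomorphism rho to Isom(Y) and x in Y put f(u) = rho(u) x
   and E(x) = mean over |v| = l of d(rho(v) x, x)^2. A relator joins u to the formal
   inverse of w by an edge along which f moves by d(x, rho(v) x). Because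
   d > k/(2k+1), the random graph on the (2m)^n words has degree at least a power
   of the number of vertices, so it is an expander whose spectral gap is almost
   that of the complete graph; the inequality survives for Hilbert space valued
   maps, and delta(Y) <= delta transports it to Y: the variance of f over words of
   length n is at most C E(x) with C < k. On the other hand, if x is close to the
   barycenter of its translates by the words of length l, the CAT(0) variance
   inequality adds about E(x) to the variance for each of the k blocks of length l.
   Hence x is far from that barycenter, moving towards it multiplies E by a factor
   theta < 1, and iterating gives a point with E = 0.

   The operator norm of the centred edge matrix S is controlled by the trace of
   (S S^T)^h for a large fixed power of two h: an index occurring once in a closed
   walk contributes 0, so only (#I)^h walks of length 2h matter. Sets of relators
   of prescribed size are compared with i.i.d. samples of size (2m)^e, e <= eta/2,
   which is possible because the fixed-point property passes to larger sets of
   relators. *)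

Set Implicit Arguments.
Unset Strict Implicit.
Unset Printing Implicit Defensive.

Import Order.TTheory GRing.Theory Num.Theory.
Import numFieldNormedType.Exports.

Local Open Scope classical_set_scope.
Local Open Scope ring_scope.

(** * Words *)

(** The class of spaces [Y] is far too large for a union bound, so the random event must not mention
    [Y], nor [Gamma]: [good_sample] is purely combinatorial, and all geometry is deterministic once
    it holds. The condition on d is a comparison of exponents: with l just below eta / (2k + 1)
    there are about (2m)^(k eta / (2k + 1)) vertices, against about (2m)^(d eta) edges. An edge
    joins the first part of a relator to its last part, so the edge matrix is not symmetric. The
    vertex set is therefore doubled and two maps are compared, f and f composed with formal
    inversion; they differ by a permutation, hence share barycenter and variance. The ideal constant
    in the variance bound is 1 / (2 (1 - delta)). The hypothesis k > 1 / (1 - delta) leaves a factor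
    2, so a fixed spectral error 1/10 suffices and no limit in it is taken. The trace loses one
    factor N, the number of vertices, while each unit of h gains a power N / M, for M relators in
    the sample; hence h depends only on d and k, not on eta. *)

Section TupleSplit.
Context {T : finType} {n l : nat}.
Implicit Types (w : (n + l).-tuple T).

Fact tuple_fst_subproof w : size (take n w) == n.
Proof. by rewrite size_takel // size_tuple leq_addr. Qed.
Definition tuple_fst w : n.-tuple T := Tuple (tuple_fst_subproof w).

Fact tuple_snd_subproof w : size (drop n w) == l.
Proof. by rewrite size_drop size_tuple addKn. Qed.
Definition tuple_snd w : l.-tuple T := Tuple (tuple_snd_subproof w).

Lemma cat_tuple_split w : cat_tuple (tuple_fst w) (tuple_snd w) = w.
Proof. by apply: val_inj; rewrite /= cat_take_drop. Qed.

Lemma tuple_fst_cat (u : n.-tuple T) (v : l.-tuple T) : tuple_fst (cat_tuple u v) = u.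
Proof. by apply: val_inj; rewrite /= take_size_cat // size_tuple. Qed.

Lemma tuple_snd_cat (u : n.-tuple T) (v : l.-tuple T) : tuple_snd (cat_tuple u v) = v.
Proof. by apply: val_inj; rewrite /= drop_size_cat // size_tuple. Qed.

Lemma sum_cat_tuple (R : nmodType) (F : (n + l).-tuple T -> R) :
  \sum_w F w = \sum_(u : n.-tuple T) \sum_(v : l.-tuple T) F (cat_tuple u v).
Proof.
rewrite pair_big (reindex (fun p : n.-tuple T * l.-tuple T => cat_tuple p.1 p.2)) //=.
exists (fun w => (tuple_fst w, tuple_snd w)) => [[u v] _|w _] /=.
  by rewrite tuple_fst_cat tuple_snd_cat.
by rewrite cat_tuple_split.
Qed.

End TupleSplit.

Lemma sum_tuple_cat (R : nmodType) (T : finType) n l (F : seq T -> R) :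
  \sum_(w : (n + l).-tuple T) F w =
  \sum_(u : n.-tuple T) \sum_(v : l.-tuple T) F (u ++ v).
Proof. exact: sum_cat_tuple. Qed.

Lemma sum_tuple_cons (R : nmodType) (T : finType) n (F : seq T -> R) :
  \sum_(w : n.+1.-tuple T) F w = \sum_a \sum_(v : n.-tuple T) F (a :: v).
Proof.
rewrite pair_big (reindex (fun p : T * n.-tuple T => [tuple of p.1 :: p.2])) //=.
exists (fun w => (thead w, [tuple of behead w])) => [[a v] _|w _] /=.
  by congr pair; apply: val_inj.
by rewrite -tuple_eta.
Qed.

Lemma expr_sum_tuple (R : comNzRingType) (T : finType) n (a : T -> R) :
  (\sum_i a i) ^+ n = \sum_(t : n.-tuple T) \prod_(j <- t) a j.
Proof.
elim: n => [|n IH].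
  rewrite expr0 (eq_bigr (fun=> 1)) => [|t _]; last by rewrite tuple0 big_nil.
  by rewrite sumr_const card_tuple expn0.
rewrite (sum_tuple_cons n (fun s => \prod_(j <- s) a j)) exprS IH mulr_suml; apply: eq_bigr => i _.
by rewrite mulr_sumr; apply: eq_bigr => t _; rewrite big_cons.
Qed.

(** * Geometry of CAT(0) spaces *)

Section CatZero.
Context {R : realType} (Y : metricType R).
Local Notation "d[ x , y ]" := (mdist x y) (format "d[ x ,  y ]").

(** The Bruhat-Tits inequality at every parameter t, with z playing the point at fraction t of a
    geodesic. Together with completeness it is the only geometric consequence of [CAT0] used
    below. *)
Definition cn_space : Prop :=
  forall (x y : Y) (t : R), 0 <= t <= 1 ->
    exists z : Y, forall q : Y,
      d[z, q] ^+ 2 <= (1 - t) * d[x, q] ^+ 2 + t * d[y, q] ^+ 2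
                      - t * (1 - t) * d[x, y] ^+ 2.

Definition vec2 (a b : R) : 'rV[R]_2 := \row_i (if i == 0 then a else b).

Lemma eucl_dist_vec2 (a b a' b' : R) :
  eucl_dist (vec2 a b) (vec2 a' b') = Num.sqrt ((a - a') ^+ 2 + (b - b') ^+ 2).
Proof.
by rewrite /eucl_dist !big_ord_recl big_ord0 !mxE /= addr0.
Qed.

Lemma vec2_lin (u v a b a' b' : R) :
  u *: vec2 a b + v *: vec2 a' b' = vec2 (u * a + v * a') (u * b + v * b').
Proof. by apply/rowP => i; rewrite !mxE; case: (i == 0). Qed.

(** The planar triangle with side c on the first axis; p is the abscissa of the third vertex given
    by the law of cosines. *)
Definition comparison_vertex (a b c : R) (i : 'I_3) : 'rV[R]_2 :=
  let p := (b ^+ 2 + c ^+ 2 - a ^+ 2) / (2 * c) in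
  if i == 0 then vec2 0 0 else
  if i == 1 then vec2 c 0 else vec2 p (Num.sqrt (b ^+ 2 - p ^+ 2)).

Lemma cat0_cn : CAT0 Y -> cn_space.
Proof.
move=> [_ _ geoY catY] x y t /andP[t0 t1].
have [<-|neqxy] := eqVneq x y.
  by exists x => q; rewrite mdistxx; lra.
have [g0 g0P] := geoY x y.
exists (g0 (t * d[x, y])) => q.
have [g1 g1P] := geoY y q.
have [g2 g2P] := geoY q x.
set c := d[x, y]; set a := d[y, q]; set b := d[x, q].
have c0 : 0 < c by rewrite mdist_gt0.
have a0 : 0 <= a by exact: mdist_ge0.
have b0 : 0 <= b by exact: mdist_ge0.
have cab : c <= b + a by rewrite /c /b /a (metric_sym y); exact: metric_triangle.
have abc : a <= c + b by rewrite /c /b /a (metric_sym x y); exact: metric_triangle.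
have bac : b <= c + a by exact: metric_triangle.
pose v (i : 'I_3) := if i == 0 then x else if i == 1 then y else q.
pose side (i : 'I_3) := if i == 0 then g0 else if i == 1 then g1 else g2.
pose v' := comparison_vertex a b c.
pose p := (b ^+ 2 + c ^+ 2 - a ^+ 2) / (2 * c).
have pE : 2 * c * p = b ^+ 2 + c ^+ 2 - a ^+ 2.
  by rewrite /p mulrC divfK // mulf_neq0 ?gt_eqF.
(* Heron's formula: 4 c^2 (b^2 - p^2) is 16 times the squared area, a product of four factors that
   are nonnegative by the triangle inequalities. *)
have pb : 0 <= b ^+ 2 - p ^+ 2.
  have c2 : 0 < 4 * c ^+ 2 by rewrite mulr_gt0 ?exprn_gt0.
  rewrite -(pmulr_rge0 _ c2).
  have -> : 4 * c ^+ 2 * (b ^+ 2 - p ^+ 2) =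
     (2 * c * b - 2 * c * p) * (2 * c * b + 2 * c * p) by ring.
  rewrite pE.
  have -> : 2 * c * b - (b ^+ 2 + c ^+ 2 - a ^+ 2) = (a - b + c) * (a + b - c) by ring.
  have -> : 2 * c * b + (b ^+ 2 + c ^+ 2 - a ^+ 2) = (b + c - a) * (a + b + c) by ring.
  by rewrite !mulr_ge0 //; lra.
have sb := sqr_sqrtr pb.
(* The vertex q enters the comparison as the point at parameter 0 of the third side, which starts at
   q. *)
have H := catY v side v' _ _ 0 (inord 2) (t * c) 0 (vec2 (t * c) 0) (v' (inord 2)).
have i20 : (inord 2 == 0 :> 'I_3) = false by rewrite -val_eqE /= inordK.
have i21 : (inord 2 == 1 :> 'I_3) = false by rewrite -val_eqE /= inordK.
have {}H : mdist (g0 (t * c)) q <= eucl_dist (vec2 (t * c) 0) (v' (inord 2)).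
  have [_ _ _] := g0P; have [g20 _ _] := g2P.
  suff: mdist (side 0 (t * c)) (side (inord 2) 0) <= eucl_dist (vec2 (t * c) 0) (v' (inord 2)).
    by rewrite /side /= i20 i21 g20.
  apply: H.
  - by case=> [[|[|[|//]]] hi].
  - case=> [[|[|[|//]]] hi]; rewrite /v' /comparison_vertex /v /=.
    + rewrite eucl_dist_vec2 -/c subrr expr0n addr0 sub0r sqrrN sqrtr_sqr.
      by rewrite ger0_norm // ltW.
    + rewrite eucl_dist_vec2 -/a -/p sub0r sqrrN sb.
      have -> : (c - p) ^+ 2 + (b ^+ 2 - p ^+ 2) = c ^+ 2 + b ^+ 2 - 2 * c * p by ring.
      rewrite pE [X in Num.sqrt X](_ : _ = a ^+ 2); last by ring.
      by rewrite sqrtr_sqr ger0_norm.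
    + rewrite eucl_dist_vec2 -/p !subr0 sb addrC subrK sqrtr_sqr metric_sym.
      by rewrite ger0_norm.
  - rewrite /v /= -/c mulr_ge0 ?(ltW c0)//= ler_piMl // ltW //.
  - by rewrite lexx mdist_ge0.
  - split.
      exists t; first by rewrite t0.
      by rewrite /v' /comparison_vertex /= vec2_lin; congr vec2; ring.
    rewrite /v' /comparison_vertex /= eucl_dist_vec2 subrr expr0n addr0 sub0r sqrrN.
    by rewrite sqrtr_sqr ger0_norm // mulr_ge0 // ltW.
  - split.
      by exists 0; rewrite ?lexx ?ler01 // subr0 scale1r scale0r addr0.
    by rewrite /eucl_dist big1 ?sqrtr0 // => i _; rewrite subrr expr0n.
rewrite -[leLHS]ger0_norm ?exprn_ge0 ?mdist_ge0 // normrX ger0_norm ?mdist_ge0 //.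
have {}H : d[g0 (t * c), q] ^+ 2 <= eucl_dist (vec2 (t * c) 0) (v' (inord 2)) ^+ 2.
  by rewrite lerXn2r ?nnegrE ?mdist_ge0 // sqrtr_ge0.
apply: le_trans H _.
rewrite /v' /comparison_vertex i20 i21 -/p eucl_dist_vec2 sqr_sqrtr; last first.
  by rewrite addr_ge0 ?sqr_ge0.
rewrite sub0r sqrrN sb.
have -> : (t * c - p) ^+ 2 + (b ^+ 2 - p ^+ 2) =
  t ^+ 2 * c ^+ 2 + b ^+ 2 - t * (2 * c * p) by ring.
rewrite pE.
by rewrite le_eqVlt; apply/orP; left; apply/eqP; ring.
Qed.

Lemma complete_cauchy_seq (u : nat -> Y) : complete_space Y ->
  (forall e : R, 0 < e -> exists N, forall n m, (N <= n)%N -> (N <= m)%N ->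
     d[u n, u m] < e) ->
  exists y, forall e : R, 0 < e -> exists N, forall n, (N <= n)%N -> d[y, u n] < e.
Proof.
move=> cY uC.
have [|y uy] := cY (u @ \oo) _.
  apply: cauchy_exP => e e0; have [N uN] := uC e e0.
  exists (u N); exists N => // n /= Nn; rewrite ballEmdist /=.
  exact: uN.
exists y => e e0.
have /(_ _ e e0) [N _ uN] := (@metricType_numDomainType.cvgr_dist_lt _ _ _ _ _ _ _ uy).
by exists N.
Qed.

Lemma complete_geometric_seq (u : nat -> Y) (C theta : R) : complete_space Y ->
  0 <= theta < 1 -> (forall n, d[u n, u n.+1] <= C * theta ^+ n) ->
  exists y, forall e : R, 0 < e -> exists N, forall n, (N <= n)%N -> d[y, u n] < e.
Proof.
move=> cY /andP[th0 th1] uC; apply: complete_cauchy_seq => // e e0.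
have C0 : 0 <= C by have := uC 0; rewrite expr0 mulr1; apply: le_trans; exact: mdist_ge0.
have th1' : 0 < 1 - theta by rewrite subr_gt0.
pose K := C / (1 - theta).
have K0 : 0 <= K by rewrite divr_ge0 // ltW.
have CK : C = K * (1 - theta) by rewrite divfK ?gt_eqF.
have tail n j : d[u n, u (n + j)%N] <= K * theta ^+ n.
  suff : d[u n, u (n + j)%N] <= K * (theta ^+ n - theta ^+ (n + j)).
    move/le_trans; apply; rewrite ler_wpM2l //.
    by rewrite gerBl exprn_ge0.
  elim: j => [|j IH]; first by rewrite addn0 mdistxx subrr mulr0.
  rewrite (le_trans (metric_triangle _ (u (n + j)%N) _)) // addnS.
  apply: le_trans (lerD IH (uC _)) _.
  by rewrite CK exprS le_eqVlt; apply/orP; left; apply/eqP; ring.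
have : (fun n => theta ^+ n) @ \oo --> (0 : R) by apply: cvg_expr; rewrite ger0_norm.
move/cvgrPdist_lt => /(_ (e / (2 * (K + 1)))) [|N _ HN].
  by rewrite divr_gt0 // mulr_gt0 //; lra.
have {}HN : K * theta ^+ N < e / 2.
  have := HN N (leqnn N); rewrite /= sub0r normrN ger0_norm ?exprn_ge0 // => h.
  have : (K + 1) * theta ^+ N < e / 2.
    rewrite mulrC -ltr_pdivlMr; last by lra.
    by rewrite (_ : _ / _ / _ = e / (2 * (K + 1))) // invfM mulrA.
  apply: le_lt_trans; rewrite ler_wpM2r ?exprn_ge0 //; lra.
exists N => n m Nn Nm.
rewrite (le_lt_trans (metric_triangle _ (u N) _)) // (metric_sym (u n)).
have := tail N (n - N)%N; have := tail N (m - N)%N; rewrite !subnKC // -/K.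
lra.
Qed.

(** * Barycenters of finite families *)

Section Barycenter.
Context (I : finType) (i0 : I).
Implicit Types f : I -> Y.

Definition sumsq f (q : Y) : R := \sum_i d[f i, q] ^+ 2.

(** The variance inequality: the barycenter of the family [f], in a quantitative form that also
    yields uniqueness. *)
Definition variance_center f (b : Y) : Prop :=
  forall q, sumsq f b + #|I|%:R * d[b, q] ^+ 2 <= sumsq f q.

Let card_gt0 : 0 < #|I|%:R :> R.
Proof. by rewrite ltr0n; apply/card_gt0P; exists i0. Qed.

Lemma sumsq_ge0 f q : 0 <= sumsq f q.
Proof. by apply: sumr_ge0 => i _; rewrite sqr_ge0. Qed.

Lemma sumsq_cn f x y t : cn_space -> 0 <= t <= 1 -> exists z,
  sumsq f z <= (1 - t) * sumsq f x + t * sumsq f y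
               - t * (1 - t) * (#|I|%:R * d[x, y] ^+ 2).
Proof.
move=> cn t01; have [z zP] := cn x y t t01; exists z.
rewrite /sumsq !mulr_sumr -big_split /=.
have -> : #|I|%:R * d[x, y] ^+ 2 = \sum_(i : I) d[x, y] ^+ 2.
  by rewrite sumr_const mulr_natl.
rewrite mulr_sumr -sumrB; apply: ler_sum => i _.
by rewrite !(metric_sym (f i)); exact: zP.
Qed.

Lemma sumsq_perturb f b u h : d[u, b] <= h ->
  sumsq f b <= (1 + h) * sumsq f u + #|I|%:R * (h + h ^+ 2).
Proof.
move=> ubh; have h0 : 0 <= h by apply: le_trans ubh; exact: mdist_ge0.
rewrite /sumsq mulr_sumr -[in X in _ + X]sum1_card natr_sum mulr_suml -big_split /=.
apply: ler_sum => i _; rewrite mul1r.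
have := metric_triangle (f i) u b; have := @mdist_ge0 _ _ (f i) b.
have := @mdist_ge0 _ _ (f i) u.
move: (mdist (f i) u) (mdist (f i) b) => a c a0 c0 ca.
have : c ^+ 2 <= (a + h) ^+ 2 by rewrite lerXn2r ?nnegrE //; lra.
move/le_trans; apply.
rewrite -subr_ge0 (_ : _ - _ = h * (a - 1) ^+ 2); last by ring.
by rewrite mulr_ge0 // sqr_ge0.
Qed.

(** First variation along the segment from b to q: minimality of b gives (1 - t) X <= Z for small t,
    hence X <= Z. *)
Lemma variance_center_min f b : cn_space ->
  (forall q, sumsq f b <= sumsq f q) -> variance_center f b.
Proof.
move=> cn bmin q; set X := #|I|%:R * _.
have X0 : 0 <= X by rewrite mulr_ge0 ?ler0n ?sqr_ge0.
rewrite -lerBrDl leNgt; apply/negP => lt.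
set Z := sumsq f q - sumsq f b in lt.
have Z0 : 0 <= Z by rewrite subr_ge0.
have X1 : 0 < X by apply: le_lt_trans lt.
(* With this t, (1 - t) X is the midpoint of X and Z, which exceeds Z if Z < X. *)
pose t := (X - Z) / (2 * X).
have tX : t * X = (X - Z) / 2.
  by rewrite /t; field; rewrite gt_eqF.
have XZ : 0 < X - Z by rewrite subr_gt0.
have X2 : 0 < 2 * X by rewrite mulr_gt0.
have t0 : 0 < t by exact: divr_gt0.
have t1 : t <= 1.
  by rewrite ler_pdivrMr // mul1r; move: Z0 X1; clearbody X Z => *; lra.
have [z zP] := sumsq_cn f b q cn (introT andP (conj (ltW t0) t1)).
have : t * ((1 - t) * X) <= t * Z.
  by have := bmin z; rewrite /Z; move: zP; rewrite -/X; lra.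
rewrite ler_pM2l // mulrBl mul1r tX; lra.
Qed.

Lemma barycenter_exists f : cn_space -> complete_space Y ->
  exists b, variance_center f b.
Proof.
move=> cn cY.
pose S := range (sumsq f).
have S0 : has_inf S.
  split; first by exists (sumsq f (f i0)); exists (f i0).
  by exists 0 => _ [q _ <-]; exact: sumsq_ge0.
have infS q : inf S <= sumsq f q by apply: ge_inf; [case: S0|exists q].
(* Tolerance 4^-n makes a minimizing sequence Cauchy at geometric speed: the midpoint of two
   consecutive terms cannot go below the infimum, which bounds their distance by a multiple of
   2^-n. *)
have /choice[u uP] : forall n : nat, exists q, sumsq f q < inf S + (4^-1) ^+ n.
  move=> n; have e4 : 0 < (4^-1 : R) ^+ n by rewrite exprn_gt0 // invr_gt0.
  by have [_ [q _ <-] h] := inf_adherent e4 S0; exists q.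
have near n : d[u n, u n.+1] <= 2 * (2^-1) ^+ n.
  have half01 : 0 <= (2^-1 : R) <= 1 by apply/andP; split; lra.
  have [z zP] := sumsq_cn f (u n) (u n.+1) cn half01.
  have uz := infS z; have u1 := uP n; have u2 := uP n.+1.
  have p0 : 0 <= (4^-1 : R) ^+ n by rewrite exprn_ge0.
  have I1 : 1 <= #|I|%:R :> R by rewrite ler1n -(ltr0n R).
  set D := d[u n, u n.+1] in zP *.
  have D2 : D ^+ 2 <= #|I|%:R * D ^+ 2 by rewrite ler_peMl ?sqr_ge0.
  have : D ^+ 2 <= (2 * (2^-1) ^+ n) ^+ 2.
    rewrite exprMn -exprM mulnC exprM expr2 (_ : 2^-1 ^+ 2 = 4^-1 :> R); last first.
      by rewrite expr2; lra.
    move: u2; rewrite exprS; move: zP D2; move: (#|I|%:R * D ^+ 2) => W.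
    lra.
  by rewrite ler_pXn2r ?nnegrE ?mdist_ge0 // mulr_ge0 // exprn_ge0 // invr_ge0.
have half01 : 0 <= (2^-1 : R) < 1 by apply/andP; split; lra.
have [b bP] := complete_geometric_seq cY half01 near.
exists b; apply: variance_center_min => // q; apply: le_trans (infS q).
apply/ler_addgt0Pr => e e0.
have m0 : 0 <= inf S by apply: lb_le_inf; [case: S0|move=> _ [z _ <-]; exact: sumsq_ge0].
pose K := inf S + 2 + 2 * #|I|%:R.
have K0 : 0 < K by rewrite /K; move: card_gt0; lra.
pose h := Num.min 1 (e / K).
have h0 : 0 < h by rewrite lt_min ltr01 divr_gt0.
have h1 : h <= 1 by rewrite ge_min lexx.
have hK : h * K <= e by rewrite -ler_pdivlMr // ge_min lexx orbT.
have [N uN] := bP h h0.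
have : (fun n => (4^-1 : R) ^+ n) @ \oo --> (0 : R).
  by apply: cvg_expr; rewrite ger0_norm ?invf_lt1 ?ltr1n // invr_ge0.
move/cvgrPdist_lt => /(_ h h0) [M _ HM].
pose n := maxn N M.
have := HM n (leq_maxr _ _); rewrite /= sub0r normrN ger0_norm ?exprn_ge0 // => hn.
have := uN n (leq_maxl _ _); rewrite metric_sym => /ltW /(sumsq_perturb f).
move/le_trans; apply.
have sn : sumsq f (u n) <= inf S + h by have := uP n; lra.
have : (1 + h) * sumsq f (u n) <= (1 + h) * (inf S + h) by rewrite ler_wpM2l //; lra.
move: hK; rewrite /K.
have h2 : h ^+ 2 <= h by rewrite expr2 ler_piMl // ltW.
have : #|I|%:R * (h + h ^+ 2) <= #|I|%:R * (2 * h) by rewrite ler_wpM2l //; lra.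
lra.
Qed.

End Barycenter.

(** * Displacement energy of a symmetric family of isometries *)

Section Displacement.
Context (I : finType) (i0 : I) (g : I -> Y -> Y) (inv : I -> I).
Hypothesis g_dist : forall i x y, d[g i x, g i y] = d[x, y].
Hypothesis inv_bij : bijective inv.
Hypothesis g_inv : forall i x y, d[g i x, y] = d[x, g (inv i) y].

Definition energy (x : Y) : R := sumsq (g ^~ x) x.

Lemma energy_ge0 x : 0 <= energy x.
Proof. exact: sumsq_ge0. Qed.

Lemma sumsq_inv x y : \sum_i d[x, g i y] ^+ 2 = sumsq (g ^~ x) y.
Proof.
rewrite (reindex inv) /=; last exact: onW_bij.
by apply: eq_bigr => i _; rewrite g_inv.
Qed.

(** Convexity of the energy. The inequality of [zP] is applied to each of the two occurrences of z
    in d(g z, z), gaining t (1 - t) d(x, b)^2 both times; symmetry under [inv] identifies the two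
    mixed sums. *)
Lemma energy_segment x b t : cn_space -> 0 <= t <= 1 -> exists z,
  d[x, z] ^+ 2 <= d[x, b] ^+ 2 /\
  energy z <= (1 - t) ^+ 2 * energy x + 2 * t * (1 - t) * sumsq (g ^~ x) b
    + t ^+ 2 * energy b - 2 * t * (1 - t) * (#|I|%:R * d[x, b] ^+ 2).
Proof.
move=> cn t01; have [z zP] := cn x b t t01; exists z; split.
  have := zP x; rewrite mdistxx (metric_sym z) (metric_sym b) => h.
  have : t ^+ 2 * d[x, b] ^+ 2 <= d[x, b] ^+ 2.
    by rewrite ler_piMl ?sqr_ge0 // expr_le1; case/andP: t01.
  by apply: le_trans; move: h; rewrite expr0n mulr0; lra.
case/andP: t01 => t0 t1.
pose c := t * (1 - t) * d[x, b] ^+ 2.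
have h1 : energy z <= (1 - t) * sumsq (g ^~ z) x + t * sumsq (g ^~ z) b
                        - \sum_(i : I) c.
  rewrite /energy /sumsq !mulr_sumr -big_split -sumrB /=.
  apply: ler_sum => i _; have := zP (g i z).
  by rewrite !(metric_sym _ (g i z)) /c.
have h2 y : sumsq (g ^~ z) y <= (1 - t) * sumsq (g ^~ x) y + t * sumsq (g ^~ b) y
                        - \sum_(i : I) c.
  rewrite -!sumsq_inv !mulr_sumr -big_split -sumrB /=.
  apply: ler_sum => i _; exact: zP.
have cE : \sum_(i : I) c = t * (1 - t) * (#|I|%:R * d[x, b] ^+ 2).
  by rewrite sumr_const -mulr_natl /c; ring.
have sxb : sumsq (g ^~ b) x = sumsq (g ^~ x) b.
  by rewrite -sumsq_inv; apply: eq_bigr => i _; rewrite metric_sym.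
have := h2 b; have := h2 x; rewrite sxb -/(energy x) -/(energy b) cE in h1 *.
move: h1; move: (#|I|%:R * _) (sumsq (g ^~ x) b) (energy z) (energy x) (energy b) => D V Ez Ex Eb.
move: (sumsq (g ^~ z) x) (sumsq (g ^~ z) b) => A B h1 hA hB.
have : (1 - t) * A <= (1 - t) * ((1 - t) * Ex + t * V - t * (1 - t) * D).
  by rewrite ler_wpM2l // subr_ge0.
have : t * B <= t * ((1 - t) * V + t * Eb - t * (1 - t) * D) by rewrite ler_wpM2l.
lra.
Qed.

(** A crude bound is enough, since [energy b] enters [energy_segment] only with the factor t^2. *)
Lemma energy_triangle x b :
  energy b <= 8 * (#|I|%:R * d[x, b] ^+ 2) + 2 * energy x.
Proof.
have -> : #|I|%:R * d[x, b] ^+ 2 = \sum_(i : I) d[x, b] ^+ 2.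
  by rewrite sumr_const mulr_natl.
rewrite !mulr_sumr -big_split /=; apply: ler_sum => i _.
have h : d[g i b, b] <= 2 * d[x, b] + d[g i x, x].
  have := metric_triangle (g i b) (g i x) b; rewrite g_dist.
  have := metric_triangle (g i x) x b; rewrite (metric_sym b); lra.
have := @mdist_ge0 _ _ (g i b) b; have := @mdist_ge0 _ _ (g i x) x.
have := @mdist_ge0 _ _ x b.
move: h; move: (mdist (g i b) b) (mdist x b) (mdist (g i x) x) => u v w h v0 w0 u0.
have : u ^+ 2 <= (2 * v + w) ^+ 2 by rewrite lerXn2r ?nnegrE //; lra.
have : 0 <= (2 * v - w) ^+ 2 by rewrite sqr_ge0.
lra.
Qed.

Lemma energy_descent (kappa : R) x : cn_space -> complete_space Y ->
  0 < kappa <= 1 ->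
  (forall b, variance_center (g ^~ x) b -> kappa * energy x <= #|I|%:R * d[x, b] ^+ 2) ->
  exists z, d[x, z] <= Num.sqrt (energy x) /\
            energy z <= (1 - kappa ^+ 2 / 4) * energy x.
Proof.
move=> cn cY /andP[k0 k1] H.
have [b bP] := barycenter_exists i0 (g ^~ x) cn cY.
have {}H := H b bP.
(* Write t = kappa / 10, E for the energy of x and D for #I d(x, b)^2. The variance inequality turns
   [energy_segment] into E + 9 t^2 E - 4 t (1 - t) D, and D >= 10 t E. As t <= 1/10, this is at most
   (1 - 27 t^2) E, whereas kappa^2 / 4 is only 25 t^2. *)
have t01 : 0 <= kappa / 10 <= 1 by apply/andP; split; lra.
have [z [xz Ez]] := energy_segment x b cn t01.
exists z; have := bP x; rewrite -/(energy x) (metric_sym b) => bx.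
have V0 := sumsq_ge0 (g ^~ x) b; have Ex0 := energy_ge0 x.
have I1 : 1 <= #|I|%:R :> R by rewrite ler1n; apply/card_gt0P; exists i0.
have DD : d[x, b] ^+ 2 <= #|I|%:R * d[x, b] ^+ 2 by rewrite ler_peMl ?sqr_ge0.
split.
  rewrite -[leLHS]ger0_norm ?mdist_ge0 // -sqrtr_sqr ler_wsqrtr //; lra.
have Eb := energy_triangle x b.
have {}Eb : energy b <= 10 * energy x by lra.
apply: le_trans Ez _.
move: H bx V0 Eb Ex0; move: (#|I|%:R * _) (sumsq _ b) (energy x) (energy b) => D V E E' H bx V0 Eb E0.
set t := kappa / 10; have kt : kappa = 10 * t by rewrite /t; lra.
have t0 : 0 <= t by lra. have t1 : t <= 10^-1 by lra.
have h1 : t ^+ 2 * E' <= t ^+ 2 * (10 * E) by rewrite ler_wpM2l // sqr_ge0.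
have tt : 0 <= 2 * t * (1 - t) by rewrite mulr_ge0 //; lra.
have h2 : 2 * t * (1 - t) * V <= 2 * t * (1 - t) * (E - D) by rewrite ler_wpM2l //; lra.
have h3 : 2 * t * (1 - t) * (kappa * E) <= 2 * t * (1 - t) * D by rewrite ler_wpM2l.
rewrite kt in h3 *.
have h4 : 0 <= t ^+ 2 * E by rewrite mulr_ge0 ?sqr_ge0.
have h5 : t ^+ 3 * E <= t ^+ 2 * E / 10.
  by rewrite exprS -mulrA mulrC ler_wpM2l.
have : 2 * t * (1 - t) * (10 * t * E) = 20 * (t ^+ 2 * E) - 20 * (t ^+ 3 * E) by ring.
lra.
Qed.

Lemma displacement_fixed_point (kappa : R) : cn_space -> complete_space Y ->
  [set: Y] !=set0 -> 0 < kappa <= 1 ->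
  (forall x b, variance_center (g ^~ x) b ->
     kappa * energy x <= #|I|%:R * d[x, b] ^+ 2) ->
  exists p, forall i, g i p = p.
Proof.
move=> cn cY [x0 _] k01 H.
have /choice[F FP] : forall x, exists z, d[x, z] <= Num.sqrt (energy x) /\
            energy z <= (1 - kappa ^+ 2 / 4) * energy x.
  by move=> x; apply: energy_descent => //; exact: H.
pose u n := iter n F x0; set th := 1 - kappa ^+ 2 / 4 in FP.
have th01 : 0 <= th < 1.
  have /andP[k0 k1] := k01; have : 0 < kappa ^+ 2 by rewrite exprn_gt0.
  have : kappa ^+ 2 <= 1 by rewrite expr_le1 // ltW.
  by rewrite /th => *; apply/andP; split; lra.
have /andP[th0 th1] := th01.
have uE n : energy (u n) <= th ^+ n * energy x0.
  elim: n => [|n IH]; first by rewrite expr0 mul1r.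
  have [_ h] := FP (u n); apply: le_trans h _.
  by rewrite exprS -mulrA ler_wpM2l.
have sth01 : 0 <= Num.sqrt th < 1.
  by rewrite sqrtr_ge0 /= -sqrtr1 ltr_sqrt.
have sqE n : Num.sqrt (energy (u n)) <= Num.sqrt (energy x0) * Num.sqrt th ^+ n.
  rewrite -[leRHS]ger0_norm; last by rewrite mulr_ge0 ?exprn_ge0 ?sqrtr_ge0.
  rewrite -sqrtr_sqr ler_wsqrtr // exprMn exprAC !sqr_sqrtr ?energy_ge0 //.
  by rewrite mulrC.
have [p pP] : exists y, forall e : R, 0 < e -> exists N, forall n, (N <= n)%N -> d[y, u n] < e.
  apply: (complete_geometric_seq cY sth01) => n.
  by have [h _] := FP (u n); exact: le_trans h (sqE n).
exists p => i; apply: mdist_positivity; apply/eqP; rewrite eq_le mdist_ge0 andbT.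
apply/ler_addgt0Pr => e e0; rewrite add0r.
have [N Np] := pP (e / 4) ltac:(lra).
have : (fun n => Num.sqrt th ^+ n) @ \oo --> (0 : R).
  by apply: cvg_expr; rewrite ger0_norm ?sqrtr_ge0; case/andP: sth01.
pose A := Num.sqrt (energy x0) + 1.
have A0 : 0 < A by rewrite /A; have := sqrtr_ge0 (energy x0); lra.
move/cvgrPdist_lt => /(_ (e / 2 / A)) [|M _ HM]; first by rewrite !divr_gt0.
pose n := maxn N M.
have := HM n (leq_maxr _ _); rewrite /= sub0r normrN ger0_norm ?exprn_ge0 ?sqrtr_ge0 //.
rewrite ltr_pdivlMr // => hn.
have {}Np := Np n (leq_maxl _ _).
have gn : d[g i (u n), u n] <= e / 2.
  apply: le_trans (_ : Num.sqrt (energy (u n)) <= _).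
    rewrite -[leLHS]ger0_norm ?mdist_ge0 // -sqrtr_sqr ler_wsqrtr //.
    rewrite /energy /sumsq (bigD1 i) //= lerDl; apply: sumr_ge0 => j _.
    by rewrite sqr_ge0.
  apply: le_trans (sqE n) _; apply: le_trans (ltW hn).
  by rewrite mulrC ler_wpM2l ?exprn_ge0 ?sqrtr_ge0 // /A lerDl.
have := metric_triangle (g i p) (g i (u n)) p; rewrite g_dist.
have := metric_triangle (g i (u n)) (u n) p; rewrite (metric_sym (u n) p).
lra.
Qed.

End Displacement.
End CatZero.

(** * Growth of the variance along words *)

Section WordAverage.
Context {R : realType} (T : finType) (t0 : T).

(** [F] is a function of sequences rather than of tuples, so that averages over words of different
    lengths compose by concatenation without casts. *)
Definition word_avg (n : nat) (F : seq T -> R) : R :=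
  (\sum_(w : n.-tuple T) F w) / (#|T| ^ n)%:R.

Let pow_gt0 n : 0 < (#|T| ^ n)%:R :> R.
Proof. by rewrite ltr0n expn_gt0; apply/orP; left; apply/card_gt0P; exists t0. Qed.

Lemma word_avg_cat n l F :
  word_avg (n + l) F = word_avg n (fun u => word_avg l (fun v => F (u ++ v))).
Proof.
rewrite /word_avg -mulr_suml -mulrA -invfM -natrM -expnD addnC; congr (_ / _).
by rewrite addnC sum_tuple_cat.
Qed.

Lemma word_avg_const n c : word_avg n (fun=> c) = c.
Proof.
by rewrite /word_avg sumr_const card_tuple -[c *+ _]mulr_natr mulfK ?gt_eqF.
Qed.

Lemma ler_word_avg n F G : (forall w, F w <= G w) -> word_avg n F <= word_avg n G.
Proof.
by move=> FG; rewrite ler_pM2r ?invr_gt0 ?pow_gt0 //; apply: ler_sum.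
Qed.

Lemma word_avgD n F G : word_avg n (fun w => F w + G w) = word_avg n F + word_avg n G.
Proof. by rewrite /word_avg big_split mulrDl. Qed.

Lemma word_avgZ n c F : word_avg n (fun w => c * F w) = c * word_avg n F.
Proof. by rewrite /word_avg -mulr_sumr mulrA. Qed.

Lemma word_avg_ge0 n F : (forall w, 0 <= F w) -> 0 <= word_avg n F.
Proof. by move=> F0; rewrite divr_ge0 ?(ltW (pow_gt0 _)) // sumr_ge0. Qed.

End WordAverage.

Section WordAction.
Context {R : realType} (Y : metricType R) (T : finType) (t0 : T).
Variables (act : seq T -> Y -> Y) (inv : T -> T).
Local Notation "d[ x , y ]" := (mdist x y) (format "d[ x ,  y ]").
Hypothesis act_dist : forall u x y, d[act u x, act u y] = d[x, y].
Hypothesis act_cat : forall u v x, act (u ++ v) x = act u (act v x).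
Hypothesis act_nil : forall x, act [::] x = x.
Hypothesis invK : involutive inv.
Hypothesis act_inv : forall a x, act [:: a] (act [:: inv a] x) = x.

Definition mean_sqdist n (x q : Y) : R := word_avg n (fun w => d[act w x, q] ^+ 2).

Definition mean_displacement l (x : Y) : R := mean_sqdist l x x.

Lemma mean_sqdist_ge0 n x q : 0 <= mean_sqdist n x q.
Proof. by apply: word_avg_ge0 => // w; rewrite sqr_ge0. Qed.

Lemma sqr_add_le (a b t : R) : 0 < t -> (a + b) ^+ 2 <= (1 + t) * a ^+ 2 + (1 + t^-1) * b ^+ 2.
Proof.
move=> tp; have h : 0 <= t^-1 * (t * a - b) ^+ 2 by rewrite mulr_ge0 ?sqr_ge0 // invr_ge0 ltW.
rewrite -subr_ge0 (_ : _ - _ = t^-1 * (t * a - b) ^+ 2) //.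
by field; rewrite gt_eqF.
Qed.

Lemma act_rev_inv u x : act u (act (rev (map inv u)) x) = x.
Proof.
elim: u x => [|a u IH] x; first by rewrite !act_nil.
by rewrite map_cons rev_cons -cats1 act_cat -[a :: u]cat1s act_cat IH act_inv.
Qed.

(** For fixed u, average over v the squared distance from v x to q' = u^-1 q. The variance
    inequality at b splits it into V, which is almost E, plus d(b, q')^2, which is almost d(x,
    q')^2, because b is within tau sqrt(E) of x. The loss 4 tau is 3 tau from V and tau from the
    second replacement. *)
Lemma mean_sqdist_step n l x b q (tau : R) : 0 < tau <= 1 ->
  variance_center (fun w : l.-tuple T => act w x) b ->
  d[x, b] ^+ 2 <= tau ^+ 2 * mean_displacement l x ->
  (1 - tau) * mean_sqdist n x q + (1 - 4 * tau) * mean_displacement l x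
    <= mean_sqdist (n + l) x q.
Proof.
move=> /andP[tau0 tau1] bP.
set E := mean_displacement l x; set D := d[x, b] => DE.
have E0 : 0 <= E by exact: mean_sqdist_ge0.
have Q0 : 0 < (#|T| ^ l)%:R :> R by rewrite ltr0n expn_gt0; apply/orP; left; apply/card_gt0P; exists t0.
have bP' q' : mean_sqdist l x b + d[b, q'] ^+ 2 <= mean_sqdist l x q'.
  have := bP q'; rewrite card_tuple => h.
  rewrite -(ler_pM2r Q0) mulrDl /mean_sqdist /word_avg !divfK ?gt_eqF //.
  by rewrite [_ ^+ 2 * _]mulrC.
set V := mean_sqdist l x b in bP'.
have VE : (1 - 3 * tau) * E <= V.
  have h : E <= (1 + tau) * V + (1 + tau^-1) * D ^+ 2.
    rewrite /E /V /mean_displacement /mean_sqdist -word_avgZ -[X in _ + X](word_avg_const t0 l).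
    rewrite -word_avgD; apply: ler_word_avg => // w.
    apply: le_trans (sqr_add_le _ _ tau0).
    rewrite lerXn2r ?nnegrE ?addr_ge0 ?mdist_ge0 // /D (metric_sym x).
    exact: metric_triangle.
  have h2 : (1 + tau^-1) * D ^+ 2 <= 2 * tau * E.
    apply: le_trans (_ : (1 + tau^-1) * (tau ^+ 2 * E) <= _).
      by rewrite ler_wpM2l // addr_ge0 // invr_ge0 ltW.
    rewrite mulrA ler_wpM2r //.
    have -> : (1 + tau^-1) * tau ^+ 2 = tau ^+ 2 + tau by field; rewrite gt_eqF.
    have : tau ^+ 2 <= tau by rewrite expr2 ler_piMl // ltW.
    by lra.
  have h3 : (1 - 2 * tau) * E <= (1 + tau) * V by lra.
  rewrite -(ler_pM2l (_ : 0 < 1 + tau)); last by lra.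
  apply: le_trans h3; rewrite mulrA ler_wpM2r //.
  by have := sqr_ge0 tau; lra.
have step : V + (1 - tau) * mean_sqdist n x q <= mean_sqdist (n + l) x q + (tau^-1 - 1) * D ^+ 2.
  rewrite /mean_sqdist word_avg_cat -word_avgZ -[X in X + _](word_avg_const t0 n).
  rewrite -[X in _ <= _ + X](word_avg_const t0 n) -!word_avgD.
  apply: ler_word_avg => // u.
  have uK : exists q', forall z, d[act u z, q] = d[z, q'].
    exists (act (rev (map inv u)) q) => z.
    by rewrite -[in RHS](act_dist u) act_rev_inv.
  have [q' q'P] := uK.
  rewrite -lerBlDr; apply: le_trans (_ : V + d[b, q'] ^+ 2 <= _); last first.
    apply: le_trans (bP' q') _.
    by apply: ler_word_avg => // v; rewrite act_cat q'P.
  rewrite -addrA lerD2l q'P.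
  have h : d[x, q'] <= D + d[b, q'] by exact: metric_triangle.
  have := @mdist_ge0 _ _ x q'; have := @mdist_ge0 _ _ b q'.
  have D0 : 0 <= D by exact: mdist_ge0.
  move: h D0; rewrite -/D; move: D (mdist x q') (mdist b q') {DE} => D' a c h D0 c0 a0.
  have tD : 0 <= (tau^-1 - 1) * D' ^+ 2.
    by rewrite mulr_ge0 ?sqr_ge0 // subr_ge0 invf_ge1.
  have [aD|aD] := leP a D'.
    have : (1 - tau) * a ^+ 2 <= (1 - tau) * D' ^+ 2.
      by rewrite ler_wpM2l ?subr_ge0 // lerXn2r // nnegrE.
    have : (1 - tau) * D' ^+ 2 <= (tau^-1 - 1) * D' ^+ 2.
      rewrite ler_wpM2r ?sqr_ge0 //.
      rewrite -subr_ge0 (_ : _ - _ = tau^-1 * (1 - tau) ^+ 2); last by field; rewrite gt_eqF.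
      by rewrite mulr_ge0 ?sqr_ge0 // invr_ge0 ltW.
    by have := sqr_ge0 c; lra.
  have : (a - D') ^+ 2 <= c ^+ 2 by rewrite lerXn2r ?nnegrE //; lra.
  apply: le_trans.
  have -> : (a - D') ^+ 2 = (1 - tau) * a ^+ 2 - ((tau^-1 - 1) * D' ^+ 2)
     + tau^-1 * (tau * a - D') ^+ 2 by field; rewrite gt_eqF.
  by rewrite lerDl mulr_ge0 ?sqr_ge0 // invr_ge0 ltW.
have Dt : (tau^-1 - 1) * D ^+ 2 <= tau * E.
  apply: le_trans (_ : tau^-1 * D ^+ 2 <= _); first by rewrite ler_wpM2r ?sqr_ge0 // gerBl.
  rewrite mulrC ler_pdivrMr //; apply: le_trans DE _.
  by rewrite le_eqVlt; apply/orP; left; apply/eqP; ring.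
lra.
Qed.

(** Each block contributes 1 - 4 tau and damps the previous total by 1 - tau, so the accumulated
    loss is quadratic in j. The r remaining letters only provide a nonnegative start. *)
Lemma mean_sqdist_growth r j l x b q (tau : R) : 0 < tau <= 1 ->
  variance_center (fun w : l.-tuple T => act w x) b ->
  d[x, b] ^+ 2 <= tau ^+ 2 * mean_displacement l x ->
  j%:R * (1 - (j%:R + 4) * tau) * mean_displacement l x
    <= mean_sqdist (r + j * l) x q.
Proof.
move=> tau01 bP DE; have /andP[tau0 tau1] := tau01.
elim: j => [|j IH]; first by rewrite mul0r mul0r mean_sqdist_ge0.
rewrite mulSn addnCA addnC; apply: le_trans (mean_sqdist_step _ _ tau01 bP DE).
set E := mean_displacement l x in IH *.
have E0 : 0 <= E by exact: mean_sqdist_ge0.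
apply: le_trans (_ : (1 - tau) * (j%:R * (1 - (j%:R + 4) * tau) * E) + (1 - 4 * tau) * E <= _).
  rewrite mulrA -mulrDl ler_wpM2r // -natr1; set J := j%:R : R.
  have J0 : 0 <= J by rewrite ler0n.
  rewrite -subr_ge0 (_ : _ - _ = (J + 1) * tau + tau ^+ 2 * J * (J + 4)); last by ring.
  by rewrite addr_ge0 ?mulr_ge0 ?sqr_ge0 // ?(ltW tau0) //; lra.
by rewrite lerD2r ler_wpM2l // subr_ge0.
Qed.

Lemma inv_word_bij n : exists2 s : n.-tuple T -> n.-tuple T, bijective s &
  forall w, s w = rev (map inv w) :> seq T.
Proof.
have szP (w : n.-tuple T) : size (rev (map inv w)) == n by rewrite size_rev size_map size_tuple.
exists (fun w => Tuple (szP w)) => //.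
exists (fun w => Tuple (szP w)) => w; apply: val_inj => /=;
  by rewrite map_rev revK -map_comp (eq_map invK) map_id.
Qed.

Lemma words_fixed_point (n l k : nat) (C : R) : cn_space Y -> complete_space Y ->
  [set: Y] !=set0 -> (k * l <= n)%N -> C < k%:R ->
  (forall x, exists q, mean_sqdist n x q <= C * mean_displacement l x) ->
  exists p, forall w : l.-tuple T, act w p = p.
Proof.
move=> cn cY Y0 kln Ck H.
have [s s_bij sE] := inv_word_bij l.
(* Small enough that k (1 - (k + 4) tau) > C: k blocks of growth then contradict the upper bound at
   any x lying within tau sqrt(E) of the barycenter of its translates. So [displacement_fixed_point]
   applies with kappa = tau^2. *)
pose tau : R := Num.min 1 ((k%:R - C) / (2 * (k%:R * (k%:R + 4) + 1))).
have K0 : 0 < 2 * (k%:R * (k%:R + 4) + 1) :> R.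
  by rewrite mulr_gt0 // ltr_wpDl // mulr_ge0 ?addr_ge0 ?ler0n.
have tau0 : 0 < tau by rewrite lt_min ltr01 divr_gt0 // subr_gt0.
have tau1 : tau <= 1 by rewrite ge_min lexx.
have tauC : C < k%:R * (1 - (k%:R + 4) * tau).
  have : tau * (2 * (k%:R * (k%:R + 4) + 1)) <= k%:R - C.
    by rewrite -ler_pdivlMr // ge_min lexx orbT.
  have : 0 <= k%:R * (k%:R + 4) * tau by rewrite !mulr_ge0 ?addr_ge0 ?ler0n ?(ltW tau0).
  lra.
have k2 : 0 < tau ^+ 2 <= 1 by rewrite exprn_gt0 //= expr_le1 // ltW.
pose i0 : l.-tuple T := nseq_tuple l t0.
have act_s (w : l.-tuple T) x y : d[act w x, y] = d[x, act (s w) y].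
  by rewrite sE -[in RHS](act_dist w) act_rev_inv.
apply: (@displacement_fixed_point _ _ _ i0 (fun w : l.-tuple T => act w) s _ s_bij act_s
  (tau ^+ 2) cn cY Y0 k2) => [i x y|x b bP]; first exact: act_dist.
have Q0 : 0 < #|{: l.-tuple T}|%:R :> R by rewrite ltr0n; apply/card_gt0P; exists i0.
have EE : energy (fun w : l.-tuple T => act w) x = #|{: l.-tuple T}|%:R * mean_displacement l x.
  by rewrite /mean_displacement /mean_sqdist /word_avg -card_tuple mulrC divfK ?gt_eqF.
rewrite EE mulrCA ler_pM2l // leNgt; apply/negP => lt.
have [q qP] := H x.
have := mean_sqdist_growth (n - k * l) k q (introT andP (conj tau0 tau1)) bP (ltW lt).
rewrite subnK // => /le_trans /(_ qP).
rewrite leNgt => /negP; apply; rewrite ltr_pM2r //.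
have E0 := mean_sqdist_ge0 l x x; rewrite lt_def E0 andbT; apply/negP => /eqP E0'.
by move: lt; rewrite E0' mulr0 ltNge sqr_ge0.
Qed.

(* If [z] is the image of [p] under a fixed word of length [l - 1], every letter
   maps [z] to [p]; letters come with their inverses, so they exchange the two
   points and fix their midpoint. *)
Lemma letters_fixed_point (l : nat) p : cn_space Y -> (0 < l)%N ->
  (forall w : l.-tuple T, act w p = p) ->
  exists q, forall a, act [:: a] q = q.
Proof.
case: l => // l cn _ pP.
pose z := act (nseq l t0) p.
have az a : act [:: a] z = p.
  have /= := pP [tuple of a :: nseq_tuple l t0].
  by rewrite -[a :: _]cat1s act_cat.
have ap a : act [:: a] p = z.
  by rewrite -{1}(az (inv a)) act_inv.
have half : 0 <= (2^-1 : R) <= 1 by apply/andP; split; lra.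
have [c cP] := cn p z _ half.
have cp : d[c, p] ^+ 2 <= 4^-1 * d[p, z] ^+ 2.
  by have := cP p; rewrite mdistxx (metric_sym z); lra.
have cz : d[c, z] ^+ 2 <= 4^-1 * d[p, z] ^+ 2.
  by have := cP z; rewrite mdistxx; lra.
exists c => a; apply/esym/mdist_positivity/eqP; rewrite -sqrf_eq0 eq_le sqr_ge0 andbT.
have := cP (act [:: a] c).
have -> : d[p, act [:: a] c] = d[c, z] by rewrite -{1}(az a) act_dist metric_sym.
have -> : d[z, act [:: a] c] = d[c, p] by rewrite -{1}(ap a) act_dist metric_sym.
lra.
Qed.
End WordAction.

(** * The Hilbert space of square summable sequences *)

Lemma quadratic_ge0_discr (R : realFieldType) (a b c : R) : 0 <= c ->
  (forall t, 0 <= a + 2 * t * b + t ^+ 2 * c) -> b ^+ 2 <= a * c.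
Proof.
move=> c0 H; have [c00|cn0] := eqVneq c 0.
  suff -> : b = 0 by rewrite c00 mulr0 expr0n.
  apply/eqP/negP => /negP bn0; have := H (- (a + 1) / (2 * b)).
  rewrite c00 mulr0 addr0.
  have -> : 2 * (- (a + 1) / (2 * b)) * b = - (a + 1) by field.
  lra.
have cp : 0 < c by rewrite lt_def cn0.
have := H (- b / c).
have -> : a + 2 * (- b / c) * b + (- b / c) ^+ 2 * c = (a * c - b ^+ 2) / c by field.
by rewrite pmulr_lge0 ?invr_gt0 // subr_ge0.
Qed.

Section SquareSummable.
Context {R : realType}.

Definition square_summable (f : nat -> R) : bool :=
  `[< exists M, forall n, \sum_(i < n) f i ^+ 2 <= M >].

Lemma square_summable_submod : submod_closed square_summable.
Proof.
split=> [|a f g /asboolP[M fM] /asboolP[N gN]]; apply/asboolP.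
  by exists 0 => n; rewrite big1 // => i _; rewrite expr0n.
exists (2 * a ^+ 2 * M + 2 * N) => n.
apply: le_trans (_ : \sum_(i < n) (2 * a ^+ 2 * f i ^+ 2 + 2 * g i ^+ 2) <= _).
  apply: ler_sum => i _; rewrite !fctE /GRing.scale /=.
  by have := sqr_ge0 (a * f i - g i); lra.
rewrite big_split -!mulr_sumr /=.
have a0 : 0 <= 2 * a ^+ 2 by rewrite mulr_ge0 // sqr_ge0.
by apply: lerD; rewrite ler_wpM2l ?fM ?gN.
Qed.

HB.instance Definition _ := GRing.isSubmodClosed.Build R (nat -> R) square_summable
  square_summable_submod.

(** Witness that an infinite-dimensional Hilbert space exists. Without it the set defining
    [delta_meas] might be empty and a bound on its infimum would yield no map. *)
Record ell2 := Ell2 { seq_of_ell2 :> nat -> R; _ : square_summable seq_of_ell2 }.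

HB.instance Definition _ := [isSub for seq_of_ell2].
HB.instance Definition _ := [Choice of ell2 by <:].
HB.instance Definition _ := [SubChoice_isSubLmodule of ell2 by <:].

Lemma ell2P (x : ell2) : exists M, forall n, \sum_(i < n) x i ^+ 2 <= M.
Proof. by case: x => f fS; apply/asboolP. Qed.

Lemma ell2_subE (x y : ell2) i : (x - y) i = x i - y i.
Proof. by []. Qed.

Definition ell2_dot (x y : ell2) : R := lim ((fun n => \sum_(i < n) x i * y i) @ \oo).

(** Absolute convergence, from |x y| <= x^2 + y^2. The operator [lim] carries meaning only through
    this lemma. *)
Lemma cvg_ell2_dot (x y : ell2) :
  (fun n => \sum_(i < n) x i * y i) @ \oo --> ell2_dot x y.
Proof.
have pos (f : nat -> R) M : (forall i, 0 <= f i) ->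
    (forall n, \sum_(i < n) f i <= M) -> cvgn (series f).
  move=> f0 fM; apply: nondecreasing_is_cvgn.
    by apply: nondecreasing_series => i _ _.
  by exists M => _ [n _ <-]; rewrite /series /= big_mkord.
suff h : cvgn (series (fun i => x i * y i)).
  move: h; rewrite (_ : series _ = fun n => \sum_(i < n) x i * y i) //.
  by apply/funext => n; rewrite /series /= big_mkord.
have [M xM] := ell2P x; have [N yN] := ell2P y.
apply: normed_cvg; apply: (pos _ (M + N)) => [i|n]; first exact: normr_ge0.
apply: le_trans (lerD (xM n) (yN n)); rewrite -big_split /=.
apply: ler_sum => i _; rewrite normrM -(real_normK (num_real (x i))) -(real_normK (num_real (y i))).
have := sqr_ge0 (`|x i| - `|y i|); have : 0 <= `|x i| * `|y i| by rewrite mulr_ge0.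
lra.
Qed.

Lemma ell2_dotC x y : ell2_dot x y = ell2_dot y x.
Proof.
rewrite /ell2_dot (_ : (fun n => _) = (fun n : nat => \sum_(i < n) y i * x i)) //.
by apply/funext => n; apply: eq_bigr => i _; rewrite mulrC.
Qed.

Lemma ell2_dotDl a x y z : ell2_dot (a *: x + y) z = a * ell2_dot x z + ell2_dot y z.
Proof.
apply: cvg_lim => //.
have ax : (fun n => a * \sum_(i < n) x i * z i) @ \oo --> a * ell2_dot x z.
  by apply: cvgM; [exact: cvg_cst|exact: cvg_ell2_dot].
rewrite (_ : (fun n => _) = (fun n : nat => a * (\sum_(i < n) x i * z i) + \sum_(i < n) y i * z i)).
  by apply: cvgD => //; exact: cvg_ell2_dot.
apply/funext => n /=; rewrite [LHS]/= mulr_sumr -big_split /=; apply: eq_bigr => i _.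
by rewrite mulrA -mulrDl.
Qed.

Lemma ell2_dot_partial (x : ell2) n : \sum_(i < n) x i ^+ 2 <= ell2_dot x x.
Proof.
apply: limr_ge; first by apply/cvg_ex; exists (ell2_dot x x); exact: cvg_ell2_dot.
exists n => // m /= nm.
rewrite -[leLHS](big_mkord xpredT (fun i => x i ^+ 2)).
rewrite -[leRHS](big_mkord xpredT (fun i => x i * x i)) (big_cat_nat (leq0n n) nm) /=.
under [X in X <= _]eq_bigr do rewrite expr2.
by rewrite lerDl sumr_ge0 // => i _; rewrite -expr2 sqr_ge0.
Qed.

Lemma ell2_dot_le (x : ell2) M : (forall n, \sum_(i < n) x i ^+ 2 <= M) -> ell2_dot x x <= M.
Proof.
move=> xM; apply: limr_le; first by apply/cvg_ex; exists (ell2_dot x x); exact: cvg_ell2_dot.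
by apply: nearW => n; apply: le_trans (xM n); rewrite le_eqVlt; apply/orP; left; apply/eqP/eq_bigr => i _; rewrite expr2.
Qed.

Lemma ell2_dot_ge0 x : 0 <= ell2_dot x x.
Proof. by have := ell2_dot_partial x 0; rewrite big_ord0. Qed.

Lemma ell2_dot_eq0 x : ell2_dot x x = 0 -> x = 0.
Proof.
move=> x0; apply: val_inj; apply/funext => i /=; apply/eqP.
rewrite -sqrf_eq0 eq_le sqr_ge0 andbT.
have := ell2_dot_partial x i.+1; rewrite x0 big_ord_recr /=; apply: le_trans.
by rewrite lerDr sumr_ge0 // => j _; rewrite sqr_ge0.
Qed.

Lemma ell2_CS x y : ell2_dot x y ^+ 2 <= ell2_dot x x * ell2_dot y y.
Proof.
apply: quadratic_ge0_discr (ell2_dot_ge0 y) _ => t.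
have := ell2_dot_ge0 (t *: y + x).
rewrite ell2_dotDl ![ell2_dot _ (_ + _)]ell2_dotC !ell2_dotDl (ell2_dotC y x).
by congr (_ <= _); ring.
Qed.

Definition ell2_norm x := Num.sqrt (ell2_dot x x).

Lemma ell2_normD x y : ell2_norm (x + y) <= ell2_norm x + ell2_norm y.
Proof.
have h : ell2_dot (x + y) (x + y) = ell2_dot x x + 2 * ell2_dot x y + ell2_dot y y.
  rewrite -[x in x + y]scale1r ell2_dotDl ![ell2_dot _ (_ + _)]ell2_dotC !ell2_dotDl.
  by rewrite (ell2_dotC y x); ring.
rewrite -[leRHS]ger0_norm ?addr_ge0 ?sqrtr_ge0 // -sqrtr_sqr ler_wsqrtr // h sqrrD.
rewrite !sqr_sqrtr ?ell2_dot_ge0 // lerD2r lerD2l -[leRHS]mulr_natl ler_wpM2l //.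
rewrite /ell2_norm -sqrtrM ?ell2_dot_ge0 // (le_trans (ler_norm _)) // -sqrtr_sqr.
by rewrite ler_wsqrtr // ell2_CS.
Qed.

Lemma ell2_dotZ (a : R) x : ell2_dot (a *: x) (a *: x) = a ^+ 2 * ell2_dot x x.
Proof.
have h y : ell2_dot (a *: x) y = a * ell2_dot x y.
  have z0 : ell2_dot 0 y = 0.
    have := ell2_dotDl 1 0 0 y; rewrite scale1r addr0 mul1r => h0.
    by apply: (addIr (ell2_dot 0 y)); rewrite -h0 add0r.
  by have := ell2_dotDl a x 0 y; rewrite addr0 z0 addr0.
by rewrite h ell2_dotC h; ring.
Qed.

Lemma ell2_normZ (a : R) x : ell2_norm (a *: x) = `|a| * ell2_norm x.
Proof. by rewrite /ell2_norm ell2_dotZ sqrtrM ?sqr_ge0 // sqrtr_sqr. Qed.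

Lemma ell2_norm_eq0 x : ell2_norm x = 0 -> x = 0.
Proof.
move/eqP; rewrite sqrtr_eq0 => h; apply: ell2_dot_eq0; apply/eqP.
by rewrite eq_le h ell2_dot_ge0.
Qed.

HB.instance Definition _ := Lmodule_isNormed.Build R ell2 ell2_normD ell2_normZ ell2_norm_eq0.

Lemma ell2_normE (x : ell2) : `|x| = ell2_norm x. Proof. by []. Qed.

Lemma ell2_coord_le (x : ell2) i : `|x i| <= `|x|.
Proof.
rewrite -sqrtr_sqr ell2_normE ler_wsqrtr //.
have := ell2_dot_partial x i.+1; rewrite big_ord_recr /=; apply: le_trans.
by rewrite lerDr sumr_ge0 // => j _; rewrite sqr_ge0.
Qed.

(** The limit is taken coordinate by coordinate. Bounds on finite partial sums are closed
    conditions, so they survive the limit and give both square summability and convergence in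
    norm. *)
Lemma ell2_complete (F : set_system ell2) : ProperFilter F -> cauchy F -> cvg F.
Proof.
move=> FF /cauchyP FC.
have lP i : exists l : R, (fun x : ell2 => x i) @ F --> l.
  apply/cvg_ex; apply: cauchy_cvg; apply: cauchy_exP => e e0.
  have [x Fx] := FC e e0; exists (x i).
  suff : \forall y \near F, ball (x i) e ((y : ell2) i) by [].
  apply: filterS Fx => y; rewrite -!ball_normE /= => h; apply: le_lt_trans h.
  by have := ell2_coord_le (x - y) i; rewrite ell2_subE.
have /choice[l lF] := lP.
have key e : 0 < e -> exists x : ell2, F (ball x e) /\
    forall n, \sum_(i < n) (x i - l i) ^+ 2 <= e ^+ 2.
  move=> e0; have [x Fx] := FC e e0; exists x; split=> // n.
  have cv : (fun y : ell2 => \sum_(i < n) (x i - y i) ^+ 2) @ F --> \sum_(i < n) (x i - l i) ^+ 2.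
    elim: n => [|n IH].
      rewrite big_ord0 (_ : (fun _ => _) = fun=> 0); first exact: cvg_cst.
      by apply/funext => y; rewrite big_ord0.
    rewrite big_ord_recr (_ : (fun _ => _) = fun y : ell2 =>
      \sum_(i < n) (x i - y i) ^+ 2 + (x n - y n) ^+ 2).
      apply: cvgD => //; rewrite expr2; apply: cvgM; apply: cvgB; by [exact: cvg_cst|exact: lF].
    by apply/funext => y; rewrite big_ord_recr.
  rewrite -(cvg_lim _ cv) //; apply: limr_le; first by apply/cvg_ex; eexists; exact: cv.
  apply: filterS Fx => y; rewrite -!ball_normE /= => h.
  have := ell2_dot_partial (x - y) n; move/le_trans; apply.
  rewrite -[ell2_dot _ _]sqr_sqrtr ?ell2_dot_ge0 // -/(ell2_norm _) -ell2_normE.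
  by rewrite lerXn2r ?nnegrE ?(ltW h) ?(ltW e0).
have lS : square_summable l.
  have [x [_ xl]] := key 1 ltr01; have [M xM] := ell2P x.
  apply/asboolP; exists (2 * M + 2 * 1 ^+ 2) => n.
  apply: le_trans (lerD (ler_wpM2l (ler0n _ 2) (xM n)) (ler_wpM2l (ler0n _ 2) (xl n))).
  rewrite !mulr_sumr -big_split /=; apply: ler_sum => i _.
  by have := sqr_ge0 (2 * x i - l i); lra.
apply/cvg_ex; exists (Ell2 lS); apply/cvgrPdist_lt => e e0.
have [x [Fx xl]] := key (e / 2) ltac:(lra).
apply: filterS Fx => y; rewrite -ball_normE /= => xy.
have : `|x - Ell2 lS| <= e / 2.
  rewrite ell2_normE -[leRHS]ger0_norm; last by lra.
  by rewrite -sqrtr_sqr ler_wsqrtr //; apply: ell2_dot_le.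
rewrite (_ : Ell2 lS - y = (x - y) - (x - Ell2 lS)); last by rewrite opprB [RHS]addrC addrA subrK.
by move=> h; apply: le_lt_trans (ler_normB _ _) _; lra.
Qed.

HB.instance Definition _ := Uniform_isComplete.Build ell2 ell2_complete.

Lemma ell2_bilinear : bilinear_for *%R (idfun \; *%R) ell2_dot.
Proof.
split=> [u a x y|u a x y]; first exact: ell2_dotDl.
by rewrite /= ell2_dotC ell2_dotDl !(ell2_dotC u).
Qed.

HB.instance Definition _ := bilinear_isBilinear.Build R ell2 ell2 R *%R (idfun \; *%R) ell2_dot
  ell2_bilinear.

Lemma ell2_hermitian x y : ell2_dot x y = (-1) ^+ false * idfun (ell2_dot y x).
Proof. by rewrite expr0 mul1r ell2_dotC. Qed.

HB.instance Definition _ := isHermitianSesquilinear.Build R ell2 false idfun ell2_dot ell2_hermitian.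

Lemma ell2_dot_gt0 x : x != 0 -> 0 < ell2_dot x x.
Proof.
by move=> x0; rewrite lt_def ell2_dot_ge0 andbT; apply: contra_neq x0; exact: ell2_dot_eq0.
Qed.

HB.instance Definition _ := isDotProduct.Build R ell2 ell2_dot ell2_dot_gt0.

Definition ell2_space : completeNormedModType R := ell2.

Lemma ell2_is_hilbert : is_hilbert ell2_space.
Proof.
exists (ell2_dot : {dot ell2 for idfun}) => x.
by rewrite ell2_normE sqr_sqrtr ?ell2_dot_ge0.
Qed.

Lemma ell2_unit_subproof (j : nat) : square_summable (fun i => (i == j)%:R).
Proof.
apply/asboolP; exists 1 => n; have [jn|nj] := ltnP j n.
  rewrite (bigD1 (Ordinal jn)) //= eqxx expr1n big1 ?addr0 // => i.
  by rewrite -val_eqE /= => /negPf ->; rewrite expr0n.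
rewrite big1 // => i _; rewrite ltn_eqF ?expr0n //; exact: leq_trans (ltn_ord i) nj.
Qed.

Definition ell2_unit j : ell2 := Ell2 (ell2_unit_subproof j).

(** A spanning family of n vectors would factor the identity matrix of size n + 1 through dimension
    n. *)
Lemma ell2_infinite_dimensional : infinite_dimensional ell2_space.
Proof.
move=> [n [e eP]].
have /choice[a aP] := fun j : nat => eP (ell2_unit j).
pose A := \matrix_(j < n.+1, i < n) a j i.
pose B := \matrix_(i < n, k < n.+1) (e i : ell2) k.
have AB : A *m B = 1%:M.
  apply/matrixP => j k; rewrite !mxE.
  have -> : (j == k)%:R = (ell2_unit j) k by rewrite /= eq_sym.
  rewrite aP; transitivity ((\sum_i a j i *: (e i : ell2) : ell2) k).
    elim/big_rec2: _ => // i x y _ IH; rewrite !mxE IH //.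
  by [].
have := mulmx1_min AB; by rewrite ltnn.
Qed.

End SquareSummable.

(** * Moments of random samples *)

Section NoSingleton.
Variable I : finType.
Implicit Types t s : seq I.

Definition no_singleton t := [forall i, count_mem i t != 1].

Lemma sum_count_mem t : (\sum_i count_mem i t = size t)%N.
Proof.
elim: t => [|a t IH] /=; first by rewrite big1.
rewrite big_split /= IH (bigD1 a) //= eqxx big1 // => i /negPf ia.
by rewrite eq_sym ia.
Qed.

Lemma card_no_singleton t : no_singleton t -> (#|[set x in t]|.*2 <= size t)%N.
Proof.
move/forallP => nt; rewrite -sum_count_mem -muln2 -sum1_card big_distrl /=.
rewrite [leqRHS](bigID (mem [set x in t])) /= -[leqLHS]addn0 leq_add //.
apply: leq_sum => i; rewrite inE => it; rewrite mul1n ltn_neqAle eq_sym nt.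
by rewrite -has_count has_pred1.
Qed.

(** A tuple with q distinct entries is recovered from an enumeration of these entries and the n
    positions in it. *)
Lemma card_support_eq n q :
  (#|[set t : n.-tuple I | #|[set x in t]| == q]%SET| <= #|I| ^ q * q ^ n)%N.
Proof.
pose f (p : q.-tuple I * n.-tuple 'I_q) : n.-tuple I := map_tuple (tnth p.1) p.2.
have -> : (#|I| ^ q * q ^ n)%N = #|{: q.-tuple I * n.-tuple 'I_q}|.
  by rewrite card_prod !card_tuple card_ord.
rewrite -cardsT; apply: leq_trans (leq_imset_card f _).
apply/subset_leq_card/fintype.subsetP => t; rewrite inE => /eqP tq.
have szc : size (enum [set x in t]) == q by rewrite -cardE tq.
have idx x : x \in t -> (index x (enum [set x in t]) < q)%N.
  by move=> xt; rewrite -[X in (_ < X)%N](eqP szc) index_mem mem_enum inE.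
have idx' (j : 'I_n) : (index (tnth t j) (enum [set x in t]) < q)%N by rewrite idx ?mem_tnth.
apply/finset.imsetP; exists (Tuple szc, [tuple Ordinal (idx' j) | j < n]) => //.
apply: eq_from_tnth => j; rewrite tnth_map tnth_mktuple /=.
rewrite [RHS](tnth_nth (tnth t j)) /= nth_index // mem_enum inE mem_tnth //.
Qed.

(** The support has q <= h elements because every index is repeated; since #I theta >= 1, the term q
    = h dominates. The factor h + 1 counts the values of q. *)
Lemma no_singleton_sum (R : realFieldType) (h : nat) (theta : R) :
  0 <= theta -> 1 <= #|I|%:R * theta ->
  \sum_(t : h.*2.-tuple I | no_singleton t) theta ^+ #|[set x in t]|
    <= (h.+1 * h ^ h.*2)%:R * (#|I|%:R * theta) ^+ h.
Proof.
move=> th0 Mth.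
rewrite (partition_big (fun t : h.*2.-tuple I => inord #|[set x in t]| : 'I_h.+1) xpredT) //=.
have -> : (h.+1 * h ^ h.*2)%:R * (#|I|%:R * theta) ^+ h =
    \sum_(q < h.+1) (h ^ h.*2)%:R * (#|I|%:R * theta) ^+ h.
  by rewrite sumr_const card_ord natrM -mulrA mulr_natl.
apply: ler_sum => q _.
apply: le_trans (_ : \sum_(t in [set t : h.*2.-tuple I | #|[set x in t]| == q]%SET) theta ^+ q <= _).
  rewrite [leLHS](_ : _ = \sum_(t : h.*2.-tuple I | no_singleton t && (inord #|[set x in t]| == q))
     theta ^+ q).
    rewrite [leRHS](bigID (fun t : h.*2.-tuple I => no_singleton t)) /=.
    rewrite -[leLHS]addr0 lerD ?sumr_ge0 // => [|t _]; last by rewrite exprn_ge0.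
    rewrite le_eqVlt; apply/orP; left; apply/eqP; apply: eq_bigl => t.
    rewrite inE andbC; case nt: (no_singleton t) => //=; rewrite ?andbF // !andbT.
    rewrite -val_eqE /= inordK // ltnS.
    by have := card_no_singleton nt; rewrite size_tuple leq_double.
  apply: eq_bigr => t /andP[nt /eqP <-]; rewrite inordK // ltnS.
  by have := card_no_singleton nt; rewrite size_tuple leq_double.
rewrite sumr_const -[theta ^+ q *+ _]mulr_natl.
apply: le_trans (_ : (#|I| ^ q * q ^ h.*2)%:R * theta ^+ q <= _).
  by rewrite ler_wpM2r ?exprn_ge0 // ler_nat card_support_eq.
have qh : (q <= h)%N by rewrite -ltnS.
rewrite natrM natrX mulrAC -exprMn mulrC; apply: ler_pM => //.
- by rewrite exprn_ge0 // (le_trans ler01).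
- rewrite ler_nat; have [z|z] := posnP h.*2; first by rewrite z.
  by rewrite leq_exp2r.
- by rewrite ler_weXn2l.
Qed.
End NoSingleton.

Section Kernel.
Context {R : realType} (V : finType) (v0 : V).
Let N : R := #|V|%:R.

Let N_ge1 : 1 <= N.
Proof. by rewrite ler1n; apply/card_gt0P; exists v0. Qed.

Let N_gt0 : 0 < N. Proof. exact: lt_le_trans N_ge1. Qed.

(** The matrix of the orthogonal projection onto functions of sum 0. *)
Definition centering (x y : V) : R := (x == y)%:R - (#|V|%:R)^-1.
Local Notation G := centering.

Lemma centeringC x y : G x y = G y x.
Proof. by rewrite /G eq_sym. Qed.

Lemma sum_centering_fun (L : lmodType R) (f : V -> L) x :
  \sum_y G x y *: f y = f x - N^-1 *: \sum_y f y.
Proof.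
under eq_bigr do rewrite scalerBl.
rewrite sumrB -scaler_sumr; congr (_ - _).
rewrite (bigD1 x) //= eqxx scale1r big1 ?addr0 // => y /negPf yx.
by rewrite eq_sym yx scale0r.
Qed.

Lemma sum_centering x : \sum_y G x y = 0.
Proof.
rewrite /G sumrB (bigD1 x) //= eqxx big1 ?addr0 => [|y /negPf yx]; last by rewrite eq_sym yx.
by rewrite sumr_const -[_^-1 *+ _]mulr_natr -/N mulVf ?subrr // gt_eqF.
Qed.

Lemma sum_centering_l x : \sum_y G y x = 0.
Proof. by under eq_bigr do rewrite centeringC; exact: sum_centering. Qed.

Lemma centering_idem x z : \sum_y G x y * G y z = G x z.
Proof.
have := sum_centering_fun (fun y => G y z : R^o) x.
under [X in _ = _ - _ *: X]eq_bigr do rewrite centeringC.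
by rewrite sum_centering scaler0 subr0.
Qed.

Lemma centering_le1 x y : `|G x y| <= 1.
Proof.
have i0 : 0 < N^-1 by rewrite invr_gt0.
have i1 : N^-1 <= 1 by rewrite invf_le1.
by rewrite /G -/N; case: eqP => _ /=; rewrite ler_norml; apply/andP; split; lra.
Qed.

Lemma sum_abs_centering y : \sum_x `|G x y| <= 2.
Proof.
apply: le_trans (_ : \sum_x ((y == x)%:R + N^-1) <= _).
  apply: ler_sum => x _; apply: le_trans (ler_normB _ _) _.
  by rewrite normr_nat ger0_norm ?invr_ge0 ?(ltW N_gt0) // eq_sym.
rewrite big_split /= sumr_const -[N^-1 *+ _]mulr_natr mulVf ?gt_eqF //.
rewrite (bigD1 y) //= eqxx big1 ?addr0 // => x /negPf yx.
by rewrite eq_sym yx.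
Qed.
End Kernel.

Section Expectation.
Context {R : realType} (I Z : finType) (z0 : Z).
Implicit Types (F : {ffun I -> Z} -> R).

Definition sample_mean F : R := (\sum_om F om) / (#|Z| ^ #|I|)%:R.
Local Notation Ex := sample_mean.

Let card_gt0 : 0 < (#|Z| ^ #|I|)%:R :> R.
Proof. by rewrite ltr0n expn_gt0; apply/orP; left; apply/card_gt0P; exists z0. Qed.

Let Z_gt0 : 0 < #|Z|%:R :> R.
Proof. by rewrite ltr0n; apply/card_gt0P; exists z0. Qed.

Definition upd (om : {ffun I -> Z}) i z : {ffun I -> Z} :=
  [ffun j => if j == i then z else om j].

(** Independence of coordinates: coordinate i may be integrated out first. Exchanging [om i] with a
    fresh z is an involution on pairs. *)
Lemma sample_mean_upd i F : Ex F = Ex (fun om => (\sum_z F (upd om i z)) / #|Z|%:R).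
Proof.
rewrite /Ex; congr (_ / _); rewrite -mulr_suml pair_big /=.
rewrite (reindex (fun p : {ffun I -> Z} * Z => (upd p.1 i p.2, p.1 i))) /=; last first.
  apply: onW_bij; exists (fun p : {ffun I -> Z} * Z => (upd p.1 i p.2, p.1 i)) => -[om z] /=;
  congr pair; rewrite ?ffunE ?eqxx //; apply/ffunP => j; rewrite !ffunE;
  by case: eqP => [->|].
have -> : \sum_(p : {ffun I -> Z} * Z) F (upd (upd p.1 i p.2) i (p.1 i)) =
   \sum_(p : {ffun I -> Z} * Z) F p.1.
  apply: eq_bigr => -[om z] _ /=; congr F; apply/ffunP => j; rewrite !ffunE.
  by case: eqP => [->|].
rewrite -(pair_big xpredT xpredT (fun om _ => F om)) /=.
have -> : \sum_om \sum_(z : Z) F om = #|Z|%:R * \sum_om F om.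
  by rewrite mulr_sumr; apply: eq_bigr => om _; rewrite sumr_const mulr_natl.
by rewrite mulrC mulKf ?gt_eqF.
Qed.

Lemma ler_sample_mean F F' : (forall om, F om <= F' om) -> Ex F <= Ex F'.
Proof. by move=> FF; rewrite ler_pM2r ?invr_gt0 //; exact: ler_sum. Qed.

Lemma sample_meanZ c F : Ex (fun om => c * F om) = c * Ex F.
Proof. by rewrite /Ex -mulr_sumr mulrA. Qed.

Lemma sample_mean_sum (J : finType) (P : pred J) (F : J -> {ffun I -> Z} -> R) :
  Ex (fun om => \sum_(j | P j) F j om) = \sum_(j | P j) Ex (F j).
Proof. by rewrite /Ex exchange_big mulr_suml. Qed.

Lemma sample_mean_cst c : Ex (fun=> c) = c.
Proof. by rewrite /Ex sumr_const card_ffun -[c *+ _]mulr_natr mulfK ?gt_eqF. Qed.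

Lemma markov_card F (a : R) : 0 < a -> (forall om, 0 <= F om) ->
  #|[set om | a <= F om]%SET|%:R <= Ex F / a * (#|Z| ^ #|I|)%:R.
Proof.
move=> a0 F0; rewrite /Ex mulrAC divfK ?gt_eqF // ler_pdivlMr //.
rewrite -sum1_card natr_sum mulr_suml [leRHS](bigID (fun om => om \in [set om | a <= F om]%SET)) /=.
rewrite -[leLHS]addr0 lerD ?sumr_ge0 //; apply: ler_sum => om; rewrite inE.
by rewrite mul1r.
Qed.
End Expectation.

Section Chain.
Context {R : realType} (V I Z : finType) (v0 : V) (z0 : Z) (X : bool -> Z -> V).
Local Notation G := (@centering R V).
Local Notation Ex := (@sample_mean R I Z).
Let N : R := #|V|%:R.
Hypothesis X_indep : forall f g : V -> R,
  \sum_z f (X false z) * g (X true z) = #|Z|%:R / N ^+ 2 * ((\sum_v f v) * \sum_v g v).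

Let N_gt0 : 0 < N.
Proof. by rewrite ltr0n; apply/card_gt0P; exists v0. Qed.
Let Z_gt0 : 0 < #|Z|%:R :> R.
Proof. by rewrite ltr0n; apply/card_gt0P; exists z0. Qed.

Lemma sum_equidistributed b (f : V -> R) : \sum_z f (X b z) = #|Z|%:R / N * \sum_v f v.
Proof.
have one : \sum_(v : V) (1 : R) = N by rewrite sumr_const.
case: b.
  have := X_indep (fun=> 1) f; under eq_bigr do rewrite mul1r.
  by move=> ->; rewrite one; field; rewrite gt_eqF.
have := X_indep f (fun=> 1); under eq_bigr do rewrite mulr1.
by move=> ->; rewrite one; field; rewrite gt_eqF.
Qed.

(* Consecutive indices of the sequence are linked by [K b], with alternating [b]. *)
Fixpoint chain (K : bool -> I -> I -> R) b (i : I) (s : seq I) : R :=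
  if s is j :: s' then K b i j * chain K (~~ b) j s' else 1.

Lemma chain_mul K K' b i s :
  chain (fun b i j => K b i j * K' b i j) b i s = chain K b i s * chain K' b i s.
Proof.
elim: s b i => [|j s IH] b i /=; first by rewrite mulr1.
by rewrite IH mulrACA.
Qed.

Lemma eq_chain K K' b i s : {in i :: s &, forall j l b, K b j l = K' b j l} ->
  chain K b i s = chain K' b i s.
Proof.
elim: s b i => [//|j s IH] b i KK /=.
rewrite KK ?mem_head ?inE ?eqxx ?orbT //; congr (_ * _).
by apply: IH => k l ks ls c; apply: KK; rewrite inE ?ks ?ls orbT.
Qed.

Lemma chain_cat K b i s j s' :
  chain K b i (s ++ j :: s') =
  chain K b i s * K (b (+) odd (size s)) (last i s) j * chain K (~~ (b (+) odd (size s))) j s'.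
Proof.
elim: s b i => [|k s IH] b i /=; first by rewrite mul1r addbF.
by rewrite IH addbN addNb !mulrA.
Qed.

Definition link (om : {ffun I -> Z}) b i j : R := G (X b (om i)) (X b (om j)).

(* Each index met for the first time is averaged in a single factor of the chain,
   and the mean of [`|G|] over one variable is at most [2 / N]. *)
Lemma sample_mean_chain_le b i s :
  Ex (fun om => `|chain (link om) b i s|) <= (2 / N) ^+ #|[set j in i :: s]|.-1.
Proof.
have G2 y : \sum_x `|G x y| <= 2 by exact: sum_abs_centering.
have q0 : 0 <= 2 / N by rewrite divr_ge0 // ltW.
elim: s b i => [|j s IH] b i.
  have -> : #|[set j in [:: i]]|.-1 = 0.
    have -> : [set j in [:: i]] = [set i]%SET by apply/setP => k; rewrite !inE.
    by rewrite cards1.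
  by rewrite expr0 -[leRHS](sample_mean_cst I z0); apply: ler_sample_mean => // om; rewrite normr1.
have [iS|iS] := boolP (i \in j :: s).
  have -> : [set k in i :: j :: s] = [set k in j :: s].
    by apply/setP => k; rewrite !inE; case: eqP => // ->; move: iS; rewrite inE.
  apply: le_trans (IH (~~ b) j); apply: ler_sample_mean => // om /=.
  by rewrite normrM ler_piMl // centering_le1.
have -> : #|[set k in i :: j :: s]|.-1 = #|[set k in j :: s]|.-1.+1.
  have -> : [set k in i :: j :: s] = i |: [set k in j :: s].
    by apply/setP => k; rewrite !inE.
  rewrite cardsU1 inE iS /= prednK //.
  by apply/card_gt0P; exists j; rewrite !inE eqxx.
rewrite (sample_mean_upd z0 i) exprS.
apply: le_trans (ler_wpM2l q0 (IH (~~ b) j)).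
rewrite -sample_meanZ; apply: ler_sample_mean => // om.
rewrite ler_pdivrMr //.
have -> : \sum_z `|chain (link (upd om i z)) b i (j :: s)| =
   \sum_z (fun x => `|G x (X b (om j))|) (X b z) * `|chain (link om) (~~ b) j s|.
  apply: eq_bigr => z _ /=; rewrite normrM; congr (_ * _).
    by rewrite /link !ffunE eqxx ifN //; apply: contra iS => /eqP ->; rewrite mem_head.
  congr `|_|; apply: eq_chain => k l kS lS c; rewrite /link !ffunE !ifN //;
    by apply: contra iS => /eqP <-.
rewrite -mulr_suml (sum_equidistributed b (fun x => `|G x (X b (om j))|)).
rewrite [leRHS]mulrAC; apply: ler_wpM2r => //.
rewrite mulrAC [leRHS]mulrAC ler_pM2r ?invr_gt0 // mulrC.
by rewrite ler_wpM2r ?(ltW Z_gt0).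
Qed.

(** The term of a closed walk in the trace of a power of S S^T. Links alternate between the [true]
    and [false] ends of the edges; for a walk of even length the closing [false] link completes the
    alternation. *)
Definition closed_weight (om : {ffun I -> Z}) (s : seq I) : R :=
  if s is i :: s' then chain (link om) true i s' * link om false (last i s') i else 1.

(** The [true] links pair up the entries of a list of even length, so the only occurrence of i lies
    in exactly one of them, and that centering factor sums to 0. The induction removes one pair at a
    time. *)
Lemma chain_zero_sum (f : I -> V) i a s : odd (size s) -> count_mem i (a :: s) = 1 ->
  \sum_v chain (fun b j l => if b then
     G (if j == i then v else f j) (if l == i then v else f l) else 1) true a s = 0.
Proof.
have [n] := ubnP (size s); elim: n a s => // n IH a [//|b s] sn os cnt /=.
have ctail (c : bool) (d : I) t v : i \notin d :: t ->
    chain (fun b j l => if b then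
     G (if j == i then v else f j) (if l == i then v else f l) else 1) c d t =
    chain (fun b j l => if b then G (f j) (f l) else 1) c d t.
  move=> it; apply: eq_chain => j l js ls [] //.
  by rewrite !ifN //; apply: contra it => /eqP <-.
move: cnt; rewrite /= => cnt.
have [ai|ai] := eqVneq a i; last have [bi|bi] := eqVneq b i.
- have [bi its] : (b == i) = false /\ i \notin s.
    move: cnt; rewrite ai eqxx add1n => -[]; case: (b == i) => //; rewrite add0n => /eqP.
    by rewrite -leqn0 leqNgt -has_count has_pred1.
  rewrite bi.
  rewrite (eq_bigr (fun v => G (f b) v * chain (fun b j l => if b then G (f j) (f l) else 1) false b s)).
    by rewrite -mulr_suml sum_centering // mul0r.
  by move=> v _; rewrite ctail ?inE ?negb_or ?(eq_sym i) ?bi // centeringC.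
- have its : i \notin s.
    move: cnt; rewrite (negPf ai) bi eqxx add0n add1n => -[] /eqP.
    by rewrite -leqn0 leqNgt -has_count has_pred1.
  case: s its {sn os cnt IH} => [_|c s its].
    by under eq_bigr do rewrite mulr1; exact: sum_centering.
  rewrite (eq_bigr (fun v => G (f a) v * chain (fun b j l => if b then G (f j) (f l) else 1) true c s)).
    by rewrite -mulr_suml sum_centering // mul0r.
  by move=> v _ /=; rewrite mul1r ctail.
- move: cnt; rewrite (negPf ai) (negPf bi) !add0n => cnt.
  rewrite -mulr_sumr; case: s os cnt sn => [//|c s] os cnt sn.
  rewrite /=; under eq_bigr do rewrite mul1r.
  rewrite IH ?mulr0 //; first by move: sn; rewrite /= !ltnS; exact: ltnW.
  by move: os => /=; rewrite negbK.
Qed.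

(** Resampling coordinate i moves its two ends independently, so the sum factors by [X_indep] into a
    part B with the [false] links and a part A with the [true] links; the latter vanishes by
    [chain_zero_sum]. *)
Lemma sample_mean_closed_singleton s : ~~ odd (size s) -> ~~ no_singleton s ->
  Ex (fun om => closed_weight om s) = 0.
Proof.
move=> os /forallPn[i]; rewrite negbK => /eqP cnt.
case: s os cnt => [|a s] // os cnt.
rewrite (sample_mean_upd z0 i) /sample_mean big1 ?mul0r // => om _.
apply/eqP; rewrite mulf_eq0; apply/orP; left; apply/eqP.
pose xv b v j := if j == i then v else X b (om j).
pose A v := chain (fun b j l => if b then G (xv true v j) (xv true v l) else 1) true a s.
pose B v := chain (fun b j l => if b then 1 else G (xv false v j) (xv false v l)) true a s
  * G (xv false v (last a s)) (xv false v a).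
have -> : \sum_z closed_weight (upd om i z) (a :: s) = \sum_z B (X false z) * A (X true z).
  apply: eq_bigr => z _; rewrite /closed_weight /A /B [RHS]mulrAC.
  rewrite -chain_mul; congr (_ * _).
    apply: eq_chain => j l _ _ [] /=; rewrite /link /xv !ffunE ?mul1r ?mulr1;
    by case: (j == i); case: (l == i).
  by rewrite /link /xv !ffunE; case: (a == i); case: (last a s == i).
rewrite (X_indep B A) /A chain_zero_sum ?mulr0 //.
by move: os; rewrite /= negbK.
Qed.

(** The factor N / 2 makes up for the exponent in [sample_mean_chain_le], one less than the number
    of distinct indices: this is the loss inherent in bounding a norm by a trace. *)
Lemma sample_mean_closed_sum (h : nat) : (0 < h)%N -> 1 <= #|I|%:R * (2 / N) ->
  Ex (fun om => \sum_(t : h.*2.-tuple I) closed_weight om t)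
  <= N / 2 * ((h.+1 * h ^ h.*2)%:R * (#|I|%:R * (2 / N)) ^+ h).
Proof.
move=> h0 M1.
have q0 : 0 <= 2 / N by rewrite divr_ge0 // ltW.
rewrite sample_mean_sum (bigID (fun t : h.*2.-tuple I => no_singleton t)) /= [X in _ + X]big1 ?addr0.
  apply: le_trans (ler_wpM2l _ (no_singleton_sum h q0 M1)); last by rewrite divr_ge0 // ltW.
  rewrite mulr_sumr; apply: ler_sum => t _.
  have : (0 < size t)%N by rewrite size_tuple double_gt0.
  case: t => -[|i s] //= sz _.
  have -> : N / 2 * (2 / N) ^+ #|[set x in i :: s]| = (2 / N) ^+ #|[set x in i :: s]|.-1.
    rewrite -[in LHS](prednK (_ : 0 < #|[set x in i :: s]|)%N).
      by rewrite exprS mulrA (_ : N / 2 * (2 / N) = 1) ?mul1r //; field; rewrite gt_eqF.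
    by apply/card_gt0P; exists i; rewrite !inE eqxx.
  apply: le_trans (sample_mean_chain_le true i s).
  apply: ler_sample_mean => // om; apply: le_trans (ler_norm _) _.
  by rewrite normrM ler_piMr // centering_le1.
move=> t nt; apply: sample_mean_closed_singleton => //.
by rewrite size_tuple odd_double.
Qed.

End Chain.

(** * Moments of the deviation of degrees *)

Section Degree.
Context {R : realType} (V I Z : finType) (v0 : V) (z0 : Z) (X : Z -> V).
Local Notation G := (@centering R V).
Local Notation Ex := (@sample_mean R I Z).
Let N : R := #|V|%:R.
Hypothesis X_equi : forall f : V -> R, \sum_z f (X z) = #|Z|%:R / N * \sum_v f v.

Let N_gt0 : 0 < N.
Proof. by rewrite ltr0n; apply/card_gt0P; exists v0. Qed.
Let Z_gt0 : 0 < #|Z|%:R :> R.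
Proof. by rewrite ltr0n; apply/card_gt0P; exists z0. Qed.

Let q0 : 0 <= 2 / N.
Proof. by rewrite divr_ge0 // ltW. Qed.

Lemma prod_upd_notin (om : {ffun I -> Z}) i z (s : seq I) (f : Z -> R) : i \notin s ->
  \prod_(j <- s) f (upd om i z j) = \prod_(j <- s) f (om j).
Proof.
move=> iS; rewrite big_seq [RHS]big_seq; apply: eq_bigr => j jS.
by rewrite ffunE ifN //; apply: contra iS => /eqP <-.
Qed.

Lemma sample_mean_prod_le x (s : seq I) :
  Ex (fun om => `|\prod_(j <- s) G (X (om j)) x|) <= (2 / N) ^+ #|[set j in s]|.
Proof.
elim: s => [|i s IH].
  have -> : [set j in [::]] = finset.set0 :> {set I} by apply/setP => k; rewrite !inE.
  rewrite cards0 expr0 -[leRHS](sample_mean_cst I z0); apply: ler_sample_mean => // om.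
  by rewrite big_nil normr1.
have [iS|iS] := boolP (i \in s).
  have -> : [set k in i :: s] = [set k in s].
    by apply/setP => k; rewrite !inE; case: eqP => // ->.
  apply: le_trans IH; apply: ler_sample_mean => // om.
  by rewrite big_cons normrM ler_piMl // centering_le1.
have -> : [set k in i :: s] = i |: [set k in s].
  by apply/setP => k; rewrite !inE.
rewrite cardsU1 inE iS add1n exprS (sample_mean_upd z0 i).
apply: le_trans (ler_wpM2l q0 IH).
rewrite -sample_meanZ; apply: ler_sample_mean => // om.
rewrite ler_pdivrMr //.
rewrite (eq_bigr (fun z => `|G (X z) x| * `|\prod_(j <- s) G (X (om j)) x|)); last first.
  move=> z _; rewrite -normrM big_cons (prod_upd_notin om z (fun y => G (X y) x) iS).
  by rewrite ffunE eqxx.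
rewrite -mulr_suml (X_equi (fun y => `|G y x|)).
rewrite [leRHS]mulrAC; apply: ler_wpM2r => //.
rewrite mulrAC [leRHS]mulrAC ler_pM2r ?invr_gt0 // mulrC.
by rewrite ler_wpM2r ?(ltW Z_gt0) // sum_abs_centering.
Qed.

Lemma sample_mean_prod_singleton x s : ~~ no_singleton s ->
  Ex (fun om => \prod_(j <- s) G (X (om j)) x) = 0.
Proof.
move=> /forallPn[i]; rewrite negbK => /eqP cnt.
rewrite (sample_mean_upd z0 i) /sample_mean big1 ?mul0r // => om _.
rewrite [X in X / _](_ : _ = 0) ?mul0r //.
elim: s cnt => [//|a s IH] /=; have [->|ai] := eqVneq a i.
  rewrite add1n => -[] /eqP; rewrite -leqn0 leqNgt -has_count has_pred1 => iS.
  under eq_bigr => z _ do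
    rewrite big_cons (prod_upd_notin om z (fun y => G (X y) x) iS) ffunE eqxx.
  rewrite -mulr_suml (X_equi (fun y => G y x)).
  by rewrite sum_centering_l // mulr0 mul0r.
rewrite add0n => /IH {}IH.
under eq_bigr => z _ do rewrite big_cons ffunE (negPf ai).
by rewrite -mulr_sumr IH mulr0.
Qed.

(** The inner sum is the number of i with [X (om i) = x] minus its mean #I / N. Its power expands
    over tuples of indices, and those with an index occurring once have mean 0. *)
Lemma sample_mean_degree_moment (h : nat) : 1 <= #|I|%:R * (2 / N) ->
  Ex (fun om => \sum_x (\sum_i G (X (om i)) x) ^+ h.*2)
  <= N * ((h.+1 * h ^ h.*2)%:R * (#|I|%:R * (2 / N)) ^+ h).
Proof.
move=> M1; rewrite sample_mean_sum.
rewrite /N mulr_natl -sumr_const; apply: ler_sum => x _.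
apply: le_trans (no_singleton_sum h q0 M1).
rewrite [X in X <= _](_ : _ = Ex (fun om => \sum_(t : h.*2.-tuple I) \prod_(j <- t) G (X (om j)) x)); last first.
  by congr (_ / _); apply: eq_bigr => om _; rewrite expr_sum_tuple.
rewrite sample_mean_sum (bigID (fun t : h.*2.-tuple I => no_singleton t)) /= [X in _ + X]big1 ?addr0.
  apply: ler_sum => t _; apply: le_trans (sample_mean_prod_le x t).
  by apply: ler_sample_mean => // om; exact: ler_norm.
by move=> t nt; exact: sample_mean_prod_singleton.
Qed.

End Degree.

(** * Spectral gap for Hilbert space valued maps *)

Lemma mulr_sum_sum (R : pzRingType) (I J : finType) (a : I -> R) (b : J -> R) :
  (\sum_i a i) * (\sum_j b j) = \sum_i \sum_j a i * b j.
Proof. by rewrite mulr_suml; apply: eq_bigr => i _; rewrite mulr_sumr. Qed.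

Section InnerProduct.
Context {R : realType} (H : lmodType R) (ip : H -> H -> R).
Hypothesis ipC : forall x y, ip x y = ip y x.
Hypothesis ip_lin : forall a x y z, ip (a *: x + y) z = a * ip x z + ip y z.
Hypothesis ip_ge0 : forall x, 0 <= ip x x.

Let ipDl x y z : ip (x + y) z = ip x z + ip y z.
Proof. by rewrite -[x in ip (x + _)]scale1r ip_lin mul1r. Qed.
Let ip0l z : ip 0 z = 0.
Proof. by apply: (addIr (ip 0 z)); rewrite -ipDl !add0r. Qed.
Let ipZl a x z : ip (a *: x) z = a * ip x z.
Proof. by rewrite -[a *: x]addr0 ip_lin ip0l addr0. Qed.
Let ipDr x y z : ip z (x + y) = ip z x + ip z y.
Proof. by rewrite ipC ipDl !(ipC z). Qed.
Let ipZr a x z : ip z (a *: x) = a * ip z x.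
Proof. by rewrite ipC ipZl ipC. Qed.
Let ipBsq x y : ip (x - y) (x - y) = ip x x - 2 * ip x y + ip y y.
Proof. by rewrite -scaleN1r !(ipDl, ipDr, ipZl, ipZr) (ipC y x); ring. Qed.
Let ip_suml (J : finType) (f : J -> H) z : ip (\sum_j f j) z = \sum_j ip (f j) z.
Proof.
by elim/big_rec2: _ => [|j x y _ <-]; rewrite ?ip0l ?ipDl.
Qed.
Let ip_sumr (J : finType) (f : J -> H) z : ip z (\sum_j f j) = \sum_j ip z (f j).
Proof. by rewrite ipC ip_suml; apply: eq_bigr => j _; rewrite ipC. Qed.

Section Kernels.
Variable V : finType.
Implicit Types (phi psi : V -> H) (A B : V -> V -> R).

Definition fdot phi psi : R := \sum_v ip (phi v) (psi v).
Definition kapp A phi : V -> H := fun x => \sum_y A x y *: phi y.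
Definition kmul A B : V -> V -> R := fun x z => \sum_y A x y * B y z.
Definition ktr A : V -> V -> R := fun x y => A y x.

Lemma fdot_ge0 phi : 0 <= fdot phi phi.
Proof. by apply: sumr_ge0 => v _; exact: ip_ge0. Qed.

Lemma fdot_CS phi psi : fdot phi psi ^+ 2 <= fdot phi phi * fdot psi psi.
Proof.
apply: quadratic_ge0_discr (fdot_ge0 psi) _ => t.
have := fdot_ge0 (fun v => phi v + t *: psi v).
rewrite /fdot (eq_bigr (fun v => ip (phi v) (phi v) + (2 * t * ip (phi v) (psi v)
   + t ^+ 2 * ip (psi v) (psi v)))).
  by rewrite !big_split -!mulr_sumr /= addrA.
by move=> v _; rewrite !(ipDl, ipDr, ipZl, ipZr) (ipC (psi v) (phi v)); ring.
Qed.

Lemma fdot_kapp A phi psi : fdot phi (kapp A psi) = fdot (kapp (ktr A) phi) psi.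
Proof.
rewrite /fdot /kapp /ktr.
under eq_bigr do rewrite ip_sumr.
under [RHS]eq_bigr do rewrite ip_suml.
rewrite exchange_big /=; apply: eq_bigr => y _; apply: eq_bigr => x _.
by rewrite ipZr ipZl.
Qed.

Lemma kapp_mul A B phi x : kapp (kmul A B) phi x = kapp A (kapp B phi) x.
Proof.
rewrite /kapp /kmul.
under eq_bigr do rewrite scaler_suml.
rewrite exchange_big /=; apply: eq_bigr => y _; rewrite scaler_sumr.
by apply: eq_bigr => z _; rewrite scalerA.
Qed.

Lemma fdot_kapp_sq A phi : (forall x y, A x y = A y x) ->
  fdot phi (kapp (kmul A A) phi) = fdot (kapp A phi) (kapp A phi).
Proof.
move=> As; rewrite /fdot; under eq_bigr do rewrite kapp_mul.
rewrite -/(fdot phi _) fdot_kapp /fdot; apply: eq_bigr => x _.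
by congr (ip _ _); apply: eq_bigr => y _; rewrite /ktr As.
Qed.

(** Works without coordinates in [H]: in row x, Cauchy-Schwarz pairs [phi] with y -> A x y s, where
    s is the value of A phi at x, and one factor |s|^2 cancels. *)
Lemma hilbert_schmidt_bound A phi :
  fdot (kapp A phi) (kapp A phi) <= (\sum_x \sum_y A x y ^+ 2) * fdot phi phi.
Proof.
rewrite mulr_suml; apply: ler_sum => x _.
set s := kapp A phi x; have [s0|s0] := eqVneq (ip s s) 0.
  by rewrite s0 mulr_ge0 ?fdot_ge0 // sumr_ge0 // => y _; rewrite sqr_ge0.
have sp : 0 < ip s s by rewrite lt_def s0 ip_ge0.
have := fdot_CS (fun y => A x y *: s) phi.
have -> : fdot (fun y => A x y *: s) phi = ip s s.
  by rewrite {3}/s ip_sumr; apply: eq_bigr => y _; rewrite ipZl ipZr.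
have -> : fdot (fun y => A x y *: s) (fun y => A x y *: s) = (\sum_y A x y ^+ 2) * ip s s.
  by rewrite mulr_suml; apply: eq_bigr => y _; rewrite ipZl ipZr mulrA expr2.
by rewrite expr2 mulrAC ler_pM2r.
Qed.

(** Repeated squaring in place of diagonalization. With q_k the form of the k-th kernel, q_(k+1) =
    |A_k phi|^2, so Cauchy-Schwarz gives q_k^2 <= |phi|^2 q_(k+1). The Hilbert-Schmidt bound at the
    top level descends to level 0, which is why powers of two suffice. *)
Lemma fdot_powers_bound (A : nat -> V -> V -> R) (c : R) j phi :
  (forall k x y, A k x y = A k y x) ->
  (forall k x y, A k.+1 x y = kmul (A k) (A k) x y) ->
  0 <= c -> \sum_x \sum_y A j x y ^+ 2 <= c ^+ (2 ^ j.+1) ->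
  fdot phi (kapp (A 0) phi) <= c * fdot phi phi.
Proof.
move=> As AM c0 Aj; set F := fdot phi phi.
have F0 : 0 <= F by exact: fdot_ge0.
have qS k : fdot phi (kapp (A k.+1) phi) = fdot (kapp (A k) phi) (kapp (A k) phi).
  rewrite -fdot_kapp_sq //; apply: eq_bigr => x _; congr (ip _ _).
  by apply: eq_bigr => y _; rewrite AM.
suff H0 i : (i <= j.+1)%N -> fdot phi (kapp (A (j.+1 - i)%N) phi) <= c ^+ (2 ^ (j.+1 - i)) * F.
  by have := H0 j.+1 (leqnn _); rewrite subnn.
elim: i => [_|i IH ij].
  by rewrite subn0 qS; apply: le_trans (hilbert_schmidt_bound _ _) _; rewrite ler_wpM2r.
have e : (j.+1 - i = (j.+1 - i.+1).+1)%N by rewrite -subSn // subSS.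
have := IH (ltnW ij); rewrite e; set k := (j.+1 - i.+1)%N => {}IH.
have := fdot_CS phi (kapp (A k) phi); rewrite -qS => h.
rewrite -[leLHS]addr0 leNgt; apply/negP; rewrite addr0 => lt.
have cF0 : 0 <= c ^+ (2 ^ k) * F by rewrite mulr_ge0 ?exprn_ge0.
have : (c ^+ (2 ^ k) * F) ^+ 2 < fdot phi (kapp (A k) phi) ^+ 2.
  by rewrite ltr_pXn2r ?nnegrE // ltW // (le_lt_trans cF0).
rewrite ltNge => /negP; apply; apply: le_trans h _.
apply: le_trans (ler_wpM2l F0 IH) _.
by rewrite exprMn -exprM -expnSr mulrCA expr2.
Qed.

End Kernels.

Section Spectral.
Variables (V I : finType) (v0 : V) (x : bool -> I -> V).
Local Notation G := (@centering R V).
Let N : R := #|V|%:R.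
Let N_gt0 : 0 < N.
Proof. by rewrite ltr0n; apply/card_gt0P; exists v0. Qed.

Definition glink b i j : R := G (x b i) (x b j).

Definition closed_sum n : R := \sum_(t : n.-tuple I)
  if tval t is i :: s then chain glink true i s * glink false (last i s) i else 1.

(** The biadjacency matrix of the edges, compressed on both sides to functions of sum 0. *)
Definition edge_kernel : V -> V -> R :=
  fun p q => \sum_i G p (x false i) * G (x true i) q.

(* The [2 ^ k]-th power of [S S^T], for [S] the edge kernel. *)
Fixpoint edge_power (k : nat) : V -> V -> R :=
  if k is k'.+1 then kmul (edge_power k') (edge_power k')
  else kmul edge_kernel (ktr edge_kernel).

Lemma edge_powerC k p q : edge_power k p q = edge_power k q p.
Proof.
elim: k p q => [|k IH] p q /=; rewrite /kmul /ktr; apply: eq_bigr => y _.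
  by rewrite mulrC.
by rewrite mulrC (IH p) (IH y).
Qed.

Definition walk_weight (p : V) (s : seq I) (q : V) : R :=
  if s is i :: s' then
    G p (x false i) * chain glink true i s' * G (x false (last i s')) q
  else G p q.

(** Idempotence of the centering merges the two outer factors meeting at q into one [false] link,
    the type required by alternation since s has even length. *)
Lemma walk_weight_cat p s s' r : ~~ odd (size s) ->
  \sum_q walk_weight p s q * walk_weight q s' r = walk_weight p (s ++ s') r.
Proof.
move=> os.
have idem y : \sum_q G y q * walk_weight q s' r = walk_weight y s' r.
  case: s' => [|i s'] /=; first by rewrite (centering_idem v0).
  rewrite -(centering_idem v0 y (x false i)) !mulr_suml.
  by apply: eq_bigr => q _; rewrite !mulrA.
case: s os => [|i s] os //=.
under eq_bigr do rewrite -mulrA.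
rewrite -mulr_sumr idem; case: s' {idem} => [|j s'] /=; first by rewrite cats0.
rewrite chain_cat last_cat /=.
have -> : odd (size s) by move: os; rewrite /= negbK.
by rewrite /= /glink !mulrA.
Qed.

Lemma edge_power_walks k p r :
  edge_power k p r = \sum_(t : (2 ^ k.+1).-tuple I) walk_weight p t r.
Proof.
elim: k p r => [|k IH] p r.
  rewrite expn1 (sum_tuple_cons 1 (fun t => walk_weight p t r)).
  under [RHS]eq_bigr => i _ do rewrite (sum_tuple_cons 0 (fun t => walk_weight p (i :: t) r)).
  rewrite /= /kmul /ktr /edge_kernel.
  under [LHS]eq_bigr do rewrite mulr_sum_sum.
  rewrite exchange_big /=; apply: eq_bigr => i _; rewrite exchange_big /=; apply: eq_bigr => j _.
  rewrite [RHS](eq_bigr (fun=> walk_weight p [:: i; j] r)) => [|t _]; last by rewrite tuple0.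
  rewrite sumr_const card_tuple expn0 mulr1n /= mulr1 /glink.
  rewrite -(centering_idem v0 (x true i)) mulr_sumr mulr_suml; apply: eq_bigr => y _.
  by rewrite (centeringC r) (centeringC y (x true j)); ring.
rewrite [(2 ^ k.+2)%N]expnS mul2n -addnn (sum_tuple_cat _ _ (fun t => walk_weight p t r)) /= /kmul.
under [LHS]eq_bigr do rewrite !IH mulr_sum_sum.
rewrite exchange_big /=; apply: eq_bigr => t _; rewrite exchange_big /=; apply: eq_bigr => t' _.
by rewrite walk_weight_cat // size_tuple expnS mul2n odd_double.
Qed.

(** The squared Hilbert-Schmidt norm of a symmetric matrix is the trace of its square, here (S S^T)
    to the power 2^(k+1), that is, closed walks of length 2^(k+2). *)
Lemma hilbert_schmidt_edge_power k :
  \sum_p \sum_q edge_power k p q ^+ 2 = closed_sum (2 ^ k.+2).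
Proof.
rewrite (eq_bigr (fun p => edge_power k.+1 p p)); last first.
  by move=> p _; apply: eq_bigr => q _; rewrite expr2 {2}edge_powerC.
under eq_bigr do rewrite edge_power_walks.
rewrite exchange_big /=; apply: eq_bigr => t _.
have : (0 < size t)%N by rewrite size_tuple expn_gt0.
case: (tval t) => [//|i s] _ /=.
under eq_bigr do rewrite mulrAC mulrC.
rewrite -mulr_sumr; congr (_ * _).
rewrite /glink -(centering_idem v0 (x false (last i s))).
by apply: eq_bigr => p _; rewrite mulrC.
Qed.

Lemma fdot_edge_kernel (phi psi : V -> H) : \sum_v phi v = 0 -> \sum_v psi v = 0 ->
  fdot phi (kapp edge_kernel psi) = \sum_i ip (phi (x false i)) (psi (x true i)).
Proof.
move=> phi0 psi0.
have G0 (f : V -> H) p : \sum_v f v = 0 -> \sum_q G p q *: f q = f p.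
  by move=> f0; rewrite sum_centering_fun f0 scaler0 subr0.
rewrite /fdot (eq_bigr (fun p => \sum_i ip (G (x false i) p *: phi p) (psi (x true i)))).
  rewrite exchange_big /=; apply: eq_bigr => i _.
  by rewrite -ip_suml G0.
move=> p _.
have -> : kapp edge_kernel psi p = \sum_i G p (x false i) *: psi (x true i).
  rewrite /kapp /edge_kernel; under eq_bigr do rewrite scaler_suml.
  rewrite exchange_big /=; apply: eq_bigr => i _.
  by rewrite -[in RHS](G0 psi) // scaler_sumr; apply: eq_bigr => q _; rewrite scalerA.
by rewrite ip_sumr; apply: eq_bigr => i _; rewrite ipZr ipZl centeringC.
Qed.

Lemma edge_form_bound (theta : R) k (phi psi : V -> H) :
  0 <= theta -> closed_sum (2 ^ k.+2) <= theta ^+ (2 ^ k.+2) ->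
  \sum_v phi v = 0 -> \sum_v psi v = 0 ->
  (\sum_i ip (phi (x false i)) (psi (x true i))) ^+ 2
    <= theta ^+ 2 * (fdot phi phi * fdot psi psi).
Proof.
move=> th0 cl phi0 psi0; rewrite -fdot_edge_kernel // fdot_kapp.
apply: le_trans (fdot_CS _ _) _; rewrite mulrA ler_wpM2r ?fdot_ge0 //.
have -> : fdot (kapp (ktr edge_kernel) phi) (kapp (ktr edge_kernel) phi) =
  fdot phi (kapp (edge_power 0) phi).
  by rewrite -fdot_kapp /fdot; apply: eq_bigr => v _; rewrite kapp_mul.
apply: (@fdot_powers_bound _ _ _ k) => //; first exact: edge_powerC.
- by rewrite sqr_ge0.
- by rewrite hilbert_schmidt_edge_power -exprM -expnS.
Qed.

(** After centering, expand the square. Each diagonal sum is at least (1 - eps) D |phi|^2 by the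
    lower bound on degrees, and the cross term is at most eps D |phi|^2 by the norm of S. *)
Lemma edge_energy_bound (eps D : R) k (phi psi : V -> H) :
  0 <= eps <= 1 -> D = #|I|%:R / N ->
  (forall b p, - (eps * D) <= \sum_i G (x b i) p) ->
  closed_sum (2 ^ k.+2) <= (eps * D) ^+ (2 ^ k.+2) ->
  \sum_v phi v = \sum_v psi v -> fdot phi phi = fdot psi psi ->
  2 * (1 - 2 * eps) * D * (fdot phi phi - ip (\sum_v phi v) (\sum_v phi v) / N)
    <= \sum_i ip (phi (x false i) - psi (x true i)) (phi (x false i) - psi (x true i)).
Proof.
move=> /andP[e0 e1] DE deg cl sumE sqE.
have D0 : 0 <= D by rewrite DE divr_ge0 // ltW.
pose c := N^-1 *: \sum_v phi v.
pose phi' v := phi v - c; pose psi' v := psi v - c.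
have cent (f : V -> H) : \sum_v f v = \sum_v phi v -> \sum_v (f v - c) = 0.
  move=> fE; rewrite sumrB fE sumr_const -scaler_nat /c scalerA mulfV ?gt_eqF //.
  by rewrite scale1r subrr.
have phi0 : \sum_v phi' v = 0 by exact: cent.
have psi0 : \sum_v psi' v = 0 by apply: cent.
have sq (f : V -> H) : \sum_v f v = \sum_v phi v ->
   fdot (fun v => f v - c) (fun v => f v - c) =
   fdot f f - ip (\sum_v phi v) (\sum_v phi v) / N.
  move=> fE; rewrite /fdot; under eq_bigr do rewrite ipBsq.
  rewrite big_split /= sumrB -mulr_sumr -ip_suml fE sumr_const /c !ipZr !ipZl.
  rewrite -[_ *+ #|V|]mulr_natl -/N; field; by rewrite gt_eqF.
have {}sqE : fdot psi' psi' = fdot phi' phi' by rewrite /psi' /phi' !sq // sqE.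
have -> : fdot phi phi - ip (\sum_v phi v) (\sum_v phi v) / N = fdot phi' phi'.
  by rewrite /phi' sq.
set F := fdot phi' phi' in sqE *.
have F0 : 0 <= F by exact: fdot_ge0.
have degE (f : V -> H) b : (1 - eps) * D * fdot f f <= \sum_i ip (f (x b i)) (f (x b i)).
  have -> : \sum_i ip (f (x b i)) (f (x b i)) =
    \sum_v (D + \sum_i G (x b i) v) * ip (f v) (f v).
    under [RHS]eq_bigr do rewrite mulrDl mulr_suml.
    rewrite big_split /= exchange_big /= -mulr_sumr.
    rewrite [X in _ + X](_ : _ = \sum_i (ip (f (x b i)) (f (x b i)) - N^-1 * \sum_v ip (f v) (f v))).
      rewrite sumrB sumr_const -[_ *+ #|I|]mulr_natl DE; ring.
    by apply: eq_bigr => i _; exact: (sum_centering_fun (fun v => ip (f v) (f v) : R^o)).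
  rewrite mulr_sumr; apply: ler_sum => v _; rewrite ler_wpM2r //.
  have := deg b v; lra.
have cross : \sum_i ip (phi' (x false i)) (psi' (x true i)) <= eps * D * F.
  have := edge_form_bound (mulr_ge0 e0 D0) cl phi0 psi0; rewrite sqE -/F => h.
  rewrite (le_trans (ler_norm _)) // -sqrtr_sqr.
  rewrite -[leRHS]ger0_norm ?mulr_ge0 // -sqrtr_sqr ler_wsqrtr //.
  by rewrite exprMn [F ^+ 2]expr2.
have h1 := degE phi' false; have h2 := degE psi' true.
have -> : \sum_i ip (phi (x false i) - psi (x true i)) (phi (x false i) - psi (x true i)) =
  \sum_i ip (phi' (x false i)) (phi' (x false i))
  - 2 * (\sum_i ip (phi' (x false i)) (psi' (x true i)))
  + \sum_i ip (psi' (x true i)) (psi' (x true i)).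
  rewrite mulr_sumr -sumrB -big_split /=; apply: eq_bigr => i _; rewrite -ipBsq.
  by rewrite /phi' /psi' opprB addrA addrNK.
move: h1 h2 cross; rewrite sqE -/F; lra.
Qed.

End Spectral.
End InnerProduct.

(** * The invariant delta *)

Lemma weighted_sqr_le (R : realFieldType) (J : finType) (w a : J -> R) :
  (forall j, 0 <= w j) -> \sum_j w j = 1 ->
  (\sum_j w j * a j) ^+ 2 <= \sum_j w j * a j ^+ 2.
Proof.
move=> w0 w1; set mean := \sum_j w j * a j.
have : 0 <= \sum_j w j * (a j - mean) ^+ 2.
  by apply: sumr_ge0 => j _; rewrite mulr_ge0 ?sqr_ge0.
rewrite (eq_bigr (fun j => w j * a j ^+ 2 - 2 * mean * (w j * a j) + mean ^+ 2 * w j)).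
  by rewrite big_split sumrB /= -!mulr_sumr w1 -/mean; lra.
by move=> j _; ring.
Qed.

Section DeltaInvariant.
Context {R : realType} (Y : metricType R).
Local Notation "d[ x , y ]" := (mdist x y) (format "d[ x ,  y ]").

(** Ensures that [delta_space] is the supremum of a bounded set, hence a true upper bound. Empty
    infima and null denominators give 0. *)
Lemma delta_meas_le1 (mu : {fsfun Y -> R with 0}) : is_prob mu -> delta_meas mu <= 1.
Proof.
move=> [mu0 mu1]; rewrite /delta_meas; set S := [set _ | _].
have [->|S0] := eqVneq S set0; first by rewrite inf0.
have [r Sr] : S !=set0 by apply/set0P.
apply: le_trans (_ : r <= _).
  apply: ge_inf => //; exists 0 => _ [b [H [phi [_ _ _ _ ->]]]].
  by rewrite divr_ge0 ?sqr_ge0 // sumr_ge0 // => p _; rewrite mulr_ge0 ?sqr_ge0.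
case: Sr => [b [H [phi [_ _ _ _ ->]]]]; rewrite /delta_ratio.
set den := \sum_p _ * _.
have le : `|\sum_p mu (val p) *: phi p| ^+ 2 <= den.
  apply: le_trans (weighted_sqr_le (fun p => `|phi p|) (fun p => mu0 (val p)) mu1).
  rewrite lerXn2r ?nnegrE ?sumr_ge0 // => [p _|]; first by rewrite mulr_ge0.
  apply: le_trans (ler_norm_sum _ _ _) _; apply: ler_sum => p _.
  by rewrite normrZ ger0_norm.
have : 0 <= den by apply: le_trans le; rewrite sqr_ge0.
rewrite le0r => /orP[/eqP ->|den0]; first by rewrite invr0 mulr0.
by rewrite ler_pdivrMr // mul1r.
Qed.

Lemma delta_meas_le_space (mu : {fsfun Y -> R with 0}) :
  is_prob mu -> ~ is_dirac mu -> delta_meas mu <= delta_space Y.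
Proof.
move=> mup mud; apply: ub_le_sup; last by exists mu.
by exists 1 => _ [nu [nup _ ->]]; exact: delta_meas_le1.
Qed.

Lemma is_barycenter_unique (mu : {fsfun Y -> R with 0}) b b' :
  is_barycenter mu b -> is_barycenter mu b' -> b = b'.
Proof.
move=> bP bP'; apply: contrapT => bb'.
by have := lt_trans (bP b' (nesym bb')) (bP' b bb'); rewrite ltxx.
Qed.

Section Empirical.
Context (V : finType) (v0 : V) (f : V -> Y).
Let N : R := #|V|%:R.
Let N_gt0 : 0 < N.
Proof. by rewrite ltr0n; apply/card_gt0P; exists v0. Qed.

(** The image of the uniform measure on [V]; a point is weighted by its number of preimages, as [f]
    need not be injective. *)
Definition empirical : {fsfun Y -> R with 0} :=
  [fsfun p in seq_fset tt (codom f) => (#|[pred v | f v == p]|%:R / #|V|%:R) | 0].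

Lemma empiricalE p : empirical p = #|[pred v | f v == p]|%:R / N.
Proof.
rewrite /empirical fsfunE seq_fsetE; case: ifPn => // pf.
rewrite (eq_card0 (A := [pred v | f v == p])) ?mul0r // => v; rewrite !inE.
by apply: contraNF pf => /eqP <-; exact: codom_f.
Qed.

Lemma mem_finsupp_empirical p : (p \in finsupp empirical) = (p \in codom f).
Proof.
rewrite mem_finsupp empiricalE mulf_eq0 invr_eq0 (gt_eqF N_gt0) orbF pnatr_eq0.
apply/idP/idP => [|/codomP[v ->]].
  by rewrite -lt0n => /card_gt0P[v]; rewrite inE => /eqP <-; exact: codom_f.
by rewrite -lt0n; apply/card_gt0P; exists v; rewrite inE.
Qed.

Lemma sum_empirical (L : lmodType R) (h : Y -> L) :
  \sum_(p : finsupp empirical) empirical (val p) *: h (val p) = N^-1 *: \sum_v h (f v).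
Proof.
rewrite -(big_seq_fsetE _ _ xpredT (fun p => empirical p *: h p)) /=.
under eq_bigr do rewrite empiricalE mulrC -scalerA -sum1_card natr_sum scaler_suml.
rewrite -scaler_sumr; congr (_ *: _).
rewrite (exchange_big_dep xpredT) //=; apply: eq_bigr => v _.
rewrite (eq_bigl (pred1 (f v))) => [|p]; last by rewrite inE eq_sym.
rewrite -big_filter filter_pred1_uniq ?fset_uniq //; last by rewrite mem_finsupp_empirical codom_f.
by rewrite big_seq1 scale1r.
Qed.

Lemma sum_empirical_real (h : Y -> R) :
  \sum_(p : finsupp empirical) empirical (val p) * h (val p) = N^-1 * \sum_v h (f v).
Proof. exact: (sum_empirical (h : Y -> R^o)). Qed.

Lemma empirical_is_prob : is_prob empirical.
Proof.
split=> [p|]; first by rewrite empiricalE divr_ge0 // ltW.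
have := sum_empirical_real (fun=> 1); under eq_bigr do rewrite mulr1.
by move=> ->; rewrite sumr_const mulVf // gt_eqF.
Qed.

Lemma empirical_barycenter b : variance_center f b -> is_barycenter empirical b.
Proof.
move=> bP q qb; rewrite /sq_dist_integral.
rewrite (sum_empirical_real (fun p => mdist p b ^+ 2)).
rewrite (sum_empirical_real (fun p => mdist p q ^+ 2)) ltr_pM2l ?invr_gt0 //.
apply: lt_le_trans (bP q); rewrite ltrDl mulr_gt0 // exprn_gt0 // mdist_gt0.
by apply/eqP => /esym.
Qed.

(* [delta_meas] is an infimum, hence 0 on the empty set: extracting a map from it
   requires an admissible map to start with, here with values on a line of [ell2]. *)
Lemma empirical_almost_optimal b (dlt : R) : variance_center f b ->
  delta_space Y < dlt -> 0 < sumsq f b ->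
  exists (H : completeNormedModType R) (ip : {dot H for idfun}) (phi : Y -> H),
    [/\ forall x, `|x| ^+ 2 = ip x x,
        forall v, `|phi (f v)| = d[b, f v],
        forall v w, `|phi (f v) - phi (f w)| <= d[f v, f w] &
        `|\sum_v phi (f v)| ^+ 2 / N <= dlt * sumsq f b].
Proof.
move=> bP dltP sb0.
have mub := empirical_barycenter bP.
have mud : ~ is_dirac empirical.
  move=> [p pP]; have fp v : f v = p.
    apply/eqP; have := mem_finsupp_empirical (f v); rewrite codom_f pP.
    by rewrite finmap.inE.
  have := bP p; have -> : sumsq f p = 0.
    by rewrite /sumsq big1 // => v _; rewrite fp mdistxx expr0n.
  move: sb0 (mulr_ge0 (ltW N_gt0) (sqr_ge0 d[b, p])); rewrite -/N; lra.
have := le_lt_trans (delta_meas_le_space empirical_is_prob mud) dltP.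
rewrite /delta_meas; set S := [set _ | _] => Sd.
have S0 : has_inf S.
  split; last first.
    exists 0 => _ [b' [H [phi [_ _ _ _ ->]]]].
    rewrite divr_ge0 ?sqr_ge0 // sumr_ge0 // => p _; rewrite mulr_ge0 ?sqr_ge0 //.
    by case: empirical_is_prob.
  pose e : @ell2_space R := ell2_unit 0.
  have en : `|e| != 0.
    rewrite normr_eq0; apply/eqP => /(congr1 (fun x : ell2 => x 0)) /=.
    by move/eqP; rewrite oner_eq0.
  pose phi (p : finsupp empirical) := (d[b, val p] / `|e|) *: e.
  exists (delta_ratio phi); exists b, (@ell2_space R), phi; split => //.
  - exact: ell2_is_hilbert.
  - exact: ell2_infinite_dimensional.
  - split=> p; first by rewrite normrZ normrM normfV normr_id mulfVK // ger0_norm ?mdist_ge0.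
    move=> q; rewrite -scalerBl -mulrBl normrZ normrM normfV normr_id mulfVK //.
    rewrite ler_norml; apply/andP; split.
      by have := metric_triangle b (val p) (val q); lra.
    by have := metric_triangle b (val q) (val p); rewrite (metric_sym (val q)); lra.
have dS : 0 < dlt - inf S by rewrite subr_gt0.
have [_ [b' [H [phi [b'P [ip ipP] _ [phib phid] ->]]]]] := inf_adherent dS S0.
rewrite (is_barycenter_unique b'P mub) in phib; rewrite addrC subrK => rlt.
pose phi' (p : Y) : H := if insub p is Some q then phi q else 0.
have inS v : f v \in finsupp empirical by rewrite mem_finsupp_empirical codom_f.
have phi'E (q : finsupp empirical) : phi' (val q) = phi q by rewrite /phi' valK.
have phi'f v : phi' (f v) = phi [` inS v]%fset by rewrite -phi'E.
exists H, ip, phi'; split => // [v|v w|].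
- by rewrite phi'f phib.
- by rewrite !phi'f phid.
move: rlt; rewrite /delta_ratio.
under eq_bigr do rewrite -phi'E.
rewrite sum_empirical.
have -> : \sum_p empirical (val p) * `|phi p| ^+ 2 = N^-1 * sumsq f b.
  under eq_bigr do rewrite phib metric_sym.
  by rewrite (sum_empirical_real (fun p => d[p, b] ^+ 2)).
rewrite ltr_pdivrMr ?mulr_gt0 ?invr_gt0 // normrZ exprMn ger0_norm ?invr_ge0 ?(ltW N_gt0) //.
by move=> /ltW; rewrite expr2 -mulrA [leRHS]mulrCA ler_pM2l ?invr_gt0 // mulrC.
Qed.

End Empirical.

(** An almost optimal phi does not increase edge lengths, keeps the distances to b, and has a mean
    term of at most dlt times the total. So the inequality in the Hilbert space passes to [Y] at the
    cost of the factor 1 - dlt. The strict bound on [dlt] leaves room for an infimum that may not be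
    attained. *)
Lemma cat0_poincare (V I : finType) (v0 : V) (f : V -> Y) (sigma : V -> V)
    (x : bool -> I -> V) b (dlt eps D : R) k :
  bijective sigma -> variance_center f b -> delta_space Y < dlt ->
  0 <= eps <= 2^-1 -> D = #|I|%:R / #|V|%:R ->
  (forall c p, - (eps * D) <= \sum_i centering (x c i) p) ->
  closed_sum x (2 ^ k.+2) <= (eps * D) ^+ (2 ^ k.+2) ->
  2 * (1 - 2 * eps) * D * ((1 - dlt) * sumsq f b)
    <= \sum_i d[f (x false i), f (sigma (x true i))] ^+ 2.
Proof.
move=> sbij bP dltP /andP[e0 e1] DE deg cl.
have D0 : 0 <= D by rewrite DE divr_ge0.
have : 0 <= sumsq f b by exact: sumsq_ge0.
rewrite le0r => /orP[/eqP ->|sb0].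
  by rewrite !mulr0 sumr_ge0 // => i _; rewrite sqr_ge0.
have [H [ip [phi [ipn phib phid bar]]]] := empirical_almost_optimal v0 bP dltP sb0.
have ipC y z : ip y z = ip z y.
  by rewrite hermitian_subproof expr0 mul1r.
have ipl a y z w : ip (a *: y + z) w = a * ip y w + ip z w.
  by rewrite linearPl.
have ip0 y : 0 <= ip y y by rewrite -ipn sqr_ge0.
have e01 : 0 <= eps <= 1 by rewrite e0 (le_trans e1) // invf_le1 // ler1n.
pose phi1 v := phi (f v); pose psi1 v := phi (f (sigma v)).
have sE : \sum_v phi1 v = \sum_v psi1 v.
  by rewrite (reindex sigma) //; exact: onW_bij.
have qE : fdot ip phi1 phi1 = fdot ip psi1 psi1.
  by rewrite /fdot (reindex sigma) //; exact: onW_bij.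
have := edge_energy_bound ipC ipl ip0 v0 e01 DE deg cl sE qE.
have -> : fdot ip phi1 phi1 = sumsq f b.
  by apply: eq_bigr => v _; rewrite -ipn phib metric_sym.
rewrite -ipn => le1.
apply: le_trans (_ : _ <= 2 * (1 - 2 * eps) * D * (sumsq f b - `|\sum_v phi1 v| ^+ 2 / #|V|%:R)) _.
  rewrite ler_wpM2l //; first by rewrite !mulr_ge0 //; lra.
  by rewrite mulrBl mul1r lerD2l lerN2.
apply: le_trans le1 _; apply: ler_sum => i _; rewrite -ipn.
by rewrite lerXn2r ?nnegrE ?mdist_ge0 ?normr_ge0 //; exact: phid.
Qed.

End DeltaInvariant.

(** * From a good sample of relators to a fixed point *)

Section GoodSample.
Context {R : realType} (T I : finType) (n l : nat).
Local Notation Z := ((n + (l + n)).-tuple T).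

Definition outer_part (b : bool) (z : Z) : n.-tuple T :=
  if b then tuple_snd (tuple_snd z) else tuple_fst z.

Definition inner_part (z : Z) : l.-tuple T := tuple_fst (tuple_snd z).

Lemma outer_inner_cat (z : Z) :
  tval z = outer_part false z ++ inner_part z ++ outer_part true z.
Proof.
by rewrite /= !cat_take_drop.
Qed.

(** No outer word is too rare at either end, the trace is small, and no inner word is too frequent.
    The last condition bounds a mean over relators by a mean over all words of length l. *)
Definition good_sample (eps : R) (k : nat) (r : I -> Z) : Prop :=
  let D := #|I|%:R / #|{: n.-tuple T}|%:R in
  [/\ forall b p, - (eps * D) <= \sum_i centering (outer_part b (r i)) p,
      closed_sum (fun b i => outer_part b (r i)) (2 ^ k.+2) <= (eps * D) ^+ (2 ^ k.+2) &
      forall v, \sum_i centering (inner_part (r i)) v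
                <= eps * (#|I|%:R / #|{: l.-tuple T}|%:R)].

End GoodSample.

Section FixedPoint.
Context {R : realType} (Y : metricType R) (T : finType) (t0 : T).
Variables (act : seq T -> Y -> Y) (inv : T -> T).
Local Notation "d[ x , y ]" := (mdist x y) (format "d[ x ,  y ]").
Hypothesis act_dist : forall u x y, d[act u x, act u y] = d[x, y].
Hypothesis act_cat : forall u v x, act (u ++ v) x = act u (act v x).
Hypothesis act_nil : forall x, act [::] x = x.
Hypothesis invK : involutive inv.
Hypothesis act_inv : forall a x, act [:: a] (act [:: inv a] x) = x.

Lemma relator_poincare (I : finType) (i0 : I) n l (r : I -> (n + (l + n)).-tuple T)
    k (eps dlt : R) x b :
  (forall i y, act (r i) y = y) -> 0 <= eps <= 2^-1 -> delta_space Y < dlt ->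
  good_sample eps k r -> variance_center (fun u : n.-tuple T => act u x) b ->
  2 * (1 - 2 * eps) * (1 - dlt) * mean_sqdist act n x b
    <= (1 + eps) * mean_displacement act l x.
Proof.
move=> rel e01 dltP [deg cl inner] bP.
have M0 : 0 < #|I|%:R :> R by rewrite ltr0n; apply/card_gt0P; exists i0.
have [sigma sbij sE] := inv_word_bij invK n.
have N0 : 0 < #|{: n.-tuple T}|%:R :> R.
  by rewrite ltr0n; apply/card_gt0P; exists (nseq_tuple n t0).
have L0 : 0 < #|{: l.-tuple T}|%:R :> R.
  by rewrite ltr0n; apply/card_gt0P; exists (nseq_tuple l t0).
have := cat0_poincare (nseq_tuple n t0) sbij bP dltP e01 erefl deg cl.
have edge i : d[act (outer_part false (r i)) x, act (sigma (outer_part true (r i))) x]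
    = d[x, act (inner_part (r i)) x].
  rewrite sE; set w := outer_part true _.
  (* The relator u v w, evaluated at w^-1 x, gives u v x = w^-1 x. *)
  have := rel i (act (rev (map inv w)) x).
  rewrite {1}(outer_inner_cat (r i)) !act_cat (act_rev_inv act_cat act_nil act_inv) => <-.
  by rewrite act_dist.
have -> : sumsq (fun u : n.-tuple T => act u x) b =
    #|{: n.-tuple T}|%:R * mean_sqdist act n x b.
  by rewrite /mean_sqdist /word_avg -card_tuple mulrC divfK // gt_eqF.
set N := #|{: n.-tuple T}|%:R in N0 *; set A := mean_sqdist _ _ _ _ => h.
rewrite -(ler_pM2l M0).
apply: le_trans (_ : \sum_i d[x, act (inner_part (r i)) x] ^+ 2 <= _).
  apply: le_trans (_ : \sum_i d[act (outer_part false (r i)) x,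
       act (sigma (outer_part true (r i))) x] ^+ 2 <= _).
    apply: le_trans h; rewrite le_eqVlt; apply/orP; left; apply/eqP.
    by field; rewrite gt_eqF.
  by rewrite le_eqVlt; apply/orP; left; apply/eqP/eq_bigr => i _; rewrite edge.
pose g (v : l.-tuple T) := d[x, act v x] ^+ 2.
have g0 v : 0 <= g v by rewrite sqr_ge0.
have -> : mean_displacement act l x = (\sum_v g v) / #|{: l.-tuple T}|%:R.
  rewrite /mean_displacement /mean_sqdist /word_avg card_tuple; congr (_ / _).
  by apply: eq_bigr => v _; rewrite metric_sym.
set L := #|{: l.-tuple T}|%:R in L0 inner *.
(* Regroup by inner word: the bracket is the number of relators with inner part v. *)
have -> : \sum_i d[x, act (inner_part (r i)) x] ^+ 2 =
    \sum_v (#|I|%:R / L + \sum_i centering (inner_part (r i)) v) * g v.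
  under [RHS]eq_bigr do rewrite mulrDl mulr_suml.
  rewrite big_split /= exchange_big /= -mulr_sumr.
  rewrite [X in _ + X](_ : _ = \sum_i (g (inner_part (r i)) - L^-1 * \sum_v g v)).
    rewrite sumrB sumr_const -[_ *+ #|I|]mulr_natl /g; ring.
  by apply: eq_bigr => i _; exact: (sum_centering_fun (g : _ -> R^o)).
have -> : #|I|%:R * ((1 + eps) * ((\sum_v g v) / L)) = \sum_v ((1 + eps) * (#|I|%:R / L)) * g v.
  by rewrite -mulr_sumr; ring.
apply: ler_sum => v _; rewrite ler_wpM2r //.
by have := inner v; lra.
Qed.

Lemma good_sample_fixed_point (I : finType) (i0 : I) n l (r : I -> (n + (l + n)).-tuple T)
    j (k : nat) (dlt : R) :
  CAT0 Y -> (0 < l)%N -> (k * l <= n)%N -> (forall i y, act (r i) y = y) ->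
  0 <= dlt < 1 -> 1 / (1 - dlt) < k%:R -> delta_space Y <= dlt ->
  good_sample (10^-1 : R) j r -> exists q, forall a, act [:: a] q = q.
Proof.
move=> cat l0 kln rel /andP[d0 d1] hk dltP good.
have cn := cat0_cn cat; have [Y0 cY _ _] := cat.
(* With eps = 1/10 and 1 - dlt' = 3/4 (1 - dlt), the left factor of [relator_poincare] is 2 * 4/5 *
   3/4 (1 - dlt) = 6/5 (1 - dlt) and the right one 11/10; their quotient is C. *)
pose dlt' := dlt + (1 - dlt) / 4; pose C : R := 11 / 12 / (1 - dlt).
have dp : 0 < 1 - dlt by rewrite subr_gt0.
have dlt'P : delta_space Y < dlt' by apply: le_lt_trans dltP _; rewrite /dlt'; lra.
have Ck : C < k%:R.
  apply: lt_trans hk; rewrite /C ltr_pM2r ?invr_gt0 //; lra.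
have [p pP] : exists p, forall w : l.-tuple T, act w p = p.
  apply: (words_fixed_point t0 act_dist act_cat act_nil invK act_inv cn cY Y0 kln Ck) => x.
  have [b bP] := barycenter_exists (nseq_tuple n t0) (fun u : n.-tuple T => act u x) cn cY.
  exists b; have e01 : 0 <= (10^-1 : R) <= 2^-1 by apply/andP; split; lra.
  have := relator_poincare i0 rel e01 dlt'P good bP.
  set A := mean_sqdist _ _ _ _; set E := mean_displacement _ _ _ => h.
  rewrite /C mulrAC ler_pdivlMr //.
  have {}h : 2 * (1 - 2 * 10^-1) * (1 - (dlt + (1 - dlt) / 4)) * A <= (1 + 10^-1) * E by [].
  lra.
exact: (letters_fixed_point t0 act_dist act_cat act_inv cn l0 pP).
Qed.

End FixedPoint.

(** * Words acting through the quotient group *)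

Section Quotient.
Local Open Scope group_scope.
Context {R : realType} (Y : metricType R) (m : nat) (Gamma : groupType).
Variable s : 'I_m -> Gamma.

Definition inv_letter (a : letter m) : letter m := (a.1, ~~ a.2).

Lemma inv_letterK : involutive inv_letter.
Proof. by case=> i b; rewrite /inv_letter /= negbK. Qed.

Lemma letter_val_inv a : letter_val s (inv_letter a) = (letter_val s a)^-1.
Proof. by case: a => i [] /=; rewrite /letter_val /= ?invgK. Qed.

Variables (A : set Gamma) (rho : {multiplicative (quot_ncl A) -> isom Y}).

Definition letters_act (u : seq (letter m)) (y : Y) : Y :=
  foldr (fun a z => rho (pi_ncl A (letter_val s a)) z) y u.

Lemma letters_act_dist u x y : mdist (letters_act u x) (letters_act u y) = mdist x y.
Proof. by elim: u => //= a u IH; rewrite isom_dist. Qed.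

Lemma letters_act_cat u v x : letters_act (u ++ v) x = letters_act u (letters_act v x).
Proof. by rewrite /letters_act foldr_cat. Qed.

Lemma rho1 y : rho 1 y = y.
Proof.
suff -> : rho 1 = 1 by [].
by apply: (@mulIg _ (rho 1)); rewrite -gmulfM !mul1g.
Qed.

Lemma rho_pi_mul x x' y : rho (pi_ncl A (x * x')) y = rho (pi_ncl A x) (rho (pi_ncl A x') y).
Proof. by rewrite pi_nclM gmulfM. Qed.

Lemma rho_pi_normal x y : normal_closure A x -> rho (pi_ncl A x) y = y.
Proof.
move=> Ax; rewrite -[RHS]rho1; congr (rho _ y); apply/esym.
by apply/(pi_nclP A 1); rewrite invg1 mul1g.
Qed.

Lemma rho_pi1 y : rho (pi_ncl A 1) y = y.
Proof.
apply: rho_pi_normal; by have [[]] := normal_closureP A.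
Qed.

Lemma letters_act_inv a x : letters_act [:: a] (letters_act [:: inv_letter a] x) = x.
Proof. by rewrite /= letter_val_inv -rho_pi_mul mulgV rho_pi1. Qed.

Lemma letters_act_word eta (w : word m eta) y :
  letters_act w y = rho (pi_ncl A (word_val s w)) y.
Proof.
rewrite /word_val; elim: (tval w) => [|a u IH]; first by rewrite big_nil rho_pi1.
by rewrite big_cons rho_pi_mul /= IH.
Qed.

Lemma fixed_by_generators q : generated_by (range (letter_val s)) ->
  (forall a, letters_act [:: a] q = q) -> forall g, rho g q = q.
Proof.
move=> gen fixq.
pose H := [set x : Gamma | rho (pi_ncl A x) q = q].
have Hsub : subgroup H.
  split=> [|x y Hx Hy|x Hx]; rewrite /H /=.
  - exact: rho_pi1.
  - by rewrite rho_pi_mul Hy.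
  - by rewrite -{1}Hx -rho_pi_mul mulVg rho_pi1.
have Hall x : H x.
  have : smallest subgroup (range (letter_val s)) x by rewrite gen.
  apply; split => // _ [a _ <-]; exact: fixq a.
move=> g; have : exists x, g = pi_ncl A x.
  by exists (repr g); rewrite /pi_ncl reprK.
by move=> [x ->]; exact: Hall.
Qed.

End Quotient.

Lemma has_F_good_sample (R : realType) (m : nat) (Gamma : groupType) (s : 'I_m -> Gamma)
    (n l j k : nat) (dlt : R) (I : finType) (i0 : I) (a0 : letter m)
    (Rel : {set word m (n + (l + n))}) (r : I -> word m (n + (l + n))) (Y : metricType R) :
  generated_by (range (letter_val s)) -> 0 <= dlt < 1 -> 1 / (1 - dlt) < k%:R ->
  (0 < l)%N -> (k * l <= n)%N ->
  (forall i, r i \in Rel) -> good_sample (10^-1 : R) j r ->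
  CAT0 Y -> delta_space Y <= dlt -> has_F (quot_ncl (relators s Rel)) Y.
Proof.
move=> gen d01 hk l0 kln rR good cat dY rho.
have rel i y : letters_act s rho (r i) y = y.
  rewrite letters_act_word; apply: rho_pi_normal; apply: sub_gen_smallest.
  by exists (r i).
have [q qP] := good_sample_fixed_point a0 (@letters_act_dist _ _ _ _ s _ rho)
  (@letters_act_cat _ _ _ _ s _ rho) (fun=> erefl) (@inv_letterK m)
  (@letters_act_inv _ _ _ _ s _ rho) i0 cat l0 kln rel d01 hk dY good.
by exists q => g; exact: fixed_by_generators gen qP g.
Qed.

(** * Counting *)

Section BadSamples.
Context {R : realType} (T : finType) (t0 : T) (n l M : nat).
Local Notation Z := ((n + (l + n)).-tuple T).
Let N : R := #|{: n.-tuple T}|%:R.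
Let L : R := #|{: l.-tuple T}|%:R.
Let u0 : n.-tuple T := nseq_tuple n t0.
Let v0 : l.-tuple T := nseq_tuple l t0.
Let z0 : Z := nseq_tuple _ t0.

Let N_gt0 : 0 < N. Proof. by rewrite ltr0n; apply/card_gt0P; exists u0. Qed.
Let L_gt0 : 0 < L. Proof. by rewrite ltr0n; apply/card_gt0P; exists v0. Qed.

Let cardZ : #|{: Z}|%:R = N * (L * N).
Proof. by rewrite /N /L !card_tuple !expnD !natrM. Qed.

Lemma sum_outer_parts (f g : n.-tuple T -> R) :
  \sum_(z : Z) f (outer_part false z) * g (outer_part true z) =
  #|{: Z}|%:R / N ^+ 2 * ((\sum_u f u) * \sum_w g w).
Proof.
rewrite sum_cat_tuple.
rewrite (eq_bigr (fun u => f u * (L * \sum_w g w))).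
  rewrite -mulr_suml cardZ; field; by rewrite gt_eqF.
move=> u _; rewrite sum_cat_tuple mulrA mulr_sumr.
rewrite (eq_bigr (fun=> f u * \sum_w g w)).
  by rewrite sumr_const -mulr_natr -/L mulrAC mulr_sumr.
move=> v _; rewrite mulr_sumr; apply: eq_bigr => w _.
by rewrite /outer_part tuple_fst_cat !tuple_snd_cat.
Qed.

Lemma sum_inner_part (f : l.-tuple T -> R) :
  \sum_(z : Z) f (inner_part z) = #|{: Z}|%:R / L * \sum_v f v.
Proof.
rewrite sum_cat_tuple (eq_bigr (fun=> N * \sum_v f v)).
  rewrite sumr_const -mulr_natr -/N cardZ; field; by rewrite gt_eqF.
move=> u _; rewrite sum_cat_tuple mulr_sumr; apply: eq_bigr => v _.
rewrite (eq_bigr (fun=> f v)) ?sumr_const ?mulr_natl // => w _.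
by rewrite /inner_part tuple_snd_cat tuple_fst_cat.
Qed.

Let D : R := M%:R / N.
Let eps : R := 10^-1.
Variable j : nat.
Let h := (2 ^ j.+1)%N.
Let K : R := (h.+1 * h ^ h.*2)%:R.
Let Om := {ffun 'I_M -> Z}.

Lemma deviation_power (x a : R) : 0 <= a -> ~~ (- a <= x <= a) ->
  a ^+ h.*2 <= x ^+ h.*2.
Proof.
move=> a0 xa; rewrite -!muln2 mulnC !exprM lerXn2r ?nnegrE ?sqr_ge0 //.
move: xa; rewrite negb_and -!ltNge => /orP[xa|xa].
  by rewrite -[x ^+ 2]sqrrN lerXn2r ?nnegrE //; lra.
by rewrite lerXn2r ?nnegrE //; lra.
Qed.

Lemma power_moment_ge0 (J : finType) (a : J -> R) : 0 <= \sum_x a x ^+ h.*2.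
Proof. by apply: sumr_ge0 => x _; rewrite exprn_even_ge0 // odd_double. Qed.

Lemma bad_sample_card : (l <= n)%N -> 1 <= M%:R * (2 / N) ->
  #|[set om : Om | ~~ `[< good_sample eps j om >]]%SET|%:R
    <= 4 * (N * (K * (2 / (eps ^+ 2 * D)) ^+ h)) * (#|{: Z}| ^ #|'I_M|)%:R.
Proof.
move=> ln M1.
have M0 : 0 < M%:R :> R.
  rewrite lt_def ler0n andbT; apply/eqP => M0; move: M1; rewrite M0 mul0r; lra.
have D0 : 0 < D by rewrite divr_gt0.
have e0 : 0 < eps by rewrite invr_gt0.
have eD0 : 0 < eps * D by rewrite mulr_gt0.
have LN : L <= N.
  rewrite ler_nat !card_tuple leq_pexp2l //; by apply/card_gt0P; exists t0.
pose D' : R := M%:R / L.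
have DD' : D <= D' by rewrite ler_wpM2l ?(ltW M0) // lef_pV2.
have D'0 : 0 < D' by exact: lt_le_trans DD'.
have eD'0 : 0 < eps * D' by rewrite mulr_gt0.
have M1' : 1 <= #|'I_M|%:R * (2 / L).
  rewrite card_ord; apply: le_trans M1 _; rewrite ler_wpM2l ?(ltW M0) //.
  by rewrite ler_wpM2l // lef_pV2.
have {}M1 : 1 <= #|'I_M|%:R * (2 / N) by rewrite card_ord.
set B := N * _.
have K0 : 0 <= K by rewrite ler0n.
have ratio (c : R) : 0 < c -> (2 * c) ^+ h / (eps * c) ^+ h.*2 = (2 / (eps ^+ 2 * c)) ^+ h.
  move=> c0; rewrite -muln2 mulnC exprM -expr_div_n; congr (_ ^+ _).
  by field; rewrite !gt_eqF.
pose F b (om : Om) := \sum_p (\sum_i centering (outer_part b (om i)) p) ^+ h.*2 : R.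
pose F' (om : Om) := \sum_p (\sum_i centering (inner_part (om i)) p) ^+ h.*2 : R.
pose C (om : Om) := closed_sum (fun b i => outer_part b (om i)) h.*2 : R.
pose S b := [set om : Om | (eps * D) ^+ h.*2 <= F b om]%SET.
pose S' := [set om : Om | (eps * D') ^+ h.*2 <= F' om]%SET.
pose SC := [set om : Om | (eps * D) ^+ h.*2 <= C om]%SET.
have sub : [set om : Om | ~~ `[< good_sample eps j om >]]%SET \subset
   ((S false :|: S true) :|: (S' :|: SC))%SET.
  apply/fintype.subsetP => om; rewrite !inE; apply: contraR; rewrite !negb_or -!ltNge.
  move=> /andP[/andP[sf st] /andP[s' sc]]; apply/asboolP.
  have one (J : finType) (a : J -> R) c q : 0 <= c ->
      \sum_x a x ^+ h.*2 < c ^+ h.*2 -> - c <= a q <= c.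
    move=> c0 lt; apply: contraT => /(deviation_power c0).
    rewrite leNgt => /negP[]; apply: le_lt_trans lt.
    rewrite (bigD1 q) //= lerDl; apply: sumr_ge0 => x _.
    by rewrite exprn_even_ge0 // odd_double.
  have DE : #|'I_M|%:R / #|{: n.-tuple T}|%:R = D by rewrite card_ord.
  split; rewrite ?DE.
  - by move=> [] p; [have /andP[] := one _ _ _ p (ltW eD0) st|
                     have /andP[] := one _ _ _ p (ltW eD0) sf].
  - by move: (ltW sc); rewrite /C /h -mul2n -expnS.
  - move=> v; rewrite card_ord; by have /andP[] := one _ _ _ v (ltW eD'0) s'.
have Sb b : #|S b|%:R <= B * (#|{: Z}| ^ #|'I_M|)%:R.
  have X_equi f : \sum_(z : Z) f (outer_part b z) = #|{: Z}|%:R / N * \sum_u f u :> R.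
    exact: (sum_equidistributed u0 (@sum_outer_parts)).
  have F0 om : 0 <= F b om by exact: power_moment_ge0.
  have := markov_card z0 (exprn_gt0 h.*2 eD0) F0.
  move/le_trans; apply; rewrite ler_wpM2r ?ler0n //.
  rewrite ler_pdivrMr ?exprn_gt0 //.
  apply: le_trans (sample_mean_degree_moment u0 z0 X_equi h M1) _.
  rewrite /B -ratio // -!mulrA mulVf ?gt_eqF ?exprn_gt0 // mulr1.
  rewrite card_ord /D le_eqVlt; apply/orP; left; apply/eqP.
  by rewrite [M%:R * _]mulrCA.
have S'b : #|S'|%:R <= B * (#|{: Z}| ^ #|'I_M|)%:R.
  have F'0 om : 0 <= F' om by exact: power_moment_ge0.
  have := markov_card z0 (exprn_gt0 h.*2 eD'0) F'0.
  move/le_trans; apply; rewrite ler_wpM2r ?ler0n //.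
  apply: le_trans (_ : L * (K * (2 / (eps ^+ 2 * D')) ^+ h) <= _).
    rewrite ler_pdivrMr ?exprn_gt0 //.
    apply: le_trans (sample_mean_degree_moment v0 z0 sum_inner_part h M1') _.
    rewrite -ratio // -!mulrA mulVf ?gt_eqF ?exprn_gt0 // mulr1.
    rewrite card_ord /D' le_eqVlt; apply/orP; left; apply/eqP.
    by rewrite [M%:R * _]mulrCA.
  have q0 (c : R) : 0 < c -> 0 < 2 / (eps ^+ 2 * c).
    by move=> c0; rewrite divr_gt0 // mulr_gt0 // exprn_gt0.
  rewrite /B; apply: ler_pM => //.
    by rewrite mulr_ge0 // exprn_ge0 // ltW // q0.
  rewrite ler_wpM2l // lerXn2r ?nnegrE ?(ltW (q0 _ D0)) ?(ltW (q0 _ D'0)) //.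
  have eDD : eps ^+ 2 * D <= eps ^+ 2 * D' by rewrite ler_wpM2l ?sqr_ge0.
  by rewrite ler_wpM2l // lef_pV2 // posrE mulr_gt0 // exprn_gt0.
have SCb : #|SC|%:R <= B * (#|{: Z}| ^ #|'I_M|)%:R.
  have C0 (om : Om) : 0 <= C om.
    rewrite /C /h -mul2n -expnS -hilbert_schmidt_edge_power //.
    by apply: sumr_ge0 => p _; apply: sumr_ge0 => q _; rewrite sqr_ge0.
  have := markov_card z0 (exprn_gt0 h.*2 eD0) C0.
  move/le_trans; apply; rewrite ler_wpM2r ?ler0n //.
  rewrite ler_pdivrMr ?exprn_gt0 //.
  have h0 : (0 < h)%N by rewrite expn_gt0.
  apply: le_trans (sample_mean_closed_sum u0 z0 (@sum_outer_parts) h0 M1) _.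
  rewrite /B -ratio // -!mulrA mulVf ?gt_eqF ?exprn_gt0 // mulr1.
  have -> : #|'I_M|%:R * (2 / N) = 2 * D by rewrite card_ord mulrCA.
  rewrite ler_wpM2l ?(ltW N_gt0) // ler_piMl ?invf_le1 ?ler1n //.
  by rewrite mulr_ge0 // exprn_ge0 // mulr_ge0 // ltW.
apply: le_trans (_ : (#|S false| + #|S true| + (#|S'| + #|SC|))%:R <= _).
  rewrite ler_nat; apply: leq_trans (subset_leq_card sub) _.
  apply: leq_trans (leq_card_setU _ _) _.
  by apply: leq_add; exact: leq_card_setU.
rewrite !natrD; have := Sb false; have := Sb true; lra.
Qed.

End BadSamples.

(** * From independent samples to uniform sets of given size *)

Section SampleToSet.
Context {R : realType} (W : finType).

(* Birthday bound: at least half of the samples have no repetition. *)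
Lemma leq_inj_ffuns M : (M ^ 2 <= #|W|)%N -> (#|W| ^ M <= 2 * #|W| ^_ M)%N.
Proof.
move=> M2; have [->|M0] := posnP M; first by [].
have MW : (M <= #|W|)%N by apply: leq_trans M2; rewrite leq_pmulr.
have W0 : (0 < #|W|)%N by exact: leq_trans MW.
(* The estimate w^_i >= w^i (1 - i^2 / (2 w)), with denominators cleared. *)
have key i : (i <= M)%N ->
    (2 * #|W| * #|W| ^ i <= 2 * #|W| * #|W| ^_ i + i ^ 2 * #|W| ^ i)%N.
  elim: i => [|i IH] iM; first by rewrite ffactn0 !expn0 !muln1 leq_addr.
  have {}IH := IH (ltnW iM); rewrite expnS ffactnSr.
  have iW : (i <= #|W|)%N by exact: leq_trans (ltnW iM) MW.
  have := leq_mul IH (leqnn (#|W| - i)); move: (#|W| - i)%N (subnKC iW) => d.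
  move: (#|W|) (#|W| ^_ i)%N => w f <-; move: ((i + d) ^ i)%N => p; nia.
have := key M (leqnn _).
have : (M ^ 2 * #|W| ^ M <= #|W| * #|W| ^ M)%N by rewrite leq_mul2r M2 orbT.
move: (#|W| ^ M)%N (#|W| ^_ M)%N (M ^ 2)%N M2 => p f q _ h1 h2.
rewrite -(leq_pmul2l W0); nia.
Qed.

Lemma card_supersets (B : {set W}) k : (#|B| <= k)%N ->
  #|[set A : {set W} | B \subset A & #|A| == k]| = 'C(#|W| - #|B|, k - #|B|).
Proof.
move=> Bk; have -> : (#|W| - #|B|)%N = #|(~: B)%SET| by rewrite [RHS]cardsCs finset.setCK.
rewrite -cards_draws.
have inj : {in [set A : {set W} | A \subset ~: B & #|A| == (k - #|B|)%N]%SET &,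
    injective (fun A : {set W} => A :|: B)%SET}.
  move=> A A'; rewrite !inE => /andP[AB _] /andP[A'B _] /setP AA'.
  apply/setP => x; have := AA' x; rewrite !inE; have := fintype.subsetP AB x.
  have := fintype.subsetP A'B x; rewrite !inE; case: (x \in B); rewrite ?orbF //=.
  by case: (x \in A); case: (x \in A') => // h1 h2; first [have := h2 isT|have := h1 isT].
rewrite -(card_in_imset inj); apply: eq_card => A; rewrite inE.
apply/andP/finset.imsetP => [[BA /eqP Ak]|[A' + ->]].
  exists (A :\: B)%SET; last first.
    apply/setP => x; rewrite !inE; have := fintype.subsetP BA x.
    by case: (x \in B) => [/(_ isT) ->|_]; rewrite ?orbT ?orbF.
  rewrite inE cardsD (finset.setIidPr BA) Ak eqxx andbT.
  by apply/fintype.subsetP => x; rewrite !inE => /andP[].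
rewrite inE => /andP[A'B /eqP A'k]; split; first exact: finset.subsetUr.
rewrite cardsU A'k (_ : A' :&: B = finset.set0)%SET ?cards0 ?subn0 ?subnK //.
by apply/eqP; rewrite finset.setI_eq0 finset.disjoints_subset.
Qed.

Variables (good : pred {set W}) (M k : nat) (b : R).
Hypothesis good_up : forall A B : {set W}, A \subset B -> good A -> good B.
Hypothesis Mk : (M <= k)%N.
Hypothesis M2 : (M ^ 2 <= #|W|)%N.
Hypothesis bad_samples :
  #|[set om : {ffun 'I_M -> W} | ~~ good [set x in codom om]%SET]%SET|%:R <= b * (#|W| ^ M)%:R.

(* Double count pairs (injective sample, set of size k containing it). *)
Lemma bad_sets_card :
  #|[set A : {set W} | (#|A| == k) && ~~ good A]%SET|%:R
    <= 2 * b * #|[set A : {set W} | #|A| == k]%SET|%:R :> R.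
Proof.
pose inj (om : {ffun 'I_M -> W}) := injectiveb om.
pose im (om : {ffun 'I_M -> W}) : {set W} := [set x in codom om]%SET.
have count (P : pred {set W}) :
    (\sum_(A : {set W} | (#|A| == k) && P A) \sum_(om | inj om && (im om \subset A)) 1
     = #|[set A : {set W} | (#|A| == k) && P A]%SET| * k ^_ M)%N.
  rewrite -sum1_card big_distrl /= [RHS](eq_bigl (fun A : {set W} => (#|A| == k) && P A)).
    apply: eq_bigr => A /andP[/eqP Ak _]; rewrite mul1n -Ak.
    have := card_inj_ffuns_on 'I_M (mem A); rewrite card_ord => <-.
    rewrite -sum1_card; apply: eq_bigl => om; rewrite !inE andbC; congr (_ && _).
    apply/fintype.subsetP/ffun_onP => [h x|h w]; first by apply: h; rewrite inE codom_f.
    by rewrite inE => /codomP[x ->]; exact: h.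
  by move=> A; rewrite inE.
have cim om : inj om -> #|im om| = M.
  by move=> /injectiveP io; rewrite cardsE card_codom // card_ord.
pose c2 := 'C(#|W| - M, k - M).
have c2E om : inj om -> (\sum_(A : {set W} | (#|A| == k) && (im om \subset A)) 1 = c2)%N.
  move=> io; rewrite /c2 -(cim om io) -card_supersets ?cim // -sum1_card.
  by apply: eq_bigl => A; rewrite inE andbC.
have tot : (#|[set A : {set W} | (#|A| == k) && true]%SET| * k ^_ M = #|W| ^_ M * c2)%N.
  rewrite -count (exchange_big_dep inj) /=; last by move=> A om _ /andP[].
  rewrite (eq_bigr (fun=> c2)) => [|om io]; last first.
    by rewrite -(c2E om io); apply: eq_bigl => A; rewrite andbT io.
  rewrite sum_nat_const; congr (_ * _)%N.
  by rewrite -[M in RHS]card_ord -card_inj_ffuns; apply: eq_card => om; rewrite !inE.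
have bad : (#|[set A : {set W} | (#|A| == k) && ~~ good A]%SET| * k ^_ M
   <= #|[set om : {ffun 'I_M -> W} | ~~ good [set x in codom om]%SET]%SET| * c2)%N.
  rewrite -count (exchange_big_dep (fun om => inj om && ~~ good (im om))) /=; last first.
    move=> A om /andP[_ bA] /andP[-> sA] /=; apply: contra bA; exact: good_up.
  apply: leq_trans (_ : \sum_(om | inj om && ~~ good (im om)) c2 <= _)%N.
    apply: leq_sum => om /andP[io _]; rewrite -(c2E om io).
    rewrite [leqRHS](bigID (fun A => ~~ good A)) /= -[leqLHS]addn0 leq_add //.
    rewrite leq_eqVlt; apply/orP; left; apply/eqP; apply: eq_bigl => A.
    by rewrite io /=; rewrite -!andbA; congr (_ && _); rewrite andbC.
  rewrite sum_nat_const leq_mul2r; apply/orP; right.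
  by apply/subset_leq_card/fintype.subsetP => om; rewrite !inE => /andP[].
have kM : (0 < k ^_ M)%N by rewrite ffact_gt0.
rewrite -(ler_pM2r (_ : 0 < (k ^_ M)%:R :> R)) ?ltr0n // -natrM.
apply: le_trans (_ : _ <= (#|[set om : {ffun 'I_M -> W} | ~~ good [set x in codom om]%SET]%SET| * c2)%:R) _.
  by rewrite ler_nat.
rewrite natrM; apply: le_trans (ler_wpM2r (ler0n _ _) bad_samples) _.
have -> : #|[set A : {set W} | #|A| == k]%SET| =
  #|[set A : {set W} | (#|A| == k) && true]%SET|.
  by apply: eq_card => A; rewrite !inE andbT.
rewrite -[leRHS]mulrA -natrM tot !natrM !mulrA ler_wpM2r ?ler0n //.
have W0 : 0 < (#|W| ^ M)%:R :> R.
  rewrite ltr0n expn_gt0; have [M0|M0] := posnP M; first by rewrite orbT.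
  by rewrite (leq_trans _ M2) // expn_gt0 M0.
have b0 : 0 <= b by have := le_trans (ler0n _ _) bad_samples; rewrite pmulr_lge0.
rewrite [2 * b]mulrC -[leRHS]mulrA ler_wpM2l // -natrM ler_nat; exact: leq_inj_ffuns.
Qed.

End SampleToSet.

(** n is the least integer above kappa eta, which amounts to n > K l. The sample exponent e is the
    integer part of d' eta, for d' strictly between kappa and min(d, 1/2): below d so that samples
    are smaller than the sets, below 1/2 for the birthday bound. Since kappa < 1/2, such d' exists.
    M witnesses that some set has an allowed size. *)
Lemma eventual_parameters (R : realType) (Q : nat) (c d : R) (K : nat) :
  (2 <= Q)%N -> 1 < c -> (0 < K)%N -> K%:R / (2 * K%:R + 1) < d < 1 ->
  exists j eta0, forall eta, (eta0 <= eta)%N -> exists n l e,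
    [/\ eta = (n + (l + n))%N, (0 < l)%N, (K * l <= n)%N & (l <= n)%N] /\
    [/\ (2 * e <= eta)%N, (n + n * 2 ^ j.+1 + eta <= e * 2 ^ j.+1)%N, (n <= e)%N,
        (Q ^ e)%:R <= c^-1 * Q%:R `^ (d * eta%:R) &
        exists2 M : nat, c^-1 * Q%:R `^ (d * eta%:R) <= M%:R <= c * Q%:R `^ (d * eta%:R)
                      & (M <= Q ^ eta)%N].
Proof.
move=> Q2 c1 K0 /andP[]; set kappa := K%:R / _ => kd d1.
have K1 : 1 <= K%:R :> R by rewrite ler1n.
have K3 : 0 < 2 * K%:R + 1 :> R by lra.
have kE : kappa * (2 * K%:R + 1) = K%:R by rewrite divfK // gt_eqF.
have k0 : 0 < kappa by rewrite divr_gt0 //; lra.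
have k2 : kappa < 2^-1.
  by rewrite ltr_pdivrMr //; lra.
have Qr2 : 2 <= Q%:R :> R by rewrite ler_nat.
have Qr1 : 1 <= Q%:R :> R by lra.
have Q0 : Q%:R != 0 :> R by rewrite gt_eqF //; lra.
clearbody kappa.
have [tau [tau0 taud tau2]] : exists tau, [/\ 0 < tau, tau <= d - kappa & tau <= 2^-1 - kappa].
  exists (Num.min d 2^-1 - kappa); rewrite subr_gt0 lt_min kd k2 !lerD2r !ge_min !lexx.
  by rewrite orbT.
have [d' d'E] : exists d', d' = kappa + tau / 2 by eexists.
(* Since e - n >= tau eta / 4 eventually, h tau >= 8 gives h (e - n) >= 2 eta >= n + eta. *)
have [j hb] : exists j, 8 / tau <= (2 ^ j.+1)%:R.
  exists (Num.truncn (8 / tau)); apply: le_trans (ltW (truncnS_gt _)) _; rewrite ler_nat.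
  by apply: ltnW; exact: ltn_expl.
exists j; move: hb; move: (2 ^ j.+1)%N => h hb.
have ht : 8 <= h%:R * tau by rewrite -ler_pdivrMr.
have [s cs] : exists s, c <= Q%:R ^+ s.
  exists (Num.truncn c).+1; apply: le_trans (ltW (truncnS_gt _)) _; rewrite -natrX ler_nat.
  by apply: leq_trans (ltnW (ltn_expl _ (ltnSn 1))) _; rewrite leq_exp2r.
have cm : 0 < c - 1 by rewrite subr_gt0.
have c0 : 0 < c by lra.
(* One summand per requirement: l > 0, rounding of n and e, absorption of c <= Q^s, and an integer
   in the window between X / c and c X. *)
pose B : R := 3 * (2 * K%:R + 1) + 8 / tau + 2 * s%:R / tau + 3 * (c / (c - 1)).
have p1 : 0 <= 8 / tau by rewrite divr_ge0 // ltW.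
have p2 : 0 <= 2 * s%:R / tau by rewrite divr_ge0 ?mulr_ge0 // ltW.
have p3 : 0 <= c / (c - 1) by rewrite divr_ge0 // ltW.
exists (Num.truncn B).+1 => eta eta0.
have etaB : B <= eta%:R.
  by apply: le_trans (ltW (truncnS_gt _)) _; rewrite ler_nat.
have [E EE] : exists E : R, E = eta%:R by eexists.
rewrite -EE in etaB *; clear eta0.
have E1 : 3 * (2 * K%:R + 1) <= E by rewrite /B in etaB; lra.
have E2 : 8 <= tau * E.
  by rewrite mulrC -ler_pdivrMr //; rewrite /B in etaB; lra.
have E3 : 2 * s%:R <= tau * E.
  by rewrite [tau * _]mulrC -ler_pdivrMr //; rewrite /B in etaB; lra.
have E4 : 3 * (c / (c - 1)) <= E by rewrite /B in etaB; lra.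
have E0 : 0 <= E by rewrite EE ler0n.
clear etaB p1 p2 p3 B.
have [n n_lo n_hi] : exists2 n, (K * eta < n * (2 * K + 1))%N & (n.-1 * (2 * K + 1) <= K * eta)%N.
  by exists ((K * eta) %/ (2 * K + 1)).+1; [rewrite ltn_ceil // addn1|exact: leq_divM].
have KE : K%:R * E = kappa * E * (2 * K%:R + 1) by rewrite mulrAC kE.
have n1 : n%:R <= n.-1%:R + 1 :> R by rewrite natr1 ler_nat leqSpred.
have nr : n%:R <= kappa * E + 1.
  have : (n.-1 * (2 * K + 1))%:R <= (K * eta)%:R :> R by rewrite ler_nat.
  rewrite !natrM natrD natrM -EE KE ler_pM2r //; lra.
have n2 : (2 * n < eta)%N.
  rewrite -(ltr_nat R) natrM -EE -(ltr_pM2r K3).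
  have : n%:R * (2 * K%:R + 1) <= (kappa * E + 1) * (2 * K%:R + 1) by rewrite ler_pM2r.
  by rewrite [(kappa * E + 1) * _]mulrDl -KE; lra.
have [l etaE l0] : exists2 l, eta = (n + (l + n))%N & (0 < l)%N.
  by exists (eta - 2 * n)%N; move: n2; clear; lia.
have Kl : (K * l <= n)%N by move: n_lo; rewrite etaE; clear; nia.
have ln : (l <= n)%N by apply: leq_trans Kl; rewrite leq_pmull.
have dE0 : 0 <= d' * E by rewrite mulr_ge0 //; lra.
have dEE : d' * E = kappa * E + tau * E / 2 by rewrite d'E; ring.
have [e e_le e_gt] : exists2 e, e%:R <= d' * E & d' * E < e%:R + 1.
  exists (Num.truncn (d' * E)); first by rewrite truncn_le.
  by rewrite natr1; exact: truncnS_gt.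
have nE : n%:R <= E by rewrite EE ler_nat; move: n2; clear; lia.
have en : tau * E / 4 <= e%:R - n%:R by lra.
exists n, l, e; split=> //.
have dtau : d' * E + tau * E / 2 <= d * E.
  have : (kappa + tau) * E <= d * E by rewrite ler_wpM2r //; lra.
  lra.
have [X XX] : exists X, X = Q%:R `^ (d * E) by eexists.
have X0 : 0 <= X by rewrite XX powR_ge0.
rewrite -XX.
have XE : c * (Q ^ e)%:R <= X.
  have : Q%:R `^ (d' * E) * Q%:R `^ (s%:R) <= X.
    rewrite XX -powRD ?Q0 ?implybT // ler_powR //; lra.
  apply: le_trans; rewrite mulrC powR_mulrn ?ler0n //.
  apply: ler_pM => //; first by rewrite ltW.
  by rewrite natrX -powR_mulrn ?ler0n // ler_powR.
have XQ : X <= (Q ^ eta)%:R.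
  by rewrite XX natrX -powR_mulrn ?ler0n // ler_powR // -EE ler_piMl // ltW.
have Xn : E / 3 <= X.
  apply: le_trans (_ : n%:R <= _).
    rewrite ler_pdivrMr // EE -natrM ler_nat; move: n_lo K0; clear; nia.
  apply: le_trans (_ : (Q ^ e)%:R <= _); last first.
    by apply: le_trans XE; rewrite ler_peMl // ltW.
  rewrite ler_nat; apply: leq_trans (ltnW (ltn_expl n (ltnSn 1))) _.
  apply: leq_trans (_ : (2 ^ e <= _)%N); last first.
    rewrite leq_exp2r // -(ltr_nat R); have := ler0n R n; lra.
  rewrite leq_exp2l // -(ler_nat R); lra.
split.
- rewrite -(ler_nat R) natrM -EE.
  have : d' * E <= 2^-1 * E by rewrite ler_wpM2r //; lra.
  lra.
- rewrite -(ler_nat R) !natrD !natrM -EE.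
  have : h%:R * (tau * E / 4) <= h%:R * (e%:R - n%:R) by rewrite ler_wpM2l.
  have : 8 * (E / 4) <= h%:R * tau * (E / 4) by rewrite ler_wpM2r //; lra.
  lra.
- rewrite -(ler_nat R); lra.
- by rewrite mulrC ler_pdivlMr // mulrC.
have t1 : (Num.truncn X)%:R <= X by rewrite truncn_le.
have t2 : X < (Num.truncn X)%:R + 1 by rewrite natr1; exact: truncnS_gt.
move: (Num.truncn X) t1 t2 => t t1 t2; exists t; last by rewrite -(ler_nat R); exact: le_trans XQ.
apply/andP; split; last by apply: le_trans t1 _; rewrite ler_peMl // ltW.
have cX : c / (c - 1) <= X by lra.
rewrite mulrC ler_pdivrMr //.
have : c <= X * (c - 1) by rewrite -ler_pdivrMr.
have : (X - 1) * c <= t%:R * c by rewrite ler_wpM2r ?(ltW c0) //; lra.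
lra.
Qed.

(** * Proportion of bad presentations *)

Section Main.
Context {R : realType} (m : nat) (hm : (1 <= m)%N) (c d : R).
Context (Gamma : groupType) (s : 'I_m -> Gamma).
Hypothesis hs : generated_by (range (letter_val s)).
Variables (dlt : R) (k : nat).
Hypothesis hdlt : 0 <= dlt < 1.
Hypothesis hk : 1 / (1 - dlt) < k%:R.

Definition fixed_point_property eta (Rel : {set word m eta}) : bool :=
  `[< forall Y : metricType R, CAT0 Y -> delta_space Y <= dlt ->
        has_F (quot_ncl (relators s Rel)) Y >].

Let card_letter : #|letter m| = (2 * m)%N.
Proof. by rewrite card_prod card_ord card_bool mulnC. Qed.

(** Here a good set is one containing all relators of a good sample, a property that passes to
    supersets. The bound of [bad_sets_card] is the same for every cardinality in the window, so it
    sums over cardinalities. *)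
Lemma bad_presentations (n l e j : nat) (eta := (n + (l + n))%N) (h := (2 ^ j.+1)%N) :
  (0 < l)%N -> (k * l <= n)%N -> (l <= n)%N -> (2 * e <= eta)%N ->
  (n + n * 2 ^ j.+1 + eta <= e * 2 ^ j.+1)%N -> (n <= e)%N ->
  ((2 * m) ^ e)%:R <= c^-1 * (2 * m)%:R `^ (d * eta%:R) ->
  #|[set Rel in presentations c m eta d | ~~ fixed_point_property Rel]%SET|%:R
    <= 8 * (h.+1 * h ^ h.*2)%:R * 200 ^+ h * (2^-1) ^+ eta
       * #|presentations c m eta d|%:R :> R.
Proof.
move=> l0 kl ln e2 he ne Xe.
have a0 : letter m by exact: (Ordinal hm, false).
pose W : finType := word m eta.
have Q2 : (2 <= 2 * m)%N by rewrite leq_pmulr.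
have Q0 : (0 < 2 * m)%N by exact: ltnW.
pose M := ((2 * m) ^ e)%N.
have M0 : (0 < M)%N by rewrite expn_gt0 Q0.
pose eps : R := 10^-1.
pose good (A : {set W}) : bool := `[< exists om : {ffun 'I_M -> W},
  (forall i, om i \in A) /\ good_sample eps j om >].
have good_up (A A' : {set W}) : A \subset A' -> good A -> good A'.
  move=> AA' /asboolP[om [omA omg]]; apply/asboolP; exists om; split => // i.
  by apply: (fintype.subsetP AA').
have good_fixed (A : {set W}) : good A -> fixed_point_property A.
  move=> /asboolP[om [omA omg]]; apply/asboolP => Y cat dY.
  exact: (has_F_good_sample (Ordinal M0) a0 hs hdlt hk l0 kl omA omg cat dY).
have cardn p : #|{: p.-tuple (letter m)}| = ((2 * m) ^ p)%N.
  by rewrite card_tuple card_letter.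
set N : R := #|{: n.-tuple (letter m)}|%:R.
have NE : N = (2 * m)%:R ^+ n by rewrite /N cardn natrX.
have ME : M%:R = (2 * m)%:R ^+ e :> R by rewrite /M natrX.
have Qr : 2 <= (2 * m)%:R :> R by rewrite ler_nat.
set q := (2 * m)%:R : R in NE ME Qr.
have q1 : 1 <= q by lra.
have q0 : 0 < q by lra.
have N0 : 0 < N by rewrite NE exprn_gt0.
have M1 : 1 <= M%:R * (2 / N).
  rewrite mulrA ler_pdivlMr // mul1r NE ME.
  have : q ^+ n <= q ^+ e by rewrite ler_weXn2l.
  have : 0 <= q ^+ e by rewrite exprn_ge0 // ltW.
  lra.
have bad := bad_sample_card a0 j ln M1.
pose b := 4 * (N * ((h.+1 * h ^ h.*2)%:R * (2 / (eps ^+ 2 * (M%:R / N))) ^+ h)).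
have bb : 2 * b <= 8 * (h.+1 * h ^ h.*2)%:R * 200 ^+ h * (2^-1) ^+ eta.
  (* 200 is 2 / eps^2. What remains, N (N / M)^h <= 2^-eta, is the exponent inequality n + n h + eta
     <= e h, as 2 <= 2m. *)
  rewrite /b; have -> : 2 / (eps ^+ 2 * (M%:R / N)) = 200 * (N / M%:R).
    by rewrite /eps; field; rewrite !gt_eqF // ltr0n.
  rewrite exprMn.
  have -> : 2 * (4 * (N * ((h.+1 * h ^ h.*2)%:R * (200 ^+ h * (N / M%:R) ^+ h)))) =
    8 * (h.+1 * h ^ h.*2)%:R * 200 ^+ h * (N * (N / M%:R) ^+ h) by ring.
  rewrite ler_wpM2l ?mulr_ge0 ?ler0n ?exprn_ge0 //.
  rewrite expr_div_n mulrA ler_pdivrMr ?exprn_gt0 ?ltr0n //.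
  rewrite exprVn ler_pdivlMl ?exprn_gt0 // NE ME -!exprM -exprD.
  apply: le_trans (_ : q ^+ eta * q ^+ (n + n * h) <= _).
    by rewrite ler_wpM2r ?exprn_ge0 ?(ltW q0) // lerXn2r ?nnegrE ?(ltW q0).
  by rewrite -exprD ler_weXn2l // addnC.
have MW : (M ^ 2 <= #|W|)%N.
  by rewrite cardn /M -expnM leq_exp2l // mulnC.
have bad_samples : #|[set om : {ffun 'I_M -> W} | ~~ good [set x in codom om]%SET]%SET|%:R
    <= b * (#|W| ^ M)%:R.
  rewrite card_ord in bad; apply: le_trans bad.
  rewrite ler_nat; apply/subset_leq_card/fintype.subsetP => om; rewrite !inE.
  apply: contra => /asboolP omg; apply/asboolP; exists om; split => // i.
  by rewrite inE codom_f.
pose p (K : nat) := c^-1 * q `^ (d * eta%:R) <= K%:R <= c * q `^ (d * eta%:R).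
have presE (A : {set W}) : (A \in presentations c m eta d) = p #|A|.
  by rewrite inE.
pose f (A : {set W}) : 'I_#|W|.+1 := inord #|A|.
have fE (A : {set W}) (K : 'I_#|W|.+1) : (f A == K) = (#|A| == K).
  by rewrite -val_eqE /= inordK // ltnS max_card.
rewrite -!sum1_card !natr_sum.
rewrite [leLHS](partition_big f xpredT) //= [in leRHS](partition_big f xpredT) //=.
rewrite mulr_sumr; apply: ler_sum => K _.
have [pK|pK] := boolP (p K); last first.
  rewrite big1 => [|A]; last first.
    rewrite inE presE fE => /andP[/andP[pA _] /eqP AK].
    by rewrite AK (negPf pK) in pA.
  rewrite mulr_ge0 ?sumr_ge0 // !mulr_ge0 ?exprn_ge0 //.
have MK : (M <= K)%N.
  rewrite -(ler_nat R); apply: le_trans (_ : c^-1 * q `^ (d * eta%:R) <= _) => //.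
  by case/andP: pK.
have := bad_sets_card good_up MK MW bad_samples.
rewrite -!sum1_card !natr_sum => badK.
apply: le_trans (_ : \sum_(A in [set A : {set W} | (#|A| == K) && ~~ good A]%SET) 1 <= _).
  rewrite [leRHS](bigID (fun A => ~~ fixed_point_property A)) /= -[leLHS]addr0 lerD ?sumr_ge0 //.
  rewrite le_eqVlt; apply/orP; left; apply/eqP; apply: eq_bigl => A.
  rewrite !inE fE; case: (#|A| =P K) => [AK|]; rewrite ?andbF //= AK.
  rewrite -/q -/(p K) pK /= andbT; case: (boolP (good A)) => [/good_fixed ->|] //.
apply: le_trans badK _; apply: le_trans (ler_wpM2r _ bb) _; first by rewrite sumr_ge0.
rewrite ler_wpM2l // ?mulr_ge0 ?exprn_ge0 //.
rewrite le_eqVlt; apply/orP; left; apply/eqP; apply: eq_bigl => A.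
by rewrite presE fE inE; case: eqP => [->|]; rewrite ?andbT ?andbF.
Qed.

End Main.

Theorem theorem7p2 (R : realType) (m : nat) (hm : (1 <= m)%N)
    (c : R) (hc : 1 < c)
    (Gamma : groupType) (s : 'I_m -> Gamma)
    (hs : generated_by (range (letter_val s)))
    (delta : R) (hdelta : 0 <= delta < 1)
    (k : int) (hk : 1 / (1 - delta) < k%:~R)
    (d : R) (hd : k%:~R / (2 * k%:~R + 1) < d < 1) :
  (fun eta : nat =>
     #|[set Rel in presentations c m eta d |
          `[< forall Y : metricType R, CAT0 Y -> delta_space Y <= delta ->
                has_F (quot_ncl (relators s Rel)) Y >]]%SET|%:R
     / #|presentations c m eta d|%:R : R) @ \oo --> (1 : R).
Proof.
have k0 : 0 < k%:~R :> R.
  by apply: lt_trans hk; rewrite divr_gt0 // subr_gt0; case/andP: hdelta.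
case: k hk hd k0 => [k hk hd k0|k _ _]; last by rewrite NegzE mulrNz oppr_gt0 ltNge ler0n.
rewrite -pmulrn in hk hd k0; rewrite ltr0n in k0.
have Q2 : (2 <= 2 * m)%N by rewrite leq_pmulr.
have [j [eta0 param]] := eventual_parameters Q2 hc k0 hd.
pose h := (2 ^ j.+1)%N; pose C : R := 8 * (h.+1 * h ^ h.*2)%:R * 200 ^+ h.
have C0 : 0 <= C by rewrite !mulr_ge0 ?exprn_ge0.
apply/cvgrPdist_lt => eps eps0.
have : (fun n => (2^-1 : R) ^+ n) @ \oo --> (0 : R).
  by apply: cvg_expr; rewrite ger0_norm ?invf_lt1 ?ltr1n // invr_ge0.
move/cvgrPdist_lt => /(_ (eps / (C + 1))) [|N _ HN]; first by rewrite divr_gt0 //; lra.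
exists (maxn N eta0) => // eta /=; rewrite geq_max => /andP[Neta eta0eta].
have := HN eta Neta; rewrite /= sub0r normrN ger0_norm ?exprn_ge0 // ltr_pdivlMr; last by lra.
move=> small.
have [n [l [e [[etaE l0 kl ln] [e2 he ne Xe [M MX MQ]]]]]] := param eta eta0eta.
pose good (Rel : {set word m eta}) := fixed_point_property s delta Rel.
(* An empty model would make the ratio 0; sets of M words belong to it, and they exist because M <=
   (2m)^eta. *)
have pres0 : 0 < #|presentations c m eta d|%:R :> R.
  rewrite ltr0n; apply/card_gt0P.
  have : (0 < #|[set A : {set word m eta} | #|A| == M]%SET|)%N.
    by rewrite card_draws bin_gt0 card_tuple card_prod card_ord card_bool mulnC.
  by move=> /card_gt0P[A]; rewrite inE => /eqP AM; exists A; rewrite inE AM.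
have bad : #|[set Rel in presentations c m eta d | ~~ good Rel]%SET|%:R
    <= C * (2^-1) ^+ eta * #|presentations c m eta d|%:R.
  move: e2 he Xe; rewrite {}/good; rewrite etaE => e2 he Xe.
  exact: (bad_presentations hm hs hdelta hk l0 kl ln e2 he ne Xe).
have split : #|presentations c m eta d|%:R =
   #|[set Rel in presentations c m eta d | good Rel]%SET|%:R
   + #|[set Rel in presentations c m eta d | ~~ good Rel]%SET|%:R :> R.
  rewrite -natrD -(cardsID [set Rel | good Rel]%SET); congr (_ + _)%:R.
    by apply: eq_card => A; rewrite !inE.
  by apply: eq_card => A; rewrite !inE andbC.
have -> : #|[set Rel in presentations c m eta d |
    `[< forall Y : metricType R, CAT0 Y -> delta_space Y <= delta ->
          has_F (quot_ncl (relators s Rel)) Y >]]%SET| =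
  #|[set Rel in presentations c m eta d | good Rel]%SET| by [].
have b0 := ler0n R #|[set Rel in presentations c m eta d | ~~ good Rel]%SET|.
have q0 : 0 <= (2^-1 : R) ^+ eta by rewrite exprn_ge0.
move: split bad pres0 small b0 q0.
move: (#|presentations c m eta d|%:R : R) (2^-1 ^+ eta : R) => P q.
move: (#|_|%:R : R) (#|_|%:R : R) => b a PE bad P0 small b0 q0.
have -> : 1 - a / P = b / P by rewrite PE; field; rewrite -PE gt_eqF.
rewrite ger0_norm ?divr_ge0 ?(ltW P0) // ltr_pdivrMr //; apply: le_lt_trans bad _.
by rewrite ltr_pM2r //; lra.
Qed.
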